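(* Let $p\in[1/4,1)$, $N\ge3$, $n\ge17$, $\epsilon>0$. The algorithm $\mathrm{PMWG}(X,F,\epsilon,0,\alpha,n,p)$ is $(\epsilon,0)$-differentially private, and for any $\kappa\ge1$ and $\beta\in(0,2^{-15/2})$ it is $(\alpha,\beta)$-accurate for every (adaptively chosen) query stream $F$ with $\sum_{\tau=n}^t\ell_\tau\le\kappa\sum_{\tau=n}^t\exp\!\big(\frac{\alpha^3(1-p)^2\epsilon n^{1-p}\tau^p}{6048\log(Nn)}\big)$ for all $t\ge n$, as long as $$\alpha\ge\left(\frac{6426\log(Nn)\log(144\kappa n/\beta)}{(1-p)^2n\epsilon}\right)^{1/3}.$$
   Context: Data universe $[N]$. A database of size $t$ is a histogram $x\in\Delta([N])\subseteq\mathbb R^N$ with $x^i=n_i/t$, $n_i\in\mathbb N$, $\sum_i n_i=t$; same-size databases are neighboring if they differ in one entry. A linear query is $f\in[0,1]^N$ with $f(x)=\langle f,x\rangle$. A database stream $X=\{x_t\}_{t\ge n}$ has $x_t$ of size $t$, $x_{t+1}$ obtained from $x_t$ by adding one entry; streams $X,X'$ are neighboring if for some $t\ge n$, $x_\tau=x'_\tau$ for $n\le\tau<t$ and $x_\tau,x'_\tau$ neighboring for $\tau\ge t$. A query stream $F=\{\{f_{t,j}\}_{j=1}^{\ell_t}\}_{t\ge n}$ of linear queries, $f_{t,j}$ arriving when the database has size $t$, may be chosen adaptively. An algorithm is $(\epsilon,\delta)$-differentially private if for all neighboring streams and every set $S$ of output transcripts, $\Pr[\mathcal A(X)\in S]\le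 e^\epsilon\Pr[\mathcal A(X')\in S]+\delta$. It is $(\alpha,\beta)$-accurate for $F$ if for every database stream, with probability at least $1-\beta$, every query $f_{t,j}$ receives an answer $a_{t,j}$ with $|f_{t,j}(x_t)-a_{t,j}|\le\alpha$. $\mathrm{Lap}(b)$ has density $\frac1{2b}e^{-|z|/b}$. Subroutines (threshold $T$, noise function $\xi$, on the database stream). NATG: when started it draws $\eta\sim\mathrm{Lap}(2)$; on each subsequent query $g$ arriving at time $t$ it draws fresh $\nu\sim\mathrm{Lap}(4/\xi_t)$; if $g(x_t)+\nu\ge T+\eta/\xi_t$ it outputs $g(x_t)+Z$, $Z\sim\mathrm{Lap}(8/\xi_t)$ fresh, and halts; otherwise outputs $\bot$. NSG: processes queries in order; whenever a query arrives and no NATG instance is running, it starts a fresh NATG instance with the same $T,\xi$; it outputs the running instance's answer. $\mathrm{PMWG}(X,F,\epsilon,\delta,\alpha,n,p)$ (generalized noise): set $\xi_t=\frac{\alpha^2(1-p)^2n^{1-p}}{126\log(Nn)}\epsilon t^p$ if $\delta=0$ and $\xi_t=\frac{\alpha(1-p)n^{1-p}}{24\log^{1/2}(Nn)\log^{1/2}(1/\delta)}\epsilon t^p$ if $\delta>0$. Run NSG with $T=2\alpha/3$ and noise $\xi$. Maintain a public histogram $y$, initially $y^i=1/N$, and a hard-query count $H=0$; let $b_t=\frac{\log N}{t}+\frac{\log(t-1)}{t}+\log\frac{t}{t-1}$. On query $f=f_{t,j}$: (1) if the previous query arrived at time $t'<t$, set $y^i\leftarrow\frac{t'}{t}y^i+\frac{t-t'}{t}\cdot\frac1N$;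 (2) submit to NSG the queries $g_1(x)=f(x)-f(y)$ and $g_2(x)=f(y)-f(x)$, getting $a_1,a_2\in\mathbb R\cup\{\bot\}$; (3) if $a_1=a_2=\bot$, output $f(y)$; (4) otherwise set $H\leftarrow H+1$; if $H>\frac{36}{\alpha^2}(\log N+\sum_{\tau=n+1}^t b_\tau)$ halt with output $\bot$; else output $a=f(y)+a_1$ if $a_1\in\mathbb R$ and $a=f(y)-a_2$ otherwise; let $r=f$ if $a<f(y)$ and $r=1-f$ otherwise, and update $y^i\leftarrow y^i e^{-\alpha r^i/6}/\sum_{i'}y^{i'}e^{-\alpha r^{i'}/6}$.
   Formalization: The privacy claim is stated for 0<α≤1 only: for large α it fails (e.g. N=3, n=17, p=1/4, ε=1, α=100, where the probabilities of output ⊥ on the first query differ by a factor of about e^2.84>e). The accuracy claim has no upper bound on α. *)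

(* Defs.v *)
From HB Require Import structures.
From mathcomp Require Import all_boot all_order all_algebra.
From mathcomp Require Import all_classical all_reals all_analysis.
Set Implicit Arguments.
Unset Strict Implicit.
Unset Printing Implicit Defensive.
Import Order.TTheory GRing.Theory Num.Theory.
Local Open Scope classical_set_scope.
Local Open Scope ring_scope.

(** * Databases, linear queries, database streams *)

Definition lin (R : realType) (N : nat) (f x : 'I_N -> R) : R :=
  \sum_(i < N) f i * x i.

Definition linear_query (R : realType) (N : nat) (f : 'I_N -> R) : Prop :=
  forall i, 0 <= f i <= 1.

Definition database (R : realType) (N t : nat) (x : 'I_N -> R) : Prop :=
  exists c : 'I_N -> nat,
    (\sum_(i < N) c i)%N = t /\ forall i, x i = (c i)%:R / t%:R.

Definition neighboring (R : realType) (N t : nat) (x x' : 'I_N -> R) : Prop :=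
  exists i i' : 'I_N, i != i' /\
    forall j, x' j = x j - (j == i)%:R / t%:R + (j == i')%:R / t%:R.

Definition add_entry (R : realType) (N t : nat) (x x' : 'I_N -> R) : Prop :=
  exists i : 'I_N, forall j, x' j = (t%:R * x j + (j == i)%:R) / t.+1%:R.

(* Only the values [X t] with [n <= t] are relevant. *)
Definition database_stream (R : realType) (N n : nat) (X : nat -> 'I_N -> R)
    : Prop :=
  (forall t, (n <= t)%N -> database t (X t)) /\
  (forall t, (n <= t)%N -> add_entry t (X t) (X t.+1)).

Definition neighboring_streams (R : realType) (N n : nat)
    (X X' : nat -> 'I_N -> R) : Prop :=
  exists t, [/\ (n <= t)%N,
    forall s, (n <= s < t)%N -> X s =1 X' s &
    forall s, (t <= s)%N -> neighboring s (X s) (X' s)].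

(** * Transcripts and adaptive query streams *)

(* A transcript lists the outputs in the order of the queries; [None] is the
   symbol bottom. *)
Definition transcript (R : realType) := nat -> option R.

(* The product sigma-algebra on transcripts. *)
Definition transcript_event (R : realType) : set (set (transcript R)) :=
  <<s [set S | exists (k : nat) (B : set R), measurable B /\
       S = [set a : transcript R | exists2 r, B r & a k = Some r]] >>.

(* An adaptively chosen query stream is a strategy: the [k]-th query and its
   arrival time are a function of the [k] previous outputs. [None] means that
   no query is asked at this step, so that the stream may be finite. *)
Definition strategy (R : realType) (N : nat) :=
  seq (option R) -> option (nat * ('I_N -> R)).

Definition asked (R : realType) (N : nat) (F : strategy R N)
    (a : transcript R) (k : nat) : option (nat * ('I_N -> R)) :=
  F (mkseq a k).

Definition queries_at (R : realType) (N : nat) (F : strategy R N)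
    (a : transcript R) (t : nat) : set nat :=
  [set k | exists f, asked F a k = Some (t, f)].

(* The number [ell_t] of queries arriving at time [t]. *)
Definition ell (R : realType) (N : nat) (F : strategy R N)
    (a : transcript R) (t : nat) : \bar R :=
  counting (queries_at F a t).

Record query_stream (R : realType) (N n : nat) (F : strategy R N) : Prop :=
  QueryStream {
    qs_linear : forall a k t f, asked F a k = Some (t, f) ->
      (n <= t)%N /\ linear_query f;
    qs_ordered : forall a k k' t t' f f', (k < k')%N ->
      asked F a k = Some (t, f) -> asked F a k' = Some (t', f') -> (t <= t')%N;
    qs_finite : forall a t, finite_set (queries_at F a t);
    qs_measurable : forall k t i (B : set R), measurable B ->
      @transcript_event R
        [set a | exists f, asked F a k = Some (t, f) /\ B (f i)] }.

(** * Privacy and accuracy of a mechanism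
    mapping a database stream to a random transcript *)

Definition differentially_private (R : realType) (d : measure_display)
    (Omega : measurableType d) (P : probability Omega R) (N n : nat)
    (A : (nat -> 'I_N -> R) -> Omega -> transcript R) (eps delta : R) : Prop :=
  forall X X', database_stream n X -> database_stream n X' ->
    neighboring_streams n X X' ->
    forall S, transcript_event S ->
    (P [set w | S (A X w)] <=
       (expR eps)%:E * P [set w | S (A X' w)] + delta%:E)%E.

Definition accurate (R : realType) (d : measure_display)
    (Omega : measurableType d) (P : probability Omega R) (N n : nat)
    (A : (nat -> 'I_N -> R) -> Omega -> transcript R) (F : strategy R N)
    (alpha beta : R) : Prop :=
  forall X, database_stream n X ->
    ((1 - beta)%:E <=
      P [set w | forall k t f, asked F (A X w) k = Some (t, f) ->
           exists2 v, A X w k = Some v & (`|lin f (X t) - v| <= alpha)%R])%E.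

(** * Noise *)

Definition laplace_pdf (R : realType) (b z : R) : R :=
  1 / (2 * b) * expR (- (`|z| / b)).

Definition laplace_distributed (R : realType) (d : measure_display)
    (Omega : measurableType d) (P : probability Omega R)
    (V : {RV P >-> R}) (b : R) : Prop :=
  forall B : set R, measurable B ->
    (distribution P V B =
       \int[lebesgue_measure]_(z in B) (laplace_pdf b z)%:E)%E.

Definition mutually_independent (R : realType) (d : measure_display)
    (Omega : measurableType d) (P : probability Omega R) (D : Type)
    (V : D -> {RV P >-> R}) : Prop :=
  forall (m : nat) (s : 'I_m -> D) (B : 'I_m -> set R),
    injective s -> (forall i, measurable (B i)) ->
    P [set w | forall i, B i (V (s i) w)] =
      (\prod_(i < m) P (V (s i) @^-1` B i))%E.

(* One index for each random draw the algorithm may make: the [k]-th query, if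
   it arrives at time [t], is turned into the two NSG queries [g_1] ([false])
   and [g_2] ([true]); each of them uses its own [Nu] and, when it is answered,
   its own [Zed], and its own [Eta] if a NATG instance is started for it.
   [Nu k t s] and [Zed k t s] are separate draws for each [t] because the
   arrival time of the [k]-th query, hence the scale of the noise, may depend
   on the previous outputs. *)
Inductive draw :=
  | Eta of nat & bool
  | Nu of nat & nat & bool
  | Zed of nat & nat & bool.

(* Independent noise with the prescribed Laplace laws; draws for times before
   [n] are never made and are left unconstrained (the scale is 0 at [t = 0]). *)
Record noise_draws (R : realType) (d : measure_display)
    (Omega : measurableType d) (P : probability Omega R) (n : nat)
    (xi : nat -> R) (V : draw -> {RV P >-> R}) : Prop := NoiseDraws {
  noise_indep : mutually_independent V;
  noise_eta : forall k s, laplace_distributed (V (Eta k s)) 2;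
  noise_nu : forall k t s, (n <= t)%N ->
    laplace_distributed (V (Nu k t s)) (4 / xi t);
  noise_zed : forall k t s, (n <= t)%N ->
    laplace_distributed (V (Zed k t s)) (8 / xi t) }.

(** * The algorithms *)

(* One query of value [v] submitted to a running NATG instance with threshold
   noise [eta]. *)
Definition natg (R : realType) (T xit eta nu z v : R) : option R :=
  if T + eta / xit <= v + nu then Some (v + z) else None.

(* [st] is the threshold noise of the running NATG instance, [None] if no
   instance is running; a new instance would use [eta0]. Returns the answer and
   the new state. *)
Definition nsg (R : realType) (T xit : R) (st : option R) (eta0 nu z v : R)
    : option R * option R :=
  let eta := odflt eta0 st in
  let a := natg T xit eta nu z v in
  (a, if a is Some _ then None else Some eta).

Definition xi_noise (R : realType) (N : nat) (eps delta alpha : R) (n : nat)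
    (p : R) (t : nat) : R :=
  if delta == 0 then
    alpha ^+ 2 * (1 - p) ^+ 2 * n%:R `^ (1 - p) / (126 * ln (N * n)%:R)
      * eps * t%:R `^ p
  else
    alpha * (1 - p) * n%:R `^ (1 - p)
      / (24 * Num.sqrt (ln (N * n)%:R) * Num.sqrt (ln (1 / delta)))
      * eps * t%:R `^ p.

Definition b_seq (R : realType) (N t : nat) : R :=
  ln N%:R / t%:R + ln (t%:R - 1) / t%:R + ln (t%:R / (t%:R - 1)).

Definition hard_bound (R : realType) (N : nat) (alpha : R) (n t : nat) : R :=
  36 / alpha ^+ 2 * (ln N%:R + \sum_(n.+1 <= s < t.+1) b_seq R N s).

Record pmwg_state (R : realType) (N : nat) := PMWGState {
  pub : 'I_N -> R;            (* the public histogram y *)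
  hard : nat;                 (* the hard-query count H *)
  prev_time : option nat;          (* arrival time of the previous query *)
  inst : option R;            (* state of NSG *)
  halted : bool }.

Definition pmwg_init (R : realType) (N : nat) : pmwg_state R N :=
  PMWGState (fun=> 1 / N%:R) 0 None None false.

Definition pub_age (R : realType) (N : nat) (prev : option nat) (t : nat)
    (y : 'I_N -> R) : 'I_N -> R :=
  if prev is Some t' then
    if (t' < t)%N then
      fun i => t'%:R / t%:R * y i + (t - t')%:R / t%:R * (1 / N%:R)
    else y
  else y.

Definition pub_update (R : realType) (N : nat) (alpha : R) (r y : 'I_N -> R)
    : 'I_N -> R :=
  fun i => y i * expR (- (alpha * r i / 6)) /
    \sum_(i' < N) y i' * expR (- (alpha * r i' / 6)).

(* Processing of the [k]-th query [f], arriving at time [t] when the database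
   is [x]; [v] gives the values of the random draws. After halting there is no
   further output, which is recorded as bottom. *)
Definition pmwg_step (R : realType) (N : nat) (xi : nat -> R) (alpha : R)
    (n : nat) (v : draw -> R) (k t : nat) (x f : 'I_N -> R)
    (st : pmwg_state R N) : option R * pmwg_state R N :=
  if halted st then (None, st) else
  let T := 2 * alpha / 3 in
  let y := pub_age (prev_time st) t (pub st) in
  let submit side st' g := nsg T (xi t) st' (v (Eta k side)) (v (Nu k t side))
                             (v (Zed k t side)) g in
  let: (a1, st1) := submit false (inst st) (lin f x - lin f y) in
  let: (a2, st2) := submit true st1 (lin f y - lin f x) in
  let hard_query a :=
    let H := (hard st).+1 in
    if hard_bound N alpha n t < H%:R then
      (None, PMWGState y H (Some t) st2 true)
    else
      let r := if a < lin f y then f else fun i => 1 - f i in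
      (Some a, PMWGState (pub_update alpha r y) H (Some t) st2 false) in
  match a1, a2 with
  | None, None =>
      (Some (lin f y), PMWGState y (hard st) (Some t) st2 false)
  | Some z, _ => hard_query (lin f y + z)
  | None, Some z => hard_query (lin f y - z)
  end.

(* State and list of outputs after the first [k] steps. *)
Fixpoint pmwg_run (R : realType) (N : nat) (xi : nat -> R) (alpha : R)
    (n : nat) (v : draw -> R) (X : nat -> 'I_N -> R) (F : strategy R N)
    (k : nat) : pmwg_state R N * seq (option R) :=
  if k is k'.+1 then
    let: (st, h) := pmwg_run xi alpha n v X F k' in
    match F h with
    | None => (st, rcons h None)
    | Some (t, f) =>
        let: (a, st') := pmwg_step xi alpha n v k' t (X t) f st in
        (st', rcons h a)
    end
  else (pmwg_init R N, [::]).

Definition pmwg (R : realType) (N : nat) (d : measure_display)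
    (Omega : measurableType d) (P : probability Omega R)
    (V : draw -> {RV P >-> R}) (X : nat -> 'I_N -> R) (F : strategy R N)
    (eps delta alpha : R) (n : nat) (p : R) (w : Omega) : transcript R :=
  fun k => nth None
    (pmwg_run (xi_noise N eps delta alpha n p) alpha n (fun i => V i w) X F
       k.+1).2 k.

(* Main.v *)
(* Privacy. A run on the stream [X] is turned into a run on a neighbouring
   stream [X'] with the same transcript by shifting the noise: the threshold
   noise of an instance started at time [s] moves by [xi s / s], and at the
   query that ends the instance the comparison noise and the answer noise are
   moved to compensate for the change of threshold and of query value. As
   [xi t / t] decreases in [t], one instance costs at most [9/8 * xi s / s].
   A hard query ends at most two instances, and the budget [hard_bound] on hard
   queries makes the total cost summable, with sum at most [eps]. This gives
   the inequality for events that depend on finitely many outputs, and such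
   events approximate all events of the product sigma-algebra.

   Accuracy. Outside an event of probability at most [beta], found by a union
   bound over the queries that are actually asked (their number is controlled
   pathwise, hence in expectation, and Abel summation is applied), all noise is
   small. Then the cross entropy of the database with respect to the public
   histogram grows by at most [b_seq] per unit of time and drops by
   [alpha ^+ 2 / 36] at each hard query, so the algorithm never halts. *)
Require Import Defs.
From HB Require Import structures.
From mathcomp Require Import all_boot all_order all_algebra.
From mathcomp Require Import all_classical all_reals all_analysis.
From mathcomp Require Import measurable_realfun.
From mathcomp Require Import ring lra.
Set Implicit Arguments.
Unset Strict Implicit.
Unset Printing Implicit Defensive.
Import Order.TTheory GRing.Theory Num.Theory.
Local Open Scope classical_set_scope.
Local Open Scope ring_scope.

(** * Independent coordinates *)

(** The obstacle is adaptivity: which draws are used, their scale and their shift depend on earlier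
    noise, so the coupling is not a fixed translation of a product space. It is composed of
    translations of one coordinate each, by an amount that reads only other coordinates, on an event
    that the translation preserves. With the other coordinates frozen, each of them is a
    one-dimensional Laplace estimate. The composed map is never inverted and its density never
    computed: a map [Psi] carries a weight [w] such that the integral of [w * (G \o Psi)] is at most
    that of [G], and such inequalities compose. A random arrival time is handled by a countable
    partition that the map preserves. The price [9/8] of an instance, in units of its shift, is
    [1/2] for the threshold noise, of scale 2, at most [(1 + 1) / 4] for the comparison noise, which
    makes up for a higher threshold and for a lower query value, and at most [1/8] for the answer
    noise. *)

Definition coord_set (R : realType) (D : Type) : set (set (D -> R)) :=
  [set A | exists (i : D) (B : set R), measurable B /\ A = [set v | B (v i)]].

(** A named copy of [D -> R], so that the product sigma-algebra is attached to this name and not to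
    every function type. *)
Definition coord_space (R : realType) (D : Type) := D -> R.

HB.instance Definition _ (R : realType) (D : Type) :=
  gen_eqMixin (coord_space R D).
HB.instance Definition _ (R : realType) (D : Type) :=
  gen_choiceMixin (coord_space R D).
HB.instance Definition _ (R : realType) (D : Type) :=
  isPointed.Build (coord_space R D) (fun=> 0).
HB.instance Definition _ (R : realType) (D : Type) :=
  @isMeasurable.Build (sigma_display (@coord_set R D)) (coord_space R D)
    <<s @coord_set R D >> (@sigma_algebra0 _ setT (@coord_set R D))
    (@sigma_algebraC (coord_space R D) (@coord_set R D))
    (@sigma_algebra_bigcup _ setT (@coord_set R D)).

Section coord_space.
Context {R : realType} {D : eqType}.
Local Notation space := (coord_space R D).

Lemma measurable_coord (i : D) : measurable_fun setT (fun v : space => v i).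
Proof.
move=> _ B mB; rewrite setTI; apply: sub_sigma_algebra.
by exists i, B.
Qed.

Lemma measurable_to_coord (d : measure_display) (T : measurableType d)
    (g : T -> space) :
  (forall i, measurable_fun setT (fun x => g x i)) -> measurable_fun setT g.
Proof.
move=> mg; apply: (@measurability _ _ T space setT g (@coord_set R D)) => //.
move=> _ [_ [i [B [mB ->]]] <-].
exact: mg.
Qed.

Definition upd (v : space) (i : D) (z : R) : space :=
  fun j => if j == i then z else v j.

Lemma upd_same v i z : upd v i z i = z.
Proof. by rewrite /upd eqxx. Qed.

Lemma upd_other v i j z : j != i -> upd v i z j = v j.
Proof. by rewrite /upd => /negbTE ->. Qed.

Lemma upd_upd v i z z' : upd (upd v i z) i z' = upd v i z'.
Proof. by apply/funext => j; rewrite /upd; case: eqP. Qed.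

Lemma measurable_upd (d : measure_display) (T : measurableType d)
    (g : T -> space) (i : D) (z : T -> R) :
  measurable_fun setT g -> measurable_fun setT z ->
  measurable_fun setT (fun x => upd (g x) i (z x)).
Proof.
move=> mg mz; apply: measurable_to_coord => j; rewrite /upd.
case: eqP => // _.
exact: measurableT_comp (measurable_coord j) mg.
Qed.

Definition cylinder (s : seq D) (B : D -> set R) : set space :=
  [set v | forall i, i \in s -> B i (v i)].

(** The pi-system on which laws are compared. Coordinates are listed without repetition so that the
    probability of a cylinder is a product over the list. *)
Definition cylinders : set (set space) :=
  [set A | exists (s : seq D) (B : D -> set R),
     [/\ uniq s, forall i, measurable (B i) & A = cylinder s B]].

Lemma cylinders_measurable A : cylinders A -> measurable A.
Proof.
move=> [s [B [_ mB ->]]].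
elim: s => [|i s IHs].
  by rewrite (_ : cylinder [::] B = setT) //; apply/seteqP; split.
rewrite (_ : cylinder (i :: s) B = [set v : space | B i (v i)] `&` cylinder s B).
  apply: measurableI => //.
  by rewrite -[X in measurable X]setTI; exact: measurable_coord.
apply/seteqP; split => v /=.
  move=> h; split; first by apply: h; rewrite inE eqxx.
  by move=> j js; apply: h; rewrite inE js orbT.
by move=> [h1 h2] j; rewrite inE => /predU1P[->|/h2].
Qed.

Lemma measurable_cylinders : measurable = <<s cylinders >> :> set (set space).
Proof.
apply/seteqP; split.
- apply: smallest_sub; first exact: smallest_sigma_algebra.
  move=> _ [i [B [mB ->]]]; apply: sub_sigma_algebra.
  exists [:: i], (fun=> B); split => //.
  apply/seteqP; split => v /=.
    by move=> h j; rewrite inE => /eqP ->.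
  by move=> h; apply: h; rewrite inE.
- apply: smallest_sub; first exact: sigma_algebra_measurable.
  exact: cylinders_measurable.
Qed.

Lemma cylinders_setI : setI_closed cylinders.
Proof.
move=> _ _ [s1 [B1 [_ m1 ->]]] [s2 [B2 [_ m2 ->]]].
exists (undup (s1 ++ s2)), (fun i => (if i \in s1 then B1 i else setT) `&`
   (if i \in s2 then B2 i else setT)); split.
- exact: undup_uniq.
- by move=> i; apply: measurableI; case: ifP.
apply/seteqP; split => v /=.
  by move=> [h1 h2] i _; split; case: ifP => // hi; [apply: h1|apply: h2].
move=> h; split => i hi; have := h i; rewrite mem_undup mem_cat hi ?orbT => /(_ isT).
  by case.
by case.
Qed.

Section independent_coordinates.
Context (d : measure_display) (Omega : measurableType d)
  (P : probability Omega R) (V : D -> {RV P >-> R}).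

Definition noise_of (w : Omega) : space := fun i => V i w.

Lemma measurable_noise_of : measurable_fun setT noise_of.
Proof. by apply: measurable_to_coord => i; exact: measurable_funP. Qed.

HB.instance Definition _ := isMeasurableFun.Build _ _ _ _ noise_of
  measurable_noise_of.

Definition joint_law : probability space R := distribution P noise_of.

Hypothesis indepV : mutually_independent V.

Lemma joint_law_cylinder (s : seq D) (B : D -> set R) :
  uniq s -> (forall i, measurable (B i)) ->
  joint_law (cylinder s B) = (\prod_(i <- s) distribution P (V i) (B i))%E.
Proof.
case: s => [|i0 s].
  move=> _ _; rewrite big_nil (_ : cylinder [::] B = setT) ?probability_setT//.
  by apply/seteqP; split.
set s' := i0 :: s => us mB.
have := indepV (s := fun j : 'I_(size s') => nth i0 s' j) (B := fun j => B (nth i0 s' j)).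
move=> /(_ _ (fun j => mB _)).
have inj : injective (fun j : 'I_(size s') => nth i0 s' j).
  by move=> j j' /eqP; rewrite nth_uniq // => /eqP /val_inj.
move=> /(_ inj) h.
rewrite (big_nth i0) big_mkord -[RHS]h.
congr (P _); apply/seteqP; split => w /=.
  by move=> hw j; apply: hw; rewrite mem_nth.
move=> hw i /(nthP i0) [j js <-].
exact: (hw (Ordinal js)).
Qed.

Definition resample (i : D) (vz : space * R) : space := upd vz.1 i vz.2.

Lemma measurable_resample i : measurable_fun setT (resample i).
Proof.
apply: measurable_upd; first exact: measurable_fst.
exact: measurable_snd.
Qed.

HB.instance Definition _ i := isMeasurableFun.Build _ _ _ _ (resample i)
  (measurable_resample i).

(** The form in which independence is used. The preimage of a cylinder under [resample i] is a
    rectangle, in which the constraint on coordinate [i], if any, has moved to the second factor. *)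
Lemma joint_law_resample (i : D) (A : set space) : measurable A ->
  joint_law A = pushforward (joint_law \x distribution P (V i))%E (resample i) A.
Proof.
have cT : cylinders setT.
  exists [::], (fun=> setT); split => //.
  by apply/seteqP; split.
apply: (measure_unique cylinders (fun=> setT)) => //.
- exact: measurable_cylinders.
- exact: cylinders_setI.
- by apply/seteqP; split => // x _; exists 0%N.
- move=> _ [s [B [us mB ->]]].
  change (joint_law (cylinder s B) =
    (joint_law \x distribution P (V i))%E (resample i @^-1` cylinder s B)).
  have [si|si] := boolP (i \in s); last first.
    have -> : resample i @^-1` cylinder s B = cylinder s B `*` setT.
      apply/seteqP; split => -[v z] /=.
        move=> h; split => // j js; have := h j js.
        by rewrite /resample /= upd_other //; apply: contraNneq si => <-.
      move=> [h _] j js; rewrite /resample /= upd_other; first exact: h.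
      by apply: contraNneq si => <-.
    rewrite product_measure1E//; last by apply: cylinders_measurable; exists s, B.
    by rewrite [X in (_ * X)%E]probability_setT mule1.
  have -> : resample i @^-1` cylinder s B = cylinder (rem i s) B `*` B i.
    apply/seteqP; split => -[v z] /=.
      move=> h; split; last by have := h i si; rewrite /resample /= upd_same.
      move=> j; rewrite mem_rem_uniq // inE => /andP[ji js]; have := h j js.
      by rewrite /resample /= upd_other.
    move=> [h hz] j js; rewrite /resample /=.
    have [->|ji] := eqVneq j i; first by rewrite upd_same.
    by rewrite upd_other //; apply: h; rewrite mem_rem_uniq // inE ji.
  rewrite product_measure1E//; last first.
    by apply: cylinders_measurable; exists (rem i s), B; split => //; exact: rem_uniq.
  rewrite joint_law_cylinder // (perm_big _ (perm_to_rem si)) /= big_cons muleC.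
  by congr (_ * _)%E; rewrite -joint_law_cylinder ?rem_uniq.
- move=> _; apply: le_lt_trans (ltry 1).
  exact: probability_le1.
Qed.

(** With Tonelli, all coordinates but [i] are frozen, and statements on the joint law reduce to
    one-dimensional ones. *)
Lemma integral_resample (i : D) (G : space -> \bar R) :
  measurable_fun [set: space] G -> (forall v, 0 <= G v)%E ->
  (\int[joint_law]_v G v =
   \int[joint_law]_v \int[distribution P (V i)]_z G (upd v i z))%E.
Proof.
move=> mG G0.
transitivity (\int[pushforward (joint_law \x distribution P (V i))%E (resample i)]_v G v)%E.
  by apply: eq_measure_integral => A mA _; exact: joint_law_resample.
rewrite (ge0_integral_pushforward (measurable_resample i)) // preimage_setT.
rewrite fubini_tonelli1 //.
- exact: measurableT_comp mG (measurable_resample i).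
- by move=> vz; exact: G0.
Qed.

End independent_coordinates.
End coord_space.

(** * The Laplace distribution *)

Section laplace.
Context {R : realType}.

Lemma lebesgue_measure_shift (s : R) (A : set R) : measurable A ->
  pushforward lebesgue_measure (fun z : measurableTypeR R => z + s) A =
  lebesgue_measure A.
Proof.
have ms : measurable_fun setT (fun z : measurableTypeR R => (z + s : measurableTypeR R)).
  exact: measurable_funD.
pose ms_mixin := isMeasurableFun.Build _ _ _ _ _ ms.
pose ms_pack : {mfun _ >-> _} := HB.pack (fun z : measurableTypeR R => (z + s : measurableTypeR R)) ms_mixin.
move=> mA; apply/esym.
apply: (@lebesgue_measure_unique _ (pushforward lebesgue_measure ms_pack)) => //= _ [[a b]] _ <-.
rewrite /pushforward/=.
rewrite [X in _ = lebesgue_measure X](_ : _ = `]a - s, b - s]%classic); last first.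
  by apply/seteqP; split => z /=; rewrite !in_itv /= ltrBlDr lerBrDr.
rewrite !lebesgue_measure_itv /= !lte_fin ltrD2r.
by case: ifP => // _; rewrite -!EFinB; congr (_%:E); ring.
Qed.

Lemma laplace_pdf_ge0 (b z : R) : 0 < b -> 0 <= laplace_pdf b z.
Proof.
by move=> b0; rewrite /laplace_pdf mulr_ge0 ?expR_ge0// divr_ge0// mulr_ge0// ltW.
Qed.

Lemma measurable_laplace_pdf (b : R) : measurable_fun setT (laplace_pdf b).
Proof.
apply: measurable_funM => //.
apply: measurableT_comp => //.
apply: measurableT_comp => //.
apply: measurable_funM => //.
Qed.

Section distribution.
Context (d : measure_display) (Omega : measurableType d)
  (P : probability Omega R) (V : {RV P >-> R}) (b : R) (b0 : 0 < b)
  (lapV : laplace_distributed V b).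

(** The densities are compared only where [z + s] lies in [A]: the tail bound needs a small ratio
    that is available on a half-line only. *)
Lemma laplace_shift_set (s K : R) (A : set R) : measurable A -> 0 <= K ->
  (forall z, A (z + s) -> laplace_pdf b (z + s) <= K * laplace_pdf b z) ->
  (distribution P V A <= K%:E * distribution P V [set z | A (z + s)%R])%E.
Proof.
move=> mA K0 hK.
have ms : measurable_fun setT (fun z : measurableTypeR R => (z + s : measurableTypeR R)).
  exact: measurable_funD.
have mAs : measurable [set z | A (z + s)].
  by rewrite -[X in measurable X]setTI; exact: ms.
have mpdf D : measurable_fun D (fun z => (laplace_pdf b z)%:E).
  by apply/measurable_EFinP; apply: measurable_funTS; exact: measurable_laplace_pdf.
have pdf0 z : (0 <= (laplace_pdf b z)%:E)%E by rewrite lee_fin laplace_pdf_ge0.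
rewrite !lapV//.
rewrite [leLHS](eq_measure_integral (pushforward lebesgue_measure
   (fun z : measurableTypeR R => (z + s : measurableTypeR R)))); last first.
  by move=> B mB _; exact/esym/lebesgue_measure_shift.
rewrite (ge0_integral_pushforward ms)//.
rewrite -ge0_integralZl//.
apply: ge0_le_integral => //=.
- apply: (@measurableT_comp _ _ _ _ _ _ (fun z => (laplace_pdf b z)%:E)) => //.
  exact: (measurable_funTS ms).
- by apply: measurable_funeM; exact: mpdf.
- exact: mpdf.
- exact: mpdf.
Qed.

Lemma laplace_pdf_shift (s z : R) :
  laplace_pdf b (z + s) <= expR (`|s| / b) * laplace_pdf b z.
Proof.
rewrite /laplace_pdf mulrCA ler_wpM2l//.
  by rewrite divr_ge0// mulr_ge0// ltW.
rewrite -expRD ler_expR -mulrBl -mulNr ler_pM2r ?invr_gt0//.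
have := ler_normD (z + s) (- s).
rewrite addrK normrN => h; lra.
Qed.

(** Checked on sets first: the law pushed forward by the translation and scaled by the weight is a
    smaller measure, by [laplace_shift_set] with shift [- s]. The integrals then compare. *)
Lemma integral_laplace_shift (s : R) (g : R -> \bar R) :
  measurable_fun setT g -> (forall z, 0 <= g z)%E ->
  (\int[distribution P V]_z ((expR (- (`|s| / b)))%:E * g (z + s)%R) <=
   \int[distribution P V]_z g z)%E.
Proof.
move=> mg g0.
have ms : measurable_fun setT (fun z : R => z + s) by exact: measurable_funD.
pose ms_mixin := isMeasurableFun.Build _ _ _ _ _ ms.
pose ms_pack : {mfun _ >-> _} := HB.pack (fun z : R => z + s) ms_mixin.
have e0 := expR_ge0 (- (`|s| / b)).
rewrite ge0_integralZl//; last exact: measurableT_comp mg ms.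
rewrite -[X in (_ * X)%E](@ge0_integral_pushforward _ _ _ _ _ _ ms _ setT)//.
rewrite (_ : expR _ = (NngNum e0)%:num)//.
rewrite -(ge0_integral_mscale (pushforward (distribution P V) ms_pack))//.
apply: ge0_le_measure_integral => // S mS.
rewrite /mscale /=.
have := @laplace_shift_set (- s) (expR (`|s| / b)) [set z | S (z + s)].
rewrite /pushforward/=.
move=> /(_ _ (expR_ge0 _)) h.
have {h} : (distribution P V [set z | S (z + s)%R] <=
    (expR (`|s| / b))%:E * distribution P V S)%E.
  rewrite [X in (_ * _ X)%E](_ : S = [set z | S (z - s + s)]); last first.
    by apply/seteqP; split => z /=; rewrite subrK.
  apply: h.
    by have := ms measurableT _ mS; rewrite setTI.
  by move=> z _; rewrite -(normrN s); exact: laplace_pdf_shift.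
move=> /(lee_wpmul2l (x := (expR (- (`|s| / b)))%:E)).
rewrite lee_fin => /(_ e0) /le_trans; apply.
by rewrite muleA -EFinM -expRD addNr expR0 mul1e.
Qed.

(* The factor 2 is not optimal: each half-line is bounded by a shift of the
   half-line starting at 0, whose probability is only bounded by 1. *)
Lemma laplace_tail (u : R) : 0 <= u ->
  (distribution P V [set z | u <= `|z|]%R <= (2 * expR (- (u / b)))%:E)%E.
Proof.
move=> u0.
have mA : measurable `[u, +oo[%classic by exact: measurable_itv.
have mB : measurable `]-oo, (- u)]%classic by exact: measurable_itv.
have h1 : (distribution P V `[u, +oo[%classic <= (expR (- (u / b)))%:E)%E.
  have := @laplace_shift_set u (expR (- (u / b))) `[u, +oo[%classic mA (expR_ge0 _).
  move=> h; apply: (le_trans (h _)).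
    move=> z /=; rewrite in_itv/= andbT => uz.
    rewrite /laplace_pdf mulrCA ler_wpM2l//.
      by rewrite divr_ge0// mulr_ge0// ltW.
    rewrite -expRD ler_expR -!mulNr -mulrDl ler_pM2r ?invr_gt0//.
    have z0 : 0 <= z by lra.
    by rewrite !ger0_norm//; lra.
  rewrite -[leRHS]mule1; apply: lee_wpmul2l; first by rewrite lee_fin expR_ge0.
  apply: probability_le1; rewrite -[X in measurable X]setTI.
  by apply: (measurable_funD _ _ _ mA).
have h2 : (distribution P V `]-oo, (- u)%R]%classic <= (expR (- (u / b)))%:E)%E.
  have := @laplace_shift_set (- u) (expR (- (u / b))) `]-oo, (- u)]%classic mB (expR_ge0 _).
  move=> h; apply: (le_trans (h _)).
    move=> z /=; rewrite in_itv/= => uz.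
    rewrite /laplace_pdf mulrCA ler_wpM2l//.
      by rewrite divr_ge0// mulr_ge0// ltW.
    rewrite -expRD ler_expR -!mulNr -mulrDl ler_pM2r ?invr_gt0//.
    have z0 : z <= 0 by lra.
    by rewrite !ler0_norm//; lra.
  rewrite -[leRHS]mule1; apply: lee_wpmul2l; first by rewrite lee_fin expR_ge0.
  apply: probability_le1; rewrite -[X in measurable X]setTI.
  by apply: (measurable_funD _ _ _ mB).
rewrite (_ : [set z | u <= `|z|] = `[u, +oo[%classic `|` `]-oo, (- u)]%classic).
  apply: le_trans (measureU2 _ mA mB) _.
  by rewrite mulr_natl mulr2n EFinD leeD.
apply/seteqP; split => z /=; rewrite !in_itv/= andbT ler_normr.
  by move=> /orP[?|?]; [left|right]; lra.
by move=> [?|?]; apply/orP; [left|right]; lra.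
Qed.

End distribution.
End laplace.

(** * Transformations dominated by the law *)

(** Countably many measurable pieces glue. This is needed because the arrival time of a query, and
    with it the index and the scale of its draws, is itself random. *)
Lemma measurable_fun_case (d d' : measure_display) (T : measurableType d)
    (U : measurableType d') (c : T -> nat) (g : nat -> T -> U) :
  (forall t, measurable [set x | c x = t]) ->
  (forall t, measurable_fun setT (g t)) ->
  measurable_fun setT (fun x => g (c x) x).
Proof.
move=> mc mg _ B mB; rewrite setTI.
rewrite (_ : _ @^-1` B = \bigcup_t ([set x | c x = t] `&` g t @^-1` B)).
  apply: bigcupT_measurable => t; apply: measurableI => //.
  by rewrite -[X in measurable X]setTI; exact: mg.
apply/seteqP; split => x /=; first by move=> ?; exists (c x).
by move=> [t _ [/= <-]].
Qed.

Section dominated.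
Context {R : realType} {d : measure_display} {T : measurableType d}.
Variable mu : {measure set T -> \bar R}.

(* [w] bounds from below the inverse of the density of [mu] pushed forward
   along [Psi], so that privacy loss is [- ln w]. *)
Record dominated (Psi : T -> T) (w : T -> R) : Prop := Dominated {
  dominated_map : measurable_fun setT Psi;
  dominated_weight : measurable_fun setT w;
  dominated_ge0 : forall x, 0 <= w x;
  dominated_integral : forall G : T -> \bar R, measurable_fun setT G ->
    (forall x, 0 <= G x)%E ->
    (\int[mu]_x ((w x)%:E * G (Psi x)) <= \int[mu]_x G x)%E }.

Lemma dominated_id : dominated id (fun=> 1).
Proof.
split => // G mG G0.
by under eq_integral do rewrite mul1e.
Qed.

Lemma dominated_integrand (Psi : T -> T) (w : T -> R) (G : T -> \bar R) :
  measurable_fun setT Psi -> measurable_fun setT w -> measurable_fun setT G ->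
  measurable_fun setT (fun x => ((w x)%:E * G (Psi x))%E).
Proof.
move=> mPsi mw mG; apply: emeasurable_funM; first exact/measurable_EFinP.
exact: measurableT_comp mG mPsi.
Qed.

(** Privacy losses add. The loss of the outer map is read at the image under the inner one, so later
    uses have to check that the inner map does not affect it. *)
Lemma dominated_comp (Psi1 Psi2 : T -> T) (w1 w2 : T -> R) :
  dominated Psi1 w1 -> dominated Psi2 w2 ->
  dominated (Psi1 \o Psi2) (fun x => w2 x * w1 (Psi2 x)).
Proof.
move=> [m1 mw1 p1 h1] [m2 mw2 p2 h2]; split.
- exact: measurableT_comp.
- by apply: measurable_funM => //; exact: measurableT_comp.
- by move=> x; exact: mulr_ge0.
move=> G mG G0; apply: le_trans (h1 G mG G0).
apply: le_trans (h2 (fun x => (w1 x)%:E * G (Psi1 x))%E _ _).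
- by under eq_integral do rewrite EFinM -muleA.
- exact: dominated_integrand.
- by move=> x; rewrite mule_ge0// lee_fin.
Qed.

Lemma dominated_le (Psi : T -> T) (w w' : T -> R) : dominated Psi w ->
  measurable_fun setT w' -> (forall x, 0 <= w' x <= w x) -> dominated Psi w'.
Proof.
move=> [m mw p h] mw' ww'; split => //.
  by move=> x; have /andP[] := ww' x.
move=> G mG G0; apply: le_trans (h G mG G0).
apply: ge0_le_integral => //.
- by move=> x _; have /andP[w0 _] := ww' x; rewrite mule_ge0// lee_fin.
- exact: dominated_integrand.
- exact: dominated_integrand.
- by move=> x _; have /andP[_ ww] := ww' x; rewrite lee_wpmul2r// lee_fin.
Qed.

(** By the last premise each map keeps its piece of the partition, so distinct pieces have disjoint
    images and the inequalities on the pieces add up without counting mass twice. *)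
Lemma dominated_case (c : T -> nat) (Psi : nat -> T -> T) (w : nat -> T -> R) :
  (forall t, measurable [set x | c x = t]) ->
  (forall t, dominated (Psi t) (w t)) ->
  (forall x, c (Psi (c x) x) = c x) ->
  dominated (fun x => Psi (c x) x) (fun x => w (c x) x).
Proof.
move=> mc dom cPsi.
have mPsi : measurable_fun setT (fun x => Psi (c x) x).
  by apply: measurable_fun_case => // t; exact: dominated_map (dom t).
have mw : measurable_fun setT (fun x => w (c x) x).
  by apply: measurable_fun_case => // t; exact: dominated_weight (dom t).
split => // [x|G mG G0]; first exact: dominated_ge0 (dom _) _.
have TE : [set: T] = \bigcup_t [set x | c x = t].
  by apply/seteqP; split => x // _; exists (c x).
have tr : trivIset setT (fun t => [set x | c x = t]).
  by apply/trivIsetP => i j _ _ ij; apply/seteqP; split => x // -[/= ci cj];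
     move: ij; rewrite -ci -cj eqxx.
have wG0 x : (0 <= (w (c x) x)%:E * G (Psi (c x) x))%E.
  by rewrite mule_ge0// lee_fin; exact: dominated_ge0 (dom _) _.
rewrite TE ge0_integral_bigcup//; last first.
  by apply: measurable_funTS; exact: dominated_integrand.
rewrite ge0_integral_bigcup//; last exact: measurable_funTS.
apply: lee_nneseries => t _; first by move=> _; apply: integral_ge0.
(* The inequality for [Psi t] is one on the whole space; applied to [G] cut off outside piece [t],
   it gives the one on the piece. *)
pose Gt x := (if c x == t then G x else 0)%E.
have mct : measurable_fun setT (fun x => c x == t).
  apply: (measurable_fun_bool true) => /=.
  rewrite setTI (_ : _ @^-1` _ = [set x | c x = t])//.
  by apply/seteqP; split => x /= /eqP.
have mGt : measurable_fun setT Gt by exact: measurable_fun_ifT.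
have Gt0 x : (0 <= Gt x)%E by rewrite /Gt; case: ifP.
have -> : (\int[mu]_(x in [set x | c x = t]) G x = \int[mu]_x Gt x)%E.
  rewrite integral_mkcond; apply: eq_integral => x _.
  rewrite /Gt patchE; case: ifPn; rewrite ?inE ?notin_setE /=.
    by move=> ->; rewrite eqxx.
  by move=> /eqP/negbTE ->.
apply: le_trans (dominated_integral (dom t) mGt Gt0).
rewrite integral_mkcond; apply: ge0_le_integral => //.
- by move=> x _; rewrite patchE; case: ifP.
- by apply/(measurable_restrictT _ (mc t)); apply: measurable_funTS;
     exact: dominated_integrand.
- apply: dominated_integrand => //; first exact: dominated_map (dom t).
  exact: dominated_weight (dom t).
- move=> x _; rewrite patchE; case: ifPn => [|_]; last first.
    by rewrite mule_ge0// lee_fin; exact: dominated_ge0 (dom _) _.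
  by rewrite inE /= => cx; have := cPsi x; rewrite /Gt !cx => ->; rewrite eqxx.
Qed.

End dominated.

Section dominated_shift.
Context {R : realType} {D : eqType}.
Local Notation space := (coord_space R D).
Context (d : measure_display) (Omega : measurableType d)
  (P : probability Omega R) (V : D -> {RV P >-> R}).
Hypothesis indepV : mutually_independent V.

(** With the other coordinates frozen, [s] is a constant and the map is a translation of the line on
    a slice of [Q]. The slice may depend on coordinate [i] itself, as a comparison does on its
    noise; it suffices that the translation maps it into itself. *)
Lemma dominated_shift (i : D) (b : R) (s : space -> R) (Q : space -> bool) :
  0 < b -> laplace_distributed (V i) b ->
  measurable_fun setT s -> measurable_fun setT Q ->
  (forall v z, s (upd v i z) = s v) ->
  (forall v, Q v -> Q (upd v i (v i + s v))) ->
  dominated (joint_law V)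
    (fun v => if Q v then upd v i (v i + s v) else v)
    (fun v => if Q v then expR (- (`|s v| / b)) else 1).
Proof.
move=> b0 lapVi ms mQ si Qs.
have msh : measurable_fun setT (fun v : space => upd v i (v i + s v)).
  apply: measurable_upd; first exact: measurable_id.
  by apply: measurable_funD => //; exact: measurable_coord.
have mPsi : measurable_fun setT (fun v : space => if Q v then upd v i (v i + s v) else v).
  exact: measurable_fun_ifT.
have mw : measurable_fun setT (fun v : space => if Q v then expR (- (`|s v| / b)) else 1).
  apply: measurable_fun_ifT => //; apply: measurableT_comp => //.
  apply: measurableT_comp => //; apply: measurable_funM => //.
  exact: measurableT_comp.
have w0 v : 0 <= (if Q v then expR (- (`|s v| / b)) else 1).
  by case: ifP => // _; exact: expR_ge0.
split => // G mG G0.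
have mI := dominated_integrand mPsi mw mG.
have mupd : measurable_fun setT (fun vz : space * R => upd vz.1 i vz.2).
  exact: measurable_resample.
have mF (H : space -> \bar R) : measurable_fun setT H -> (forall v, 0 <= H v)%E ->
    measurable_fun setT (fun v => \int[distribution P (V i)]_z H (upd v i z))%E.
  move=> mH H0.
  apply: (measurable_fun_fubini_tonelli_F (m2 := distribution P (V i))
    (fun vz : space * R => H (upd vz.1 i vz.2))) => //.
  exact: measurableT_comp mH mupd.
rewrite (integral_resample indepV i) //; last first.
  by move=> v; rewrite mule_ge0// lee_fin.
rewrite [leRHS](integral_resample indepV i) //.
apply: ge0_le_integral => //.
- by move=> v _; apply: integral_ge0 => z _; rewrite mule_ge0// lee_fin.
- by apply: (mF _ mI) => v; rewrite mule_ge0// lee_fin.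
- exact: (mF _ mG).
move=> v _.
have mv : measurable_fun setT (fun z => upd v i z).
  by apply: measurable_upd.
pose g z := G (upd v i z).
(* Mass translated from [Q] lands in [Q] and is charged to [gQ]; unmoved mass is charged to [gN],
   and the two do not overlap. *)
pose gQ z := (if Q (upd v i z) then g z else 0)%E.
pose gN z : \bar R := (if Q (upd v i z) then 0 else g z)%E.
have mg : measurable_fun setT g by exact: measurableT_comp mG mv.
have mQv : measurable_fun setT (fun z => Q (upd v i z)) by exact: measurableT_comp mQ mv.
have mgQ : measurable_fun setT gQ by exact: measurable_fun_ifT.
have mgN : measurable_fun setT gN by exact: measurable_fun_ifT.
have gQ0 z : (0 <= gQ z)%E by rewrite /gQ; case: ifP => // _; exact: G0.
have gN0 z : (0 <= gN z)%E by rewrite /gN; case: ifP => // _; exact: G0.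
have e0 : (0 <= (expR (- (`|s v| / b)))%:E)%E by rewrite lee_fin expR_ge0.
have mgs : measurable_fun setT (fun z : R => gQ (z + s v)).
  by apply: (measurableT_comp mgQ); exact: measurable_funD.
apply: (@le_trans _ _ (\int[distribution P (V i)]_z
    ((expR (- (`|s v| / b)))%:E * gQ (z + s v)%R + gN z))%E).
  apply: ge0_le_integral => //.
  - by move=> z _; rewrite mule_ge0// lee_fin.
  - exact: measurableT_comp mI mv.
  - by apply: emeasurable_funD => //; exact: measurable_funeM.
  move=> z _; rewrite si upd_same upd_upd.
  case: ifPn => Qz.
    rewrite /gN Qz adde0 /gQ.
    by have := Qs _ Qz; rewrite si upd_same upd_upd => ->.
  by rewrite /gN (negbTE Qz) mul1e leeDr// mule_ge0.
rewrite ge0_integralD//; [|by move=> z _; rewrite mule_ge0|exact: measurable_funeM].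
apply: (@le_trans _ _ (\int[distribution P (V i)]_z gQ z + \int[distribution P (V i)]_z gN z)%E).
  by rewrite leeD2r//; exact: integral_laplace_shift.
rewrite -ge0_integralD//.
rewrite (_ : (fun z => _) = g)//.
by apply/funext => z; rewrite /gQ /gN; case: ifP; rewrite ?adde0 ?add0e.
Qed.

End dominated_shift.

(** * One step of the algorithm and its runs *)

HB.instance Definition _ := gen_eqMixin draw.

Definition draw_step (i : draw) : nat :=
  match i with Eta k _ => k | Nu k _ _ => k | Zed k _ _ => k end.

Section step.
Context {R : realType} {N : nat} (xi : nat -> R) (alpha : R) (n : nat).
Context (v : draw -> R) (k t : nat) (x f : 'I_N -> R) (st : pmwg_state R N).

(** The intermediate values of a step that has not halted, named separately so that measurability
    and the coupling can be treated value by value. *)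
Definition aged : 'I_N -> R := pub_age (prev_time st) t (pub st).
Definition eta1 : R := odflt (v (Eta k false)) (inst st).
Definition above1 : bool :=
  2 * alpha / 3 + eta1 / xi t <= lin f x - lin f aged + v (Nu k t false).
Definition eta2 : R := if above1 then v (Eta k true) else eta1.
Definition above2 : bool :=
  2 * alpha / 3 + eta2 / xi t <= lin f aged - lin f x + v (Nu k t true).
Definition inst2 : option R := if above2 then None else Some eta2.
Definition hard_answer : R :=
  if above1 then lin f aged + (lin f x - lin f aged + v (Zed k t false))
  else lin f aged - (lin f aged - lin f x + v (Zed k t true)).
Definition over_budget : bool := hard_bound N alpha n t < (hard st).+1%:R.
Definition penalty : 'I_N -> R :=
  if hard_answer < lin f aged then f else fun i => 1 - f i.
Definition step_out : option R :=
  if above1 || above2 then if over_budget then None else Some hard_answer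
  else Some (lin f aged).
Definition step_state : pmwg_state R N :=
  if above1 || above2 then
    if over_budget then PMWGState aged (hard st).+1 (Some t) inst2 true
    else PMWGState (pub_update alpha penalty aged) (hard st).+1 (Some t)
           inst2 false
  else PMWGState aged (hard st) (Some t) inst2 false.

Lemma pmwg_stepE : pmwg_step xi alpha n v k t x f st =
  if halted st then (None, st) else (step_out, step_state).
Proof.
rewrite /pmwg_step; case: (halted st) => //.
rewrite /nsg /natg -/aged -/eta1 -/above1 /step_out /step_state /penalty /inst2
  /hard_answer /above2 /eta2 -/over_budget.
case: above1 => /=.
  by case: over_budget; case: (2 * alpha / 3 + _ <= _).
by case: over_budget; case: (2 * alpha / 3 + _ <= _).
Qed.

End step.

Section run.
Context {R : realType} {N : nat} (xi : nat -> R) (alpha : R) (n : nat).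
Context (X : nat -> 'I_N -> R) (F : strategy R N).
Implicit Type v : draw -> R.

Definition run_state v k := (pmwg_run xi alpha n v X F k).1.
Definition run_hist v k := (pmwg_run xi alpha n v X F k).2.
Definition run_transcript v : transcript R :=
  fun k => nth None (run_hist v k.+1) k.

Definition run_out v k : option R :=
  if F (run_hist v k) is Some tf then
    (pmwg_step xi alpha n v k tf.1 (X tf.1) tf.2 (run_state v k)).1
  else None.

Lemma run_histS v k : run_hist v k.+1 = rcons (run_hist v k) (run_out v k).
Proof.
rewrite /run_out /run_hist /run_state /=.
case: (pmwg_run _ _ _ _ _ _ k) => st h /=.
by case: (F h) => [[t f]|] //=; case: pmwg_step.
Qed.

Lemma run_stateS v k : run_state v k.+1 =
  if F (run_hist v k) is Some tf then
    (pmwg_step xi alpha n v k tf.1 (X tf.1) tf.2 (run_state v k)).2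
  else run_state v k.
Proof.
rewrite /run_hist /run_state /=.
case: (pmwg_run _ _ _ _ _ _ k) => st h /=.
by case: (F h) => [[t f]|] //=; case: pmwg_step.
Qed.

Lemma size_run_hist v k : size (run_hist v k) = k.
Proof. by elim: k => // k IH; rewrite run_histS size_rcons IH. Qed.

Lemma run_transcriptE v k : run_transcript v k = run_out v k.
Proof. by rewrite /run_transcript run_histS nth_rcons size_run_hist ltnn eqxx. Qed.

Lemma run_hist_mkseq v k : run_hist v k = mkseq (run_transcript v) k.
Proof.
elim: k => [//|k IH].
by rewrite run_histS IH mkseqS run_transcriptE.
Qed.

Lemma askedE v k : asked F (run_transcript v) k = F (run_hist v k).
Proof. by rewrite /asked run_hist_mkseq. Qed.

Lemma pmwg_step_local v v' k t (x f : 'I_N -> R) st :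
  (forall i, draw_step i = k -> v i = v' i) ->
  pmwg_step xi alpha n v k t x f st = pmwg_step xi alpha n v' k t x f st.
Proof. by move=> vv'; rewrite /pmwg_step !vv'. Qed.

(** Causality. It makes a shift that is computed from the past independent of the draw that it
    moves, and the arrival of a query independent of the noise of its own step. *)
Lemma pmwg_run_local v v' k :
  (forall i, (draw_step i < k)%N -> v i = v' i) ->
  pmwg_run xi alpha n v X F k = pmwg_run xi alpha n v' X F k.
Proof.
elim: k => [//|k IH] vv' /=.
rewrite IH; last by move=> i ik; apply: vv'; rewrite ltnS ltnW.
case: pmwg_run => st h; case: (F h) => [[t f]|] //.
by rewrite (@pmwg_step_local v v') // => i ik; apply: vv'; rewrite ik.
Qed.

End run.

(** * Measurability of steps and runs *)

Section observables.
Context {R : realType} {d : measure_display} {T : measurableType d}.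

(* The types of states and outputs carry no sigma-algebra; measurability of a
   function into them is tested through real-valued observables. *)
Definition mobs {U : Type} (obs : set (U -> R)) (g : T -> U) : Prop :=
  forall o, obs o -> measurable_fun setT (o \o g).

Lemma mobs_if {U : Type} (obs : set (U -> R)) (b : T -> bool) (g h : T -> U) :
  measurable_fun setT b -> mobs obs g -> mobs obs h ->
  mobs obs (fun x => if b x then g x else h x).
Proof.
move=> mb mg mh o oo.
rewrite (_ : o \o _ = fun x => if b x then o (g x) else o (h x)).
  by apply: measurable_fun_ifT => //; [exact: mg|exact: mh].
by apply/funext => x /=; case: (b x).
Qed.

Lemma mobs_case {U : Type} (obs : set (U -> R)) (c : T -> nat)
    (g : nat -> T -> U) :
  (forall t, measurable [set x | c x = t]) -> (forall t, mobs obs (g t)) ->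
  mobs obs (fun x => g (c x) x).
Proof.
move=> mc mg o oo.
by apply: (measurable_fun_case (g := fun t x => o (g t x))) => // t; exact: mg.
Qed.

Lemma measurable_bool_natr (b : T -> bool) :
  measurable_fun setT (fun x => (b x)%:R : R) <-> measurable_fun setT b.
Proof.
split=> mb.
  rewrite (_ : b = fun x => 0 < (b x)%:R :> R); first exact: measurable_fun_ltr.
  by apply/funext => x; rewrite ltr0n; case: (b x).
rewrite (_ : (fun x => _) = fun x => if b x then 1 else 0).
  exact: measurable_fun_ifT.
by apply/funext => x; case: (b x).
Qed.

Lemma measurable_bool_set (b : T -> bool) :
  measurable_fun setT b <-> measurable [set x | b x].
Proof.
split=> [mb|mb].
  by rewrite -[X in measurable X]setTI; exact: (mb measurableT [set true]).
apply: (measurable_fun_bool true); rewrite setTI.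
by rewrite (_ : _ @^-1` _ = [set x | b x]).
Qed.

(** The power with exponent -1 is the inverse on nonnegative arguments only, hence the case on the
    sign. *)
Lemma measurable_inv (g : T -> R) : measurable_fun setT g ->
  measurable_fun setT (fun x => (g x)^-1).
Proof.
move=> mg.
rewrite (_ : (fun x => _) = fun x =>
   if g x < 0 then - ((- g x) `^ (-1)) else g x `^ (-1)).
  apply: measurable_fun_ifT; first exact: measurable_fun_ltr.
    apply: measurableT_comp => //.
    apply: (measurableT_comp (measurable_powR (-1))).
    exact: measurableT_comp.
  exact: (measurableT_comp (measurable_powR (-1))).
apply/funext => x; case: ltP => gx; last by rewrite powR_inv1.
by rewrite powR_inv1 ?oppr_ge0 ?ltW// invrN opprK.
Qed.

Definition obs_option : set (option R -> R) :=
  [set o | o = (fun a => (isSome a)%:R) \/ o = odflt 0].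

Definition obs_state (N : nat) : set (pmwg_state R N -> R) :=
  [set o | (exists i, o = fun s => pub s i) \/ o = (fun s => (hard s)%:R) \/
     (exists u, o = fun s => (prev_time s == u)%:R) \/
     o = (fun s => (isSome (inst s))%:R) \/ o = (fun s => odflt 0 (inst s)) \/
     o = (fun s => (halted s)%:R)].

Lemma mobs_optionP (g : T -> option R) : mobs obs_option g <->
  measurable_fun setT (fun x => isSome (g x)) /\
  measurable_fun setT (fun x => odflt 0 (g x)).
Proof.
split=> [m|[m1 m2] o [->|->]//]; last exact/measurable_bool_natr.
split; last by apply: (m (odflt 0)); right.
by apply/measurable_bool_natr; apply: (m (fun a => (isSome a)%:R)); left.
Qed.

Lemma mobs_None : mobs obs_option (fun=> None).
Proof. by apply/mobs_optionP; split. Qed.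

Lemma mobs_Some (g : T -> R) : measurable_fun setT g ->
  mobs obs_option (fun x => Some (g x)).
Proof. by move=> mg; apply/mobs_optionP; split. Qed.

Lemma measurable_odflt (g : T -> option R) (h : T -> R) :
  mobs obs_option g -> measurable_fun setT h ->
  measurable_fun setT (fun x => odflt (h x) (g x)).
Proof.
move=> /mobs_optionP[m1 m2] mh.
rewrite (_ : (fun x => _) = fun x => if isSome (g x) then odflt 0 (g x) else h x).
  exact: measurable_fun_ifT.
by apply/funext => x; case: (g x).
Qed.

Section state.
Context {N : nat}.
Implicit Type st : T -> pmwg_state R N.

Lemma mobs_pub st i : mobs (@obs_state N) st -> measurable_fun setT (fun x => pub (st x) i).
Proof. by move=> m; apply: (m (fun s => pub s i)); left; exists i. Qed.

Lemma mobs_hard st : mobs (@obs_state N) st -> measurable_fun setT (fun x => (hard (st x))%:R : R).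
Proof. by move=> m; apply: (m (fun s => (hard s)%:R)); right; left. Qed.

Lemma mobs_prev st u : mobs (@obs_state N) st ->
  measurable_fun setT (fun x => prev_time (st x) == u).
Proof.
move=> m; apply/measurable_bool_natr; apply: (m (fun s => (prev_time s == u)%:R)).
by right; right; left; exists u.
Qed.

Lemma mobs_inst st : mobs (@obs_state N) st -> mobs obs_option (fun x => inst (st x)).
Proof.
move=> m; apply/mobs_optionP; split.
  apply/measurable_bool_natr; apply: (m (fun s => (isSome (inst s))%:R)).
  by do 3 right; left.
by apply: (m (fun s => odflt 0 (inst s))); do 4 right; left.
Qed.

Lemma mobs_halted st : mobs (@obs_state N) st -> measurable_fun setT (fun x => halted (st x)).
Proof.
move=> m; apply/measurable_bool_natr; apply: (m (fun s => (halted s)%:R)).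
by do 5 right.
Qed.

Lemma mobs_PMWGState (y : T -> 'I_N -> R) (h : T -> nat) (u : option nat)
    (e : T -> option R) (b : bool) :
  (forall i, measurable_fun setT (fun x => y x i)) ->
  measurable_fun setT (fun x => (h x)%:R : R) ->
  mobs obs_option e ->
  mobs (@obs_state N) (fun x => PMWGState (y x) (h x) u (e x) b).
Proof.
move=> my mh /mobs_optionP[me1 me2] o.
case=> [[i ->]|[->|[[u' ->]|[->|[->|->]]]]] //.
- exact: my.
- exact: measurable_cst.
- exact/measurable_bool_natr.
- exact: measurable_cst.
Qed.

End state.
End observables.

Section measurable_step.
Context {R : realType} {d : measure_display} {T : measurableType d} {N : nat}.
Variables (xi : nat -> R) (alpha : R) (n : nat).
Variables (v : T -> draw -> R) (k t : nat) (x : 'I_N -> R) (f : T -> 'I_N -> R)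
  (st : T -> pmwg_state R N).
Hypotheses (mv : forall i, measurable_fun setT (fun w => v w i))
  (mf : forall i, measurable_fun setT (fun w => f w i))
  (mst : mobs (@obs_state R N) st).

Lemma measurable_lin (g h : T -> 'I_N -> R) :
  (forall i, measurable_fun setT (fun w => g w i)) ->
  (forall i, measurable_fun setT (fun w => h w i)) ->
  measurable_fun setT (fun w => lin (g w) (h w)).
Proof.
by move=> mg mh; rewrite /lin; apply: measurable_sum => i; exact: measurable_funM.
Qed.

Lemma measurable_aged i : measurable_fun setT (fun w => aged t (st w) i).
Proof.
(* [c] codes the previous arrival time as a number, with 0 for none; this splits the space into
   countably many pieces with one formula each. *)
pose c w := if prev_time (st w) is Some u then u.+1 else 0%N.
pose g m w := if m is u.+1 then
  if (u < t)%N then u%:R / t%:R * pub (st w) i + (t - u)%:R / t%:R * (1 / N%:R)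
  else pub (st w) i else pub (st w) i.
rewrite (_ : (fun w => _) = fun w => g (c w) w); last first.
  apply/funext => w; rewrite /aged /pub_age /g /c.
  by case: (prev_time (st w)) => // u; case: ifP.
have mp := mobs_pub i mst.
have mE u : measurable [set w | prev_time (st w) = u].
  rewrite (_ : [set w | _] = [set w | prev_time (st w) == u]).
    exact/measurable_bool_set/mobs_prev.
  by apply/seteqP; split => w /= /eqP.
apply: measurable_fun_case => [m|[|u]] //=; last first.
  rewrite /g; case: (u < t)%N => //; apply: measurable_funD => //.
  exact: measurable_funM.
rewrite (_ : [set w | _] =
    [set w | prev_time (st w) = if m is u.+1 then Some u else None]).
  exact: mE.
by apply/seteqP; split => w /=; rewrite /c; case: m => [|u]; case: (prev_time (st w)) => // u' [->].
Qed.

Local Notation aged w := (aged t (st w)).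
Local Notation eta1 w := (eta1 (v w) k (st w)).
Local Notation above1 w := (above1 xi alpha (v w) k t x (f w) (st w)).
Local Notation eta2 w := (eta2 xi alpha (v w) k t x (f w) (st w)).
Local Notation above2 w := (above2 xi alpha (v w) k t x (f w) (st w)).
Local Notation inst2 w := (inst2 xi alpha (v w) k t x (f w) (st w)).

Lemma measurable_eta1 : measurable_fun setT (fun w => eta1 w).
Proof. by apply: measurable_odflt => //; exact: mobs_inst. Qed.

Lemma measurable_lin_aged : measurable_fun setT (fun w => lin (f w) (aged w)).
Proof. exact: measurable_lin mf measurable_aged. Qed.

Lemma measurable_lin_data : measurable_fun setT (fun w => lin (f w) x).
Proof. exact: (@measurable_lin f (fun=> x)). Qed.

Let mla := measurable_lin_aged.
Let mld := measurable_lin_data.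

Lemma measurable_above1 : measurable_fun setT (fun w => above1 w).
Proof.
apply: measurable_fun_ler.
  apply: measurable_funD => //; apply: measurable_funM => //.
  exact: measurable_eta1.
by apply: measurable_funD => //; exact: measurable_funB.
Qed.

Lemma measurable_eta2 : measurable_fun setT (fun w => eta2 w).
Proof.
by apply: measurable_fun_ifT => //; [exact: measurable_above1|exact: measurable_eta1].
Qed.

Lemma measurable_above2 : measurable_fun setT (fun w => above2 w).
Proof.
apply: measurable_fun_ler.
  apply: measurable_funD => //; apply: measurable_funM => //.
  exact: measurable_eta2.
by apply: measurable_funD => //; exact: measurable_funB.
Qed.

Lemma mobs_inst2 : mobs obs_option (fun w => inst2 w).
Proof.
apply: mobs_if; first exact: measurable_above2.
  exact: mobs_None.
exact: mobs_Some measurable_eta2.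
Qed.

Lemma measurable_hard_answer : measurable_fun setT
  (fun w => hard_answer xi alpha (v w) k t x (f w) (st w)).
Proof.
apply: measurable_fun_ifT; first exact: measurable_above1.
  by apply: measurable_funD => //; apply: measurable_funD => //; exact: measurable_funB.
by apply: measurable_funB => //; apply: measurable_funD => //; exact: measurable_funB.
Qed.

Lemma measurable_hardS : measurable_fun setT (fun w => (hard (st w)).+1%:R : R).
Proof.
rewrite (_ : (fun w => _) = fun w => (hard (st w))%:R + 1).
  by apply: measurable_funD => //; exact: mobs_hard.
by apply/funext => w; rewrite natr1.
Qed.

Lemma measurable_over_budget :
  measurable_fun setT (fun w => over_budget alpha n t (st w)).
Proof. by apply: measurable_fun_ltr => //; exact: measurable_hardS. Qed.

Lemma measurable_penalty i : measurable_fun setT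
  (fun w => penalty xi alpha (v w) k t x (f w) (st w) i).
Proof.
rewrite (_ : (fun w => _) = fun w =>
   if hard_answer xi alpha (v w) k t x (f w) (st w) < lin (f w) (aged w)
   then f w i else 1 - f w i).
  apply: measurable_fun_ifT => //; last exact: measurable_funB.
  by apply: measurable_fun_ltr => //; exact: measurable_hard_answer.
by apply/funext => w; rewrite /penalty; case: ifP.
Qed.

Lemma measurable_pub_update (r y : T -> 'I_N -> R) i :
  (forall i, measurable_fun setT (fun w => r w i)) ->
  (forall i, measurable_fun setT (fun w => y w i)) ->
  measurable_fun setT (fun w => pub_update alpha (r w) (y w) i).
Proof.
move=> mr my.
have mye j : measurable_fun setT (fun w => y w j * expR (- (alpha * r w j / 6))).
  apply: measurable_funM => //; apply: measurableT_comp => //.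
  apply: measurableT_comp => //; apply: measurable_funM => //.
  exact: measurable_funM.
rewrite /pub_update; apply: measurable_funM => //.
by apply: measurable_inv; exact: measurable_sum.
Qed.

Lemma mobs_step_out : mobs obs_option
  (fun w => step_out xi alpha n (v w) k t x (f w) (st w)).
Proof.
apply: mobs_if; last exact: mobs_Some.
  by apply: measurable_or; [exact: measurable_above1|exact: measurable_above2].
apply: mobs_if; first exact: measurable_over_budget.
  exact: mobs_None.
exact: mobs_Some measurable_hard_answer.
Qed.

Lemma mobs_step_state : mobs (@obs_state R N)
  (fun w => step_state xi alpha n (v w) k t x (f w) (st w)).
Proof.
have mi := mobs_inst2; have mh := measurable_hardS; have ma := measurable_aged.
apply: mobs_if.
- by apply: measurable_or; [exact: measurable_above1|exact: measurable_above2].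
- apply: mobs_if; first exact: measurable_over_budget.
    exact: mobs_PMWGState.
  apply: mobs_PMWGState => // i; apply: measurable_pub_update => //.
  exact: measurable_penalty.
- by apply: mobs_PMWGState => //; exact: mobs_hard.
Qed.

Lemma mobs_pmwg_step_out : mobs obs_option
  (fun w => (pmwg_step xi alpha n (v w) k t x (f w) (st w)).1).
Proof.
rewrite (_ : (fun w => _) = fun w => if halted (st w) then None else
    step_out xi alpha n (v w) k t x (f w) (st w)).
  apply: mobs_if; [exact: mobs_halted|exact: mobs_None|exact: mobs_step_out].
by apply/funext => w; rewrite pmwg_stepE; case: halted.
Qed.

Lemma mobs_pmwg_step_state : mobs (@obs_state R N)
  (fun w => (pmwg_step xi alpha n (v w) k t x (f w) (st w)).2).
Proof.
rewrite (_ : (fun w => _) = fun w => if halted (st w) then st w else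
    step_state xi alpha n (v w) k t x (f w) (st w)).
  apply: mobs_if => //; [exact: mobs_halted|exact: mobs_step_state].
by apply/funext => w; rewrite pmwg_stepE; case: halted.
Qed.

End measurable_step.

Lemma transcript_preimage (R : realType) (d : measure_display)
    (T : measurableType d) (g : T -> transcript R) :
  (forall j, mobs (@obs_option R) (fun x => g x j)) ->
  forall S, transcript_event S -> measurable [set x | S (g x)].
Proof.
move=> mg; apply: (smallest_sub (C := sigma_algebra setT)).
  split => [|A mA|A mA].
  - by rewrite (_ : [set x | _] = set0).
  - rewrite setTD (_ : [set x | _] = ~` [set x | A (g x)]) //.
    exact: measurableC.
  - rewrite (_ : [set x | _] = \bigcup_k [set x | A k (g x)]).
      exact: bigcupT_measurable.
    by [].
move=> _ [k [B [mB ->]]] /=.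
have /mobs_optionP[m1 m2] := mg k.
rewrite (_ : [set x | _] = [set x | isSome (g x k)] `&` [set x | B (odflt 0 (g x k))]).
  apply: measurableI; first exact/measurable_bool_set.
  by rewrite -[X in measurable X]setTI; exact: m2.
apply/seteqP; split => x /=.
  by move=> [r Br ->].
by case: (g x k) => [r [_ Br]|[]//]; exists r.
Qed.

Section measurable_run.
Context {R : realType} {N : nat} (xi : nat -> R) (alpha : R) (n : nat).
Context (X : nat -> 'I_N -> R) (F : strategy R N).
Hypotheses (N0 : (0 < N)%N) (qF : query_stream n F).
Local Notation noise := (coord_space R draw).
Local Notation run_state := (run_state xi alpha n X F).
Local Notation run_hist := (run_hist xi alpha n X F).
Local Notation run_out := (run_out xi alpha n X F).
Local Notation run_transcript := (run_transcript xi alpha n X F).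

(* [t.+1] encodes a query arriving at time [t], and [0] the absence of query. *)
Definition query_code (v : draw -> R) k : nat :=
  if F (run_hist v k) is Some tf then tf.1.+1 else 0.

Definition query_fun (v : draw -> R) k : 'I_N -> R :=
  if F (run_hist v k) is Some tf then tf.2 else fun=> 0.

Section at_step.
Variable k : nat.
Hypothesis mh : forall j, mobs (@obs_option R)
  (fun v : noise => nth None (run_hist v k) j).

Lemma measurable_asked t i (B : set R) : measurable B ->
  measurable [set v : noise | exists f, F (run_hist v k) = Some (t, f) /\ B (f i)].
Proof.
move=> mB.
(* The query at step [k] reads only the first [k] outputs, so the history may be padded with [None]
   to a transcript, for which [qs_measurable] is stated. *)
rewrite [X in measurable X](_ : _ = [set v : noise |
   exists f, asked F (nth None (run_hist v k)) k = Some (t, f) /\ B (f i)]).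
  exact: (transcript_preimage mh (qs_measurable qF k t i mB)).
have E v : mkseq (nth None (run_hist v k)) k = run_hist v k.
  by rewrite -{2}(size_run_hist xi alpha n X F v k) mkseq_nth.
by apply/seteqP; split => v /= [f] h; exists f; move: h; rewrite /asked E.
Qed.

Lemma measurable_query_code t : measurable [set v : noise | query_code v k = t].
Proof.
have mS u : measurable [set v : noise | query_code v k = u.+1].
  (* The arrival time alone is observed through a trivial condition on one coordinate of the query;
     a coordinate exists because [N] is positive. *)
  rewrite (_ : [set v | _] = [set v : noise | exists f,
      F (run_hist v k) = Some (u, f) /\ [set: R] (f (Ordinal N0))]).
    exact: measurable_asked.
  apply/seteqP; split => v /=; rewrite /query_code.
    by case: (F _) => // -[u' f] /= [->]; exists f.
  by move=> [f [-> _]].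
case: t => [|u] //.
rewrite (_ : [set v | _] = ~` \bigcup_u [set v : noise | query_code v k = u.+1]).
  by apply: measurableC; exact: bigcupT_measurable.
apply/seteqP; split => v /=; first by move=> q0 [u _ /=]; rewrite q0.
by case E : (query_code v k) => [//|u] []; exists u.
Qed.

Lemma measurable_query_fun i :
  measurable_fun setT (fun v : noise => query_fun v k i).
Proof.
move=> _ B mB; rewrite setTI.
rewrite (_ : _ @^-1` B = (\bigcup_t [set v : noise | exists f,
     F (run_hist v k) = Some (t, f) /\ B (f i)]) `|`
   ([set v | query_code v k = 0%N] `&` (if `[< B 0 >] then setT else set0))).
  apply: measurableU.
    by apply: bigcupT_measurable => t; exact: measurable_asked.
  apply: measurableI; first exact: measurable_query_code.
  by case: ifP.
apply/seteqP; split => v /=; rewrite /query_fun /query_code.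
  case E : (F _) => [[t f]|] /= Bf; first by left; exists t => //; exists f.
  by right; split => //; case: asboolP => // /(_ Bf).
case=> [[t _ [f [-> //]]]|].
by case: (F _) => [[t f]|] /= [] //; case: asboolP.
Qed.

End at_step.

(** State and history go through the induction together: the next query is read off the history, and
    the step needs both query and state. *)
Lemma mobs_run k :
  mobs (@obs_state R N) (fun v : noise => run_state v k) /\
  forall j, mobs (@obs_option R) (fun v : noise => nth None (run_hist v k) j).
Proof.
elim: k => [|k [mst mh]].
  split; last first; [move=> j|move=> o].
    rewrite (_ : (fun v => _) = fun=> None); first exact: mobs_None.
    by apply/funext => v; rewrite nth_nil.
  by move=> _; exact: (measurable_cst (o (pmwg_init R N))).
have mc := measurable_query_code mh.
have mf := measurable_query_fun mh.
have mv i : measurable_fun setT (fun v : noise => v i) by exact: measurable_coord.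
split; last move=> j.
  pose g m (v : noise) := if m is t.+1 then
    (pmwg_step xi alpha n v k t (X t) (query_fun v k) (run_state v k)).2
    else run_state v k.
  rewrite (_ : (fun v => _) = fun v => g (query_code v k) v).
    by apply: mobs_case => // -[|t] //; exact: mobs_pmwg_step_state.
  apply/funext => v; rewrite run_stateS /g /query_code /query_fun.
  by case: (F _) => [[t f]|].
have mo : mobs (@obs_option R) (fun v : noise => run_out v k).
  pose g m (v : noise) := if m is t.+1 then
    (pmwg_step xi alpha n v k t (X t) (query_fun v k) (run_state v k)).1
    else None.
  rewrite (_ : (fun v => _) = fun v => g (query_code v k) v).
    apply: mobs_case => // -[|t]; first exact: mobs_None.
    exact: mobs_pmwg_step_out.
  apply/funext => v; rewrite /run_out /g /query_code /query_fun.
  by case: (F _) => [[t f]|].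
rewrite (_ : (fun v => _) = fun v : noise =>
   if (j < k)%N then nth None (run_hist v k) j
   else if j == k then run_out v k else None).
  by case: (j < k)%N => //; case: (j == k) => //; exact: mobs_None.
by apply/funext => v; rewrite run_histS nth_rcons size_run_hist.
Qed.

Lemma mobs_run_transcript j :
  mobs (@obs_option R) (fun v : noise => run_transcript v j).
Proof. exact: (mobs_run j.+1).2. Qed.

Lemma measurable_transcript_event S : transcript_event S ->
  measurable [set v : noise | S (run_transcript v)].
Proof. by move=> mS; apply: transcript_preimage mS; exact: mobs_run_transcript. Qed.

End measurable_run.

(** * Coupling of the runs on neighbouring streams *)

Lemma Eta_eqE k b k' b' : (Eta k b == Eta k' b') = (k == k') && (b == b').
Proof. by apply/eqP/andP => [[-> ->]|[/eqP -> /eqP ->]]. Qed.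

Lemma Nu_eqE k t b k' t' b' :
  (Nu k t b == Nu k' t' b') = [&& k == k', t == t' & b == b'].
Proof. by apply/eqP/and3P => [[-> -> ->]|[/eqP -> /eqP -> /eqP ->]]. Qed.

Lemma Zed_eqE k t b k' t' b' :
  (Zed k t b == Zed k' t' b') = [&& k == k', t == t' & b == b'].
Proof. by apply/eqP/and3P => [[-> -> ->]|[/eqP -> /eqP -> /eqP ->]]. Qed.

Lemma draw_neqE :
  (forall k b k' t' b', (Eta k b == Nu k' t' b') = false) *
  (forall k b k' t' b', (Eta k b == Zed k' t' b') = false) *
  (forall k b k' t' b', (Nu k' t' b' == Eta k b) = false) *
  (forall k b k' t' b', (Zed k' t' b' == Eta k b) = false) *
  (forall k t b k' t' b', (Nu k t b == Zed k' t' b') = false) *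
  (forall k t b k' t' b', (Zed k t b == Nu k' t' b') = false).
Proof. by repeat split => *; apply/eqP. Qed.

Section coupling.
Context {R : realType} {N : nat} (xi : nat -> R) (alpha : R) (n : nat).
Context (X X' : nat -> 'I_N -> R) (F : strategy R N).
Hypotheses (N0 : (0 < N)%N) (n0 : (0 < n)%N) (qF : query_stream n F).
Local Notation noise := (coord_space R draw).
Local Notation state := (run_state xi alpha n X F).
Local Notation hist := (run_hist xi alpha n X F).
Local Notation code := (query_code xi alpha n X F).
Local Notation query := (query_fun xi alpha n X F).
Implicit Types v u : draw -> R.

(** [t%:R^-1] bounds the change of a linear query between neighbouring databases of size [t].
    Threshold noise is divided by [xi t] in a comparison, so shifting it by [xi t / t] raises the
    threshold by exactly that amount. *)
Definition sens (t : nat) : R := xi t / t%:R.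

Definition run_above1 v k t :=
  above1 xi alpha v k t (X t) (query v k) (state v k).
Definition run_above2 v k t :=
  above2 xi alpha v k t (X t) (query v k) (state v k).

(* The shift of the threshold noise of the running instance: the sensitivity
   at the time when the instance was started. *)
Fixpoint run_shift v k : R :=
  if k is k'.+1 then
    if (0 < code v k')%N && ~~ halted (state v k') then
      let t := (code v k').-1 in
      if run_above1 v k' t || ~~ isSome (inst (state v k')) then sens t
      else run_shift v k'
    else run_shift v k'
  else 0.

(** Shift of the threshold noise met by the first query of a step. For the second, [shift2] takes
    into account that the first may have ended the instance, in which case a new one starts at time
    [t]. *)
Definition shift1 v k t : R :=
  if isSome (inst (state v k)) then run_shift v k else sens t.
Definition shift2 v k t : R :=
  if run_above1 v k t then sens t else shift1 v k t.

Definition active v k t : bool := (code v k == t.+1) && ~~ halted (state v k).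

Lemma active_halted v k t : active v k t -> halted (state v k) = false.
Proof. by move=> /andP[_ /negbTE]. Qed.

Lemma activeP v k t : active v k t -> F (hist v k) = Some (t, query v k).
Proof.
move=> /andP[+ _]; rewrite /query_code /query_fun.
by case: (F _) => [[t' f] /= /eqP[->]|].
Qed.

Lemma active_ge v k t : active v k t -> (n <= t)%N.
Proof. by move=> /activeP; rewrite -askedE => /(qs_linear qF)[]. Qed.

Lemma run_shiftS v k t : active v k t -> run_shift v k.+1 = shift2 v k t.
Proof.
move=> /andP[/eqP ct nh] /=; rewrite ct /= nh /shift2 /shift1.
by case: run_above1 => //=; case: isSome.
Qed.

Lemma run_shiftS_idle v k : (forall t, ~~ active v k t) ->
  run_shift v k.+1 = run_shift v k.
Proof.
move=> h /=; case: ifP => // /andP[c0 nh].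
by have := h (code v k).-1; rewrite /active prednK // eqxx nh.
Qed.

Lemma active_dec v k : (exists t, active v k t) \/ forall t, ~~ active v k t.
Proof.
have [|h] := pselect (exists t, active v k t); first by left.
by right=> t; apply/negP => a; apply: h; exists t.
Qed.

Definition same_before k v u := forall i, (draw_step i < k)%N -> v i = u i.

Lemma same_before_run k v u : same_before k v u ->
  [/\ state v k = state u k, hist v k = hist u k, code v k = code u k &
      query v k = query u k].
Proof.
move=> vu; have := pmwg_run_local xi alpha n X F vu.
by rewrite /query_code /query_fun /run_state /run_hist => ->.
Qed.

Lemma same_beforeW j k v u : (j <= k)%N -> same_before k v u -> same_before j v u.
Proof. by move=> jk h i ij; apply: h; exact: leq_trans ij jk. Qed.

Lemma run_above1_local k t v u : same_before k v u ->
  v (Eta k false) = u (Eta k false) -> v (Nu k t false) = u (Nu k t false) ->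
  run_above1 v k t = run_above1 u k t.
Proof.
move=> /same_before_run[e1 _ _ e4] he hn.
by rewrite /run_above1 /above1 /eta1 e1 e4 he hn.
Qed.

Lemma run_above2_local k t v u : same_before k.+1 v u ->
  run_above2 v k t = run_above2 u k t.
Proof.
move=> h; have /same_before_run[e1 _ _ e4] := same_beforeW (leqnSn k) h.
by rewrite /run_above2 /above2 /eta2 /above1 /eta1 e1 e4 !h.
Qed.

Lemma run_shift_local k v u : same_before k v u -> run_shift v k = run_shift u k.
Proof.
elim: k => [//|k IH] h /=.
have hk := same_beforeW (leqnSn k) h.
have [-> _ -> _] := same_before_run hk.
by rewrite IH // (@run_above1_local k _ v u) ?h.
Qed.

Lemma shift1_local k t v u : same_before k v u -> shift1 v k t = shift1 u k t.
Proof.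
move=> h; have [e1 _ _ _] := same_before_run h.
by rewrite /shift1 e1 (run_shift_local h).
Qed.

Lemma active_local k t v u : same_before k v u -> active v k t = active u k t.
Proof. by move=> h; have [e1 _ e3 _] := same_before_run h; rewrite /active e1 e3. Qed.

(** Ties the shift to the time of an earlier query, so that the order of arrivals and the
    monotonicity of [sens] compare it with the present sensitivity. The first alternative covers
    runs in which no step has been active yet. *)
Lemma run_shift_start v k :
  (run_shift v k = 0 /\ inst (state v k) = None) \/
  exists j t f, [/\ (j < k)%N, F (hist v j) = Some (t, f) & run_shift v k = sens t].
Proof.
elim: k => [|k IH]; first by left.
have [[t act]|idle] := active_dec v k.
  rewrite (run_shiftS act) /shift2 /shift1.
  have Fk := activeP act.
  have start : exists j t0 f, [/\ (j < k.+1)%N, F (hist v j) = Some (t0, f) & sens t = sens t0].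
    by exists k, t, (query v k).
  case: run_above1; first by right.
  case: IH => [[_ ->]|]; first by right.
  move=> [j [t0 [f [jk Fj ->]]]]; right.
  case: (inst (state v k)) => [e|] //=.
  by exists j, t0, f; split => //; exact: ltnW.
rewrite run_shiftS_idle // run_stateS.
have -> : (if F (hist v k) is Some tf then (pmwg_step xi alpha n v k tf.1 (X tf.1) tf.2
   (state v k)).2 else state v k) = state v k.
  case E : (F (hist v k)) => [[t f]|] //=; rewrite pmwg_stepE.
  by have := idle t; rewrite /active /query_code E eqxx /=; case: (halted _).
case: IH => [|[j [t0 [f [jk Fj e]]]]]; first by left.
by right; exists j, t0, f; split => //; exact: ltnW.
Qed.

Hypotheses (xi_gt0 : forall t, (n <= t)%N -> 0 < xi t)
  (sens_le : forall s t, (n <= s <= t)%N -> sens t <= sens s)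
  (close : forall t f, (n <= t)%N -> linear_query f ->
     `|lin f (X t) - lin f (X' t)| <= t%:R^-1).

Lemma sens_ge0 t : (n <= t)%N -> 0 <= sens t.
Proof. by move=> nt; rewrite divr_ge0// ltW// xi_gt0. Qed.

Lemma run_shift_ge0 v k : 0 <= run_shift v k.
Proof.
case: (run_shift_start v k) => [[-> //]|[j [t [f [_ Fj ->]]]]].
by apply: sens_ge0; move: Fj; rewrite -askedE => /(qs_linear qF)[].
Qed.

(** The running instance was started no later than [t], and [sens] decreases. This is what keeps an
    old shift sufficient at time [t]. *)
Lemma shift1_ge v k t : active v k t -> sens t <= shift1 v k t.
Proof.
move=> act; rewrite /shift1; case: ifP => // hi.
case: (run_shift_start v k) => [[_ h]|]; first by rewrite h in hi.
move=> [j [s [f [jk Fj ->]]]].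
have Fk := activeP act; apply: sens_le.
rewrite -!askedE in Fj Fk.
by rewrite (qs_ordered qF jk Fj Fk) andbT; have [] := qs_linear qF Fj.
Qed.

Lemma shift2_ge v k t : active v k t -> sens t <= shift2 v k t.
Proof. by move=> act; rewrite /shift2; case: ifP => // _; exact: shift1_ge. Qed.

Lemma active_linear v k t : active v k t -> linear_query (query v k).
Proof. by move=> /activeP; rewrite -askedE => /(qs_linear qF)[]. Qed.

Lemma measurable_code k t : measurable [set v : noise | code v k = t].
Proof. by apply: measurable_query_code => //; exact: (mobs_run _ _ _ N0 qF k).2. Qed.

Lemma measurable_query k i : measurable_fun setT (fun v : noise => query v k i).
Proof. by apply: measurable_query_fun => //; exact: (mobs_run _ _ _ N0 qF k).2. Qed.

Lemma mobs_run_state k : mobs (@obs_state R N) (fun v : noise => state v k).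
Proof. exact: (mobs_run _ _ _ N0 qF k).1. Qed.

Lemma measurable_active k t : measurable_fun setT (fun v : noise => active v k t).
Proof.
apply: measurable_and; last first.
  by apply: measurable_neg; exact: mobs_halted (mobs_run_state k).
apply/measurable_bool_set.
rewrite [X in measurable X](_ : _ = [set v : noise | code v k = t.+1]).
  exact: measurable_code.
by apply/seteqP; split => v /= /eqP.
Qed.

Let mcoord i : measurable_fun setT (fun v : noise => v i).
Proof. exact: measurable_coord. Qed.

Lemma measurable_run_above1 k t :
  measurable_fun setT (fun v : noise => run_above1 v k t).
Proof.
by apply: measurable_above1 => //; [exact: measurable_query|exact: mobs_run_state].
Qed.

Lemma measurable_run_above2 k t :
  measurable_fun setT (fun v : noise => run_above2 v k t).
Proof.
by apply: measurable_above2 => //; [exact: measurable_query|exact: mobs_run_state].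
Qed.

Lemma measurable_inst_some k :
  measurable_fun setT (fun v : noise => isSome (inst (state v k))).
Proof. by have /mobs_inst/mobs_optionP[] := mobs_run_state k. Qed.

Lemma measurable_run_shift k : measurable_fun setT (fun v : noise => run_shift v k).
Proof.
elim: k => [|k IH] /=; first exact: measurable_cst.
pose g m (v : noise) := if (0 < m)%N && ~~ halted (state v k) then
   if run_above1 v k m.-1 || ~~ isSome (inst (state v k)) then sens m.-1
   else run_shift v k else run_shift v k.
apply: (measurable_fun_case (g := g)); first exact: measurable_code.
move=> t; apply: measurable_fun_ifT => //.
  apply: measurable_and => //.
  by apply: measurable_neg; exact: mobs_halted (mobs_run_state k).
apply: measurable_fun_ifT => //; apply: measurable_or; first exact: measurable_run_above1.
by apply: measurable_neg; exact: measurable_inst_some.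
Qed.

Lemma measurable_shift1 k t : measurable_fun setT (fun v : noise => shift1 v k t).
Proof.
by apply: measurable_fun_ifT => //; [exact: measurable_inst_some|exact: measurable_run_shift].
Qed.

Lemma measurable_shift2 k t : measurable_fun setT (fun v : noise => shift2 v k t).
Proof.
by apply: measurable_fun_ifT => //; [exact: measurable_run_above1|exact: measurable_shift1].
Qed.


Context (d : measure_display) (Omega : measurableType d)
  (P : probability Omega R) (V : draw -> {RV P >-> R}).
Hypothesis hV : noise_draws n xi V.
Local Notation mu := (joint_law V).

Definition bump (i : draw) (Q : noise -> bool) (s : noise -> R) (v : noise)
  : noise := if Q v then upd v i (v i + s v) else v.

Lemma bumpE i Q s v j :
  bump i Q s v j = v j + if (j == i) && Q v then s v else 0.
Proof.
rewrite /bump; case: (Q v); rewrite ?andbF ?addr0 // andbT /upd.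
by case: eqP => [->|]; rewrite ?addr0.
Qed.

Lemma bump_other i Q s v j : j != i -> bump i Q s v j = v j.
Proof. by move=> /negbTE ji; rewrite bumpE ji addr0. Qed.

Lemma dominated_bump i (b : R) (Q : noise -> bool) (s l : noise -> R) : 0 < b -> laplace_distributed (V i) b ->
  measurable_fun setT s -> measurable_fun setT Q -> measurable_fun setT l ->
  (forall (v : noise) z, s (upd v i z) = s v) ->
  (forall v : noise, Q v -> Q (upd v i (v i + s v))) ->
  (forall v : noise, Q v -> `|s v| / b <= l v) ->
  dominated mu (bump i Q s) (fun v => expR (- (if Q v then l v else 0))).
Proof.
move=> b0 lapi ms mQ ml si Qs sl.
apply: dominated_le (dominated_shift (noise_indep hV) b0 lapi ms mQ si Qs) _ _.
  apply: measurableT_comp => //; apply: measurableT_comp => //.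
  exact: measurable_fun_ifT.
move=> v; rewrite expR_ge0 /=; case: ifPn => Qv; last by rewrite oppr0 expR0.
by rewrite ler_expR lerN2; exact: sl.
Qed.

(** All shifts are computed from the unshifted run. Comparison noise moves only when the comparison
    succeeds; a failed comparison is protected by the raised threshold alone, so failures cost
    nothing. Answer noise absorbs the change of the query value exactly. For [Eta] the arrival time
    is recovered from the query code. *)
Definition delta v (i : draw) : R :=
  match i with
  | Eta k b => let t := (code v k).-1 in
      if active v k t && (if b then run_above1 v k t
                          else ~~ isSome (inst (state v k)))
      then sens t else 0
  | Nu k t b => if active v k t && (if b then run_above2 v k t else run_above1 v k t)
      then t%:R^-1 + (if b then shift2 v k t else shift1 v k t) / xi t else 0
  | Zed k t b => if active v k t && (if b then run_above2 v k t else run_above1 v k t)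
      then if b then lin (query v k) (X' t) - lin (query v k) (X t)
           else lin (query v k) (X t) - lin (query v k) (X' t)
      else 0
  end.

Section step_at_time.
Variables (k t : nat).

Let Q1 (v : noise) := active v k t && ~~ isSome (inst (state v k)).
Let Qa (v : noise) := active v k t && run_above1 v k t.
Let Qb (v : noise) := active v k t && run_above2 v k t.
Let gap (v : noise) := lin (query v k) (X t) - lin (query v k) (X' t).
Let nu1 (v : noise) := t%:R^-1 + shift1 v k t / xi t.
Let nu2 (v : noise) := t%:R^-1 + shift2 v k t / xi t.

(* Later draws are shifted first, so that each shift is computed from the
   original values of the earlier draws. *)
Definition step_time_map : noise -> noise :=
  bump (Eta k false) Q1 (fun=> sens t) \o
  (bump (Nu k t false) Qa nu1 \o
  (bump (Zed k t false) Qa gap \o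
  (bump (Eta k true) Qa (fun=> sens t) \o
  (bump (Nu k t true) Qb nu2 \o
   bump (Zed k t true) Qb (fun v => - gap v))))).

(** One summand per draw, in the order of [step_time_map]. The costs [(sens t + shift) / 4] of
    comparison noise and at most [sens t / 8] of answer noise are rounded up to multiples of the
    shift of the instance that ends, so that its end costs [5/8] of its shift. *)
Definition step_time_loss (v : noise) : R :=
  (if Q1 v then sens t / 2 else 0) + (if Qa v then shift1 v k t / 2 else 0) +
  (if Qa v then shift1 v k t / 8 else 0) + (if Qa v then sens t / 2 else 0) +
  (if Qb v then shift2 v k t / 2 else 0) + (if Qb v then shift2 v k t / 8 else 0).

Let same_upd i (v : noise) z : draw_step i = k -> same_before k (upd v i z) v.
Proof.
move=> ik j jk; rewrite upd_other //; apply: contraTneq jk => ->.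
by rewrite ik ltnn.
Qed.

Let mQ1 : measurable_fun setT Q1.
Proof.
apply: measurable_and; first exact: measurable_active.
by apply: measurable_neg; exact: measurable_inst_some.
Qed.

Let mQa : measurable_fun setT Qa.
Proof.
by apply: measurable_and; [exact: measurable_active|exact: measurable_run_above1].
Qed.

Let mQb : measurable_fun setT Qb.
Proof.
by apply: measurable_and; [exact: measurable_active|exact: measurable_run_above2].
Qed.

Let mgap : measurable_fun setT gap.
Proof.
apply: measurable_funB.
  by apply: (@measurable_lin _ _ _ _ _ (fun=> X t)) => // i; exact: measurable_query.
by apply: (@measurable_lin _ _ _ _ _ (fun=> X' t)) => // i; exact: measurable_query.
Qed.

Let mnu1 : measurable_fun setT nu1.
Proof.
by apply: measurable_funD => //; apply: measurable_funM => //; exact: measurable_shift1.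
Qed.

Let mnu2 : measurable_fun setT nu2.
Proof.
by apply: measurable_funD => //; apply: measurable_funM => //; exact: measurable_shift2.
Qed.

Let Q1_local v u : same_before k v u -> Q1 v = Q1 u.
Proof.
move=> h; rewrite /Q1 (active_local _ h).
by have [-> _ _ _] := same_before_run h.
Qed.

Let gap_local v u : same_before k v u -> gap v = gap u.
Proof. by move=> h; rewrite /gap; have [_ _ _ ->] := same_before_run h. Qed.

Let nu1_local v u : same_before k v u -> nu1 v = nu1 u.
Proof. by move=> h; rewrite /nu1 (shift1_local _ h). Qed.

Let Qa_local v u : same_before k v u -> v (Eta k false) = u (Eta k false) ->
  v (Nu k t false) = u (Nu k t false) -> Qa v = Qa u.
Proof. by move=> h h1 h2; rewrite /Qa (active_local _ h) (run_above1_local h h1 h2). Qed.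

Let shift2_local v u : same_before k v u -> v (Eta k false) = u (Eta k false) ->
  v (Nu k t false) = u (Nu k t false) -> shift2 v k t = shift2 u k t.
Proof. by move=> h h1 h2; rewrite /shift2 (run_above1_local h h1 h2) (shift1_local _ h). Qed.

Let Qb_local v u : same_before k v u -> v (Eta k false) = u (Eta k false) ->
  v (Nu k t false) = u (Nu k t false) -> v (Eta k true) = u (Eta k true) ->
  v (Nu k t true) = u (Nu k t true) -> Qb v = Qb u.
Proof.
move=> h h1 h2 h3 h4; rewrite /Qb (active_local _ h) /run_above2 /above2 /eta2.
rewrite -!/(run_above1 _ _ _) (run_above1_local h h1 h2) /eta1 h1 h3 h4.
by have [-> _ _ ->] := same_before_run h.
Qed.

Let M6 v := bump (Zed k t true) Qb (fun v => - gap v) v.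
Let M5 v := bump (Nu k t true) Qb nu2 (M6 v).
Let M4 v := bump (Eta k true) Qa (fun=> sens t) (M5 v).
Let M3 v := bump (Zed k t false) Qa gap (M4 v).
Let M2 v := bump (Nu k t false) Qa nu1 (M3 v).

Let same_bump i Q s v u : draw_step i = k -> same_before k v u ->
  same_before k (bump i Q s v) u.
Proof.
move=> ik vu j jk; rewrite bump_other ?vu //; apply: contraTneq jk => ->.
by rewrite ik ltnn.
Qed.

Let sM6 v : same_before k (M6 v) v. Proof. exact: same_bump. Qed.
Let sM5 v : same_before k (M5 v) v. Proof. exact: same_bump. Qed.
Let sM4 v : same_before k (M4 v) v. Proof. exact: same_bump. Qed.
Let sM3 v : same_before k (M3 v) v. Proof. exact: same_bump. Qed.
Let sM2 v : same_before k (M2 v) v. Proof. exact: same_bump. Qed.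

Let QbM6 v : Qb (M6 v) = Qb v.
Proof. by apply: Qb_local => //; rewrite /M6 bump_other // draw_neqE. Qed.

Let s2M6 v : shift2 (M6 v) k t = shift2 v k t.
Proof. by apply: shift2_local => //; rewrite /M6 bump_other // draw_neqE. Qed.

Let bumps := (draw_neqE, Nu_eqE, Eta_eqE, Zed_eqE).

Let QaM5 v : Qa (M5 v) = Qa v.
Proof. by apply: Qa_local => //; rewrite /M3 /M4 /M5 /M6 !bump_other // !bumps ?andbF. Qed.

Let QaM4 v : Qa (M4 v) = Qa v.
Proof. by apply: Qa_local => //; rewrite /M3 /M4 /M5 /M6 !bump_other // !bumps ?andbF. Qed.

Let QaM3 v : Qa (M3 v) = Qa v.
Proof. by apply: Qa_local => //; rewrite /M3 /M4 /M5 /M6 !bump_other // !bumps ?andbF. Qed.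

Let step_time_mapE v i : step_time_map v i = v i +
  if (i == Zed k t true) && Qb v then - gap v else
  if (i == Nu k t true) && Qb v then nu2 v else
  if (i == Eta k true) && Qa v then sens t else
  if (i == Zed k t false) && Qa v then gap v else
  if (i == Nu k t false) && Qa v then nu1 v else
  if (i == Eta k false) && Q1 v then sens t else 0.
Proof.
rewrite /step_time_map /= -/(M6 v) -/(M5 v) -/(M4 v) -/(M3 v) -/(M2 v).
rewrite bumpE (Q1_local (sM2 v)).
rewrite {1}/M2 bumpE QaM3 (nu1_local (sM3 v)).
rewrite {1}/M3 bumpE QaM4 (gap_local (sM4 v)).
rewrite {1}/M4 bumpE QaM5.
rewrite {1}/M5 bumpE QbM6 /nu2 s2M6.
rewrite {1}/M6 bumpE.
have [->|_] := eqVneq i (Zed k t true); first by rewrite !bumps ?andbF /=; case: ifP; rewrite ?addr0.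
have [->|_] := eqVneq i (Nu k t true); first by rewrite !bumps ?andbF /=; case: ifP; rewrite ?addr0.
have [->|_] := eqVneq i (Eta k true); first by rewrite !bumps ?andbF /=; case: ifP; rewrite ?addr0.
have [->|_] := eqVneq i (Zed k t false); first by rewrite !bumps ?andbF /=; case: ifP; rewrite ?addr0.
have [->|_] := eqVneq i (Nu k t false); first by rewrite !bumps ?andbF /=; case: ifP; rewrite ?addr0.
by rewrite /= !addr0.
Qed.

Lemma dominated_step_time : (n <= t)%N ->
  dominated mu step_time_map (fun v => expR (- step_time_loss v)).
Proof.
move=> nt.
have t0 : 0 < t%:R :> R by rewrite ltr0n (leq_trans n0 nt).
have x0 := xi_gt0 nt.
have c0 := sens_ge0 nt.
have cE : t%:R^-1 = sens t / xi t by rewrite /sens; field; rewrite !gt_eqF.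
have d1 : dominated mu (bump (Eta k false) Q1 (fun=> sens t))
    (fun v => expR (- (if Q1 v then sens t / 2 else 0))).
  apply: (dominated_bump _ (noise_eta hV k false)) => //.
    by move=> v; rewrite (Q1_local (same_upd _ _ _)).
  by move=> v _; rewrite ger0_norm.
have d4 : dominated mu (bump (Eta k true) Qa (fun=> sens t))
    (fun v => expR (- (if Qa v then sens t / 2 else 0))).
  apply: (dominated_bump _ (noise_eta hV k true)) => //.
    move=> v; rewrite (@Qa_local (upd _ _ _) v) //; first exact: same_upd.
      by rewrite upd_other // Eta_eqE andbF.
    by rewrite upd_other // draw_neqE.
  by move=> v _; rewrite ger0_norm.
have d2 : dominated mu (bump (Nu k t false) Qa nu1)
    (fun v => expR (- (if Qa v then shift1 v k t / 2 else 0))).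
  apply: (dominated_bump _ (noise_nu hV k false nt)) => //.
  - by rewrite divr_gt0.
  - by apply: measurable_funM => //; exact: measurable_shift1.
  - by move=> v z; apply: nu1_local; exact: same_upd.
  (* The comparison noise is raised, so a comparison that succeeded still does: [Qa] is
     preserved. *)
  - move=> v /andP[act ab].
    have same : same_before k (upd v (Nu k t false) (v (Nu k t false) + nu1 v)) v.
      exact: same_upd.
    rewrite /Qa (active_local _ same) act /=.
    move: ab; rewrite /run_above1 /above1 /eta1 upd_same upd_other ?draw_neqE //.
    have [-> _ _ ->] := same_before_run same.
    move=> /le_trans; apply; rewrite addrA lerDl /nu1 addr_ge0 ?invr_ge0 ?ler0n//.
    by apply: divr_ge0; [exact: le_trans c0 (shift1_ge act)|exact: ltW].
  - move=> v /andP[act _]; have h1 := shift1_ge act.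
    have s0 : 0 <= shift1 v k t by exact: le_trans h1.
    rewrite /nu1 cE -mulrDl ger0_norm; last by rewrite divr_ge0 ?addr_ge0// ltW.
    rewrite (_ : _ / _ / _ = (sens t + shift1 v k t) / 4); last by field; rewrite gt_eqF.
    by lra.
have d5 : dominated mu (bump (Nu k t true) Qb nu2)
    (fun v => expR (- (if Qb v then shift2 v k t / 2 else 0))).
  apply: (dominated_bump _ (noise_nu hV k true nt)) => //.
  - by rewrite divr_gt0.
  - by apply: measurable_funM => //; exact: measurable_shift2.
  - move=> v z; rewrite /nu2 (@shift2_local _ v) //; first exact: same_upd.
      by rewrite upd_other // draw_neqE.
    by rewrite upd_other // Nu_eqE !andbF.
  - move=> v /andP[act ab].
    have same : same_before k (upd v (Nu k t true) (v (Nu k t true) + nu2 v)) v.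
      exact: same_upd.
    rewrite /Qb (active_local _ same) act /=.
    have e1 : upd v (Nu k t true) (v (Nu k t true) + nu2 v) (Nu k t false) = v (Nu k t false).
      by rewrite upd_other // Nu_eqE !andbF.
    move: ab; rewrite /run_above2 /above2 /eta2 -!/(run_above1 _ _ _).
    rewrite (@run_above1_local k t _ v) // ?e1//; last by rewrite upd_other // draw_neqE.
    rewrite /eta1 upd_same !upd_other ?draw_neqE //.
    have [-> _ _ ->] := same_before_run same.
    move=> /le_trans; apply; rewrite addrA lerDl /nu2 addr_ge0 ?invr_ge0 ?ler0n//.
    by apply: divr_ge0; [exact: le_trans c0 (shift2_ge act)|exact: ltW].
  - move=> v /andP[act _]; have h1 := shift2_ge act.
    have s0 : 0 <= shift2 v k t by exact: le_trans h1.
    rewrite /nu2 cE -mulrDl ger0_norm; last by rewrite divr_ge0 ?addr_ge0// ltW.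
    rewrite (_ : _ / _ / _ = (sens t + shift2 v k t) / 4); last by field; rewrite gt_eqF.
    by lra.
have gap_le v : active v k t -> `|gap v| / (8 / xi t) <= sens t / 8.
  move=> act; have := close nt (active_linear act); rewrite -/(gap v) => h.
  rewrite (_ : _ / (8 / xi t) = `|gap v| * (xi t / 8)); last by field; rewrite gt_eqF.
  rewrite (_ : sens t / 8 = t%:R^-1 * (xi t / 8)); last by rewrite /sens; field; rewrite gt_eqF.
  by rewrite ler_wpM2r // divr_ge0 // ltW.
have d3 : dominated mu (bump (Zed k t false) Qa gap)
    (fun v => expR (- (if Qa v then shift1 v k t / 8 else 0))).
  apply: (dominated_bump _ (noise_zed hV k false nt)) => //.
  - by rewrite divr_gt0.
  - by apply: measurable_funM => //; exact: measurable_shift1.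
  - by move=> v z; apply: gap_local; exact: same_upd.
  - move=> v; rewrite (@Qa_local (upd _ _ _) v) //; first exact: same_upd.
      by rewrite upd_other // draw_neqE.
    by rewrite upd_other // draw_neqE.
  - move=> v /andP[act _]; have := gap_le v act; have := shift1_ge act; lra.
have d6 : dominated mu (bump (Zed k t true) Qb (fun v => - gap v))
    (fun v => expR (- (if Qb v then shift2 v k t / 8 else 0))).
  apply: (dominated_bump _ (noise_zed hV k true nt)) => //.
  - by rewrite divr_gt0.
  - exact: measurableT_comp.
  - by apply: measurable_funM => //; exact: measurable_shift2.
  - by move=> v z; congr (- _); apply: gap_local; exact: same_upd.
  - move=> v; rewrite (@Qb_local (upd _ _ _) v) // ?upd_other ?draw_neqE //.
    exact: same_upd.
  - by move=> v /andP[act _]; rewrite normrN; have := gap_le v act; have := shift2_ge act; lra.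
have := dominated_comp d1 (dominated_comp d2 (dominated_comp d3
  (dominated_comp d4 (dominated_comp d5 d6)))).
congr dominated; apply/funext => v /=.
rewrite -/(M6 v) -/(M5 v) -/(M4 v) -/(M3 v) -/(M2 v) (Q1_local (sM2 v)).
rewrite QaM3 (shift1_local _ (sM3 v)) QaM4 (shift1_local _ (sM4 v)) QaM5 QbM6 s2M6.
rewrite -!expRD /step_time_loss !opprD; congr expR;
  case: (Q1 v); case: (Qa v); case: (Qb v); lra.
Qed.

Lemma active_step_time v (i : draw) : code v k = t.+1 -> step_time_map v i =
  if draw_step i == k then v i + delta v i else v i.
Proof.
move=> cv; rewrite step_time_mapE /nu1 /nu2 /Qa /Qb /Q1 /gap.
case: i => [j b|j s b|j s b] /=; rewrite !bumps.
- have [->|_] := eqVneq j k; rewrite ?addr0//= cv /=.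
  by case: b => //=; case: active; case: isSome.
- have [->|_] := eqVneq j k; rewrite ?addr0//=.
  have [->|st] := eqVneq s t; first by case: b.
  rewrite /= /active cv eqSS eq_sym (negbTE st) /=.
  by case: b.
- have [->|_] := eqVneq j k; rewrite ?addr0//=.
  have [->|st] := eqVneq s t; first by case: b; rewrite ?opprB.
  rewrite /= /active cv eqSS eq_sym (negbTE st) /=.
  by case: b.
Qed.

End step_at_time.

Definition step_map k (v : noise) : noise :=
  fun i => if draw_step i == k then v i + delta v i else v i.

Definition step_loss k (v : noise) : R :=
  if code v k is t.+1 then step_time_loss k t v else 0.

Lemma step_map_same k (v : noise) : same_before k (step_map k v) v.
Proof. by move=> i; rewrite /step_map; case: eqP => // ->; rewrite ltnn. Qed.

(** The arrival time is random, so the maps for fixed times are glued along the query code, which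
    the draws of step [k] cannot change. *)
Lemma dominated_step k : dominated mu (step_map k) (fun v => expR (- step_loss k v)).
Proof.
(* No query arrives before time [n], where the law of the noise is not prescribed; the identity
   fills in. *)
pose Psi m : noise -> noise := if m is t.+1 then
  if (n <= t)%N then step_time_map k t else id else id.
pose w m (v : noise) : R := if m is t.+1 then
  if (n <= t)%N then expR (- step_time_loss k t v) else 1 else 1.
have codeE v : code (step_map k v) k = code v k.
  by have [_ _ -> _] := same_before_run (@step_map_same k v).
have ge t v : code v k = t.+1 -> (n <= t)%N.
  rewrite /query_code; case E : (F _) => [[t' f]|] //= [<-].
  by move: E; rewrite -askedE => /(qs_linear qF)[].
have EPsi : step_map k = fun v => Psi (code v k) v.
  apply/funext => v; rewrite /Psi; case cv : (code v k) => [|t].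
    apply/funext => i; rewrite /step_map.
    case: eqP => // ik; rewrite -ik in cv.
    by case: i {ik} cv => [j b|j s b|j s b] /= cv; rewrite /active cv /= addr0.
  by rewrite (ge _ _ cv); apply/funext => i; rewrite active_step_time.
have Ew : (fun v => expR (- step_loss k v)) = fun v => w (code v k) v.
  apply/funext => v; rewrite /w /step_loss; case cv : (code v k) => [|t].
    by rewrite oppr0 expR0.
  by rewrite (ge _ _ cv).
rewrite EPsi Ew; apply: dominated_case => [t|[|t]|v].
- exact: measurable_code.
- exact: dominated_id.
- rewrite /Psi /w; have [nt|_] := boolP (n <= t)%N; last exact: dominated_id.
  exact: dominated_step_time.
- by have := codeE v; rewrite EPsi.
Qed.

Definition coupled k (v : noise) : noise :=
  fun i => if (draw_step i < k)%N then v i + delta v i else v i.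

Definition run_loss k (v : noise) : R := \sum_(j < k) step_loss j v.

Lemma delta_local k (v u : noise) : same_before k v u ->
  forall i, (draw_step i < k)%N -> delta v i = delta u i.
Proof.
move=> vu; have h j : (j < k)%N -> same_before j.+1 v u.
  by move=> jk; exact: same_beforeW vu.
case=> [j b|j t b|j t b] /= jk; have hj := h _ jk;
  have hj' := same_beforeW (leqnSn j) hj; have [e1 _ e3 e4] := same_before_run hj';
  rewrite ?e3 ?e4 ?e1 (active_local _ hj');
  rewrite (@run_above1_local j _ v u) ?(run_above2_local _ hj) ?(shift1_local _ hj') //;
  try (by apply: hj).
- rewrite /shift2 (@run_above1_local j _ v u) ?(shift1_local _ hj') //;
  by apply: hj.
Qed.

Lemma step_loss_local k (v u : noise) : same_before k v u ->
  forall j, (j < k)%N -> step_loss j v = step_loss j u.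
Proof.
move=> vu j jk; have hj := same_beforeW jk vu.
have hj' := same_beforeW (leqnSn j) hj; have [e1 _ e3 e4] := same_before_run hj'.
rewrite /step_loss e3; case: (code u j) => // t.
rewrite /step_time_loss (active_local _ hj') e1 /shift2 (shift1_local _ hj').
by rewrite (@run_above1_local j _ v u) ?(run_above2_local _ hj) ?hj.
Qed.

(** The last step is shifted first. This leaves the earlier draws alone, so shifts and losses of the
    earlier steps are still those of the original noise. *)
Lemma coupledS k : coupled k.+1 = coupled k \o step_map k.
Proof.
apply/funext => v; apply/funext => i /=; rewrite /coupled.
have [ik|ik|ik] := ltngtP (draw_step i) k.
- rewrite ltnS (ltnW ik) {1}/step_map (ltn_eqF ik); congr (_ + _).
  by apply: (delta_local _ ik) => j jk; exact/esym/step_map_same.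
- by rewrite ltnS leqNgt ik /= /step_map (gtn_eqF ik).
- by rewrite ik ltnS leqnn /step_map ik eqxx.
Qed.

Lemma dominated_coupled k :
  dominated mu (coupled k) (fun v => expR (- run_loss k v)).
Proof.
elim: k => [|k IH].
  have -> : coupled 0 = id by [].
  have -> : (fun v => expR (- run_loss 0 v)) = fun=> 1.
    by apply/funext => v; rewrite /run_loss big_ord0 oppr0 expR0.
  exact: dominated_id.
rewrite coupledS; have := dominated_comp IH (dominated_step k).
congr dominated; apply/funext => v.
have -> : run_loss k (step_map k v) = run_loss k v.
  apply: eq_bigr => j _; apply: (step_loss_local _ (ltn_ord j)).
  exact: step_map_same.
have -> : run_loss k.+1 v = step_loss k v + run_loss k v.
  by rewrite /run_loss big_ord_recr addrC.
by rewrite opprD expRD.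
Qed.

End coupling.

(** * Equality of outputs in the coupled runs *)

Section coupled_run.
Context {R : realType} {N : nat} (xi : nat -> R) (alpha : R) (n : nat).
Context (X X' : nat -> 'I_N -> R) (F : strategy R N).
Hypotheses (n0 : (0 < n)%N) (qF : query_stream n F).
Hypotheses (xi_gt0 : forall t, (n <= t)%N -> 0 < xi t)
  (sens_le : forall s t, (n <= s <= t)%N -> sens xi t <= sens xi s)
  (close : forall t f, (n <= t)%N -> linear_query f ->
     `|lin f (X t) - lin f (X' t)| <= t%:R^-1).
Local Notation noise := (coord_space R draw).
Local Notation state := (run_state xi alpha n X F).
Local Notation hist := (run_hist xi alpha n X F).
Local Notation state' := (run_state xi alpha n X' F).
Local Notation hist' := (run_hist xi alpha n X' F).
Local Notation active := (active xi alpha n X F).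
Local Notation delta := (delta xi alpha n X X' F).
Local Notation query := (query_fun xi alpha n X F).
Local Notation shift1 := (shift1 xi alpha n X F).
Local Notation shift2 := (shift2 xi alpha n X F).
Local Notation coupled := (coupled xi alpha n X X' F).
Local Notation run_shift := (run_shift xi alpha n X F).

Definition shifted_state (c : R) (st st' : pmwg_state R N) : Prop :=
  [/\ pub st' = pub st, hard st' = hard st, prev_time st' = prev_time st,
      halted st' = halted st & inst st' = omap (fun e => e + c) (inst st)].

(** If a comparison succeeds, its noise gains the rise of the threshold plus [t%:R^-1], which covers
    the possible loss of query value. If it fails, its noise stays and the threshold rises by at
    least [t%:R^-1], which covers the possible gain. Both outcomes persist, and with them the public
    part of the state. *)
Lemma coupled_step (v v' : noise) k t (st' : pmwg_state R N) : active v k t ->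
  (forall i, draw_step i = k -> v' i = v i + delta v i) ->
  shifted_state (run_shift v k) (state v k) st' ->
  let f := query v k in
  let r := pmwg_step xi alpha n v k t (X t) f (state v k) in
  let r' := pmwg_step xi alpha n v' k t (X' t) f st' in
  r'.1 = r.1 /\ shifted_state (shift2 v k t) r.2 r'.2.
Proof.
move=> act v'E [ep eh et ea ei] f.
have nt := active_ge qF act.
have x0 := xi_gt0 nt.
have t0 : 0 < t%:R :> R by rewrite ltr0n (leq_trans n0 nt).
have nh := active_halted act.
have codeE : query_code xi alpha n X F v k = t.+1.
  by move: act => /andP[/eqP].
have cE : sens xi t / xi t = t%:R^-1 by rewrite /sens; field; rewrite !gt_eqF.
have /ler_normlP[l1 l2] := close nt (active_linear qF act).
have s1 : t%:R^-1 <= shift1 v k t / xi t.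
  by rewrite -cE ler_pM2r ?invr_gt0//; exact: (shift1_ge qF sens_le act).
have s2 : t%:R^-1 <= shift2 v k t / xi t.
  by rewrite -cE ler_pM2r ?invr_gt0//; exact: (shift2_ge qF sens_le act).
set st := state v k in ep eh et ea ei *.
have agedE : aged t st' = aged t st by rewrite /aged et ep.
set a1 := above1 xi alpha v k t (X t) f st.
have e1E : eta1 v' k st' = eta1 v k st + shift1 v k t.
  rewrite /eta1 ei /shift1 -/st; case E : (inst st) => [e|] //=.
  by rewrite v'E //= codeE /= act -/st E.
have a1E : above1 xi alpha v' k t (X' t) f st' = a1.
  have nuE : v' (Nu k t false) = v (Nu k t false) +
      (if a1 then t%:R^-1 + shift1 v k t / xi t else 0).
    by rewrite v'E //= act /run_above1 -/f -/st -/a1.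
  rewrite /above1 agedE e1E nuE (mulrDl (eta1 _ _ _)).
  have [h|h] := boolP a1; move: (h) l1 l2 s1; rewrite /a1 /above1 -/f.
    by lra.
  by rewrite -ltNge => h1 h2 h3 h4; apply/negbTE; rewrite -ltNge; lra.
have e2E : eta2 xi alpha v' k t (X' t) f st' =
    eta2 xi alpha v k t (X t) f st + shift2 v k t.
  rewrite /eta2 a1E -/a1 /shift2 /run_above1 -/f -/st -/a1.
  have [h|h] := boolP a1; last by rewrite e1E.
  by rewrite v'E //= codeE /= act /run_above1 -/f -/st -/a1 h.
set a2 := above2 xi alpha v k t (X t) f st.
have a2E : above2 xi alpha v' k t (X' t) f st' = a2.
  have nuE : v' (Nu k t true) = v (Nu k t true) +
      (if a2 then t%:R^-1 + shift2 v k t / xi t else 0).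
    by rewrite v'E //= act /run_above2 -/f -/st -/a2.
  rewrite /above2 agedE e2E nuE (mulrDl (eta2 _ _ _ _ _ _ _ _)).
  have [h|h] := boolP a2; move: (h) l1 l2 s2; rewrite /a2 /above2 -/f.
    by lra.
  by rewrite -ltNge => h1 h2 h3 h4; apply/negbTE; rewrite -ltNge; lra.
have i2E : inst2 xi alpha v' k t (X' t) f st' =
    omap (fun e => e + shift2 v k t) (inst2 xi alpha v k t (X t) f st).
  by rewrite /inst2 a2E -/a2 e2E; case: (a2).
have ansE : a1 || a2 -> hard_answer xi alpha v' k t (X' t) f st' =
    hard_answer xi alpha v k t (X t) f st.
  rewrite /hard_answer a1E -/a1 agedE !v'E //= act /run_above1 /run_above2 -/f -/st -/a1 -/a2.
  have [_ _|_ /= ->] := boolP a1; rewrite /=; ring.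
have obE : over_budget alpha n t st' = over_budget alpha n t st.
  by rewrite /over_budget eh.
rewrite !pmwg_stepE ea nh /= /step_out /step_state a1E a2E obE agedE i2E eh -/a1 -/a2.
have [hd|_] := boolP (a1 || a2); last by split.
case: ifP => _ /=; first by split.
by rewrite ansE //; split => //; split => //=; rewrite /penalty agedE ansE.
Qed.

Lemma coupled_runE k (v : noise) : hist' (coupled k v) k = hist v k /\
  shifted_state (run_shift v k) (state v k) (state' (coupled k v) k).
Proof.
elim: k => [|k [hE stE]] //.
have agree : pmwg_run xi alpha n (coupled k.+1 v) X' F k =
    pmwg_run xi alpha n (coupled k v) X' F k.
  apply: pmwg_run_local => i ik; rewrite /coupled ik.
  by rewrite (ltn_trans ik (ltnSn k)).
have hE' : hist' (coupled k.+1 v) k = hist v k by rewrite /run_hist agree.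
have sE' : state' (coupled k.+1 v) k = state' (coupled k v) k by rewrite /run_state agree.
rewrite !run_histS !run_stateS /run_out hE' sE'.
have [[t act]|idle] := active_dec xi alpha n X F v k.
  rewrite (activeP act) (run_shiftS act) /=.
  have := @coupled_step v (coupled k.+1 v) k t _ act _ stE.
  case=> [i ik|-> ?] //.
  by rewrite /coupled ik ltnSn.
rewrite run_shiftS_idle //.
case E : (F (hist v k)) => [[t f]|] //=.
have hh : halted (state v k).
  by have := idle t; rewrite /active /query_code E eqxx /= negbK.
rewrite !pmwg_stepE hh; have [_ _ _ -> _] := stE.
by rewrite hh.
Qed.

Lemma coupled_transcript j k (v : noise) : (j < k)%N ->
  run_transcript xi alpha n X' F (coupled k v) j = run_transcript xi alpha n X F v j.
Proof.
move=> jk; have [] := coupled_runE k v.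
rewrite !run_hist_mkseq => /(congr1 (fun s => nth None s j)).
by rewrite !nth_mkseq.
Qed.

End coupled_run.

(** * Total privacy loss of a run *)

Section budget.
Context {R : realType} {N : nat} (xi : nat -> R) (alpha : R) (n : nat).
Context (X : nat -> 'I_N -> R) (F : strategy R N) (eps : R).
Hypotheses (qF : query_stream n F).
Local Notation sens := (sens xi).
Local Notation hb := (hard_bound N alpha n).
Hypotheses (xi_gt0 : forall t, (n <= t)%N -> 0 < xi t)
  (sens_le : forall s t, (n <= s <= t)%N -> sens t <= sens s)
  (hb_ge0 : 0 <= hb n)
  (hb_le : forall s t, (n <= s <= t)%N -> hb s <= hb t)
  (budget : forall t, (n <= t)%N ->
    9 / 4 * (sens n + (hb n * sens n +
      \sum_(n.+1 <= s < t.+1) (hb s - hb s.-1) * sens s)) <= eps).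

(** The total of the sensitivities if every hard query occurs as soon as the quota [hb] permits it,
    when its price is highest: a sum of [sens] against the increments of [hb]. *)
Definition spent (t : nat) : R :=
  hb n * sens n + \sum_(n.+1 <= s < t.+1) (hb s - hb s.-1) * sens s.

(* Bounds the loss after [h] hard queries up to time [t]: the [hb t - h] hard
   queries still available are refunded at the current price [sens t]. *)
Definition allowance (t : nat) (h : R) : R :=
  9 / 8 * (sens n + 2 * (spent t - (hb t - h) * sens t)).

Lemma allowance_le s t h : (n <= s <= t)%N -> h <= hb s ->
  allowance s h <= allowance t h.
Proof.
move=> /andP[ns]; elim: t => [|t IH].
  by rewrite leqn0 => /eqP ->.
rewrite leq_eqVlt => /predU1P[-> //|]; rewrite ltnS => st hs.
apply: le_trans (IH st hs) _.
rewrite /allowance /spent [in leRHS]big_nat_recr ?ltnS ?(leq_trans ns st) //=.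
have c1 : sens t.+1 <= sens t by apply: sens_le; rewrite (leq_trans ns st) leqnSn.
have h1 : hb s <= hb t by apply: hb_le; rewrite ns.
have : 0 <= (hb t - h) * (sens t - sens t.+1).
  by apply: mulr_ge0; lra.
set S := \sum_(_ <= i < _) _; nra.
Qed.

Local Notation state := (run_state xi alpha n X F).
Local Notation hist := (run_hist xi alpha n X F).

Lemma run_prev_time v k t : prev_time (state v k) = Some t ->
  exists j f, (j < k)%N /\ F (hist v j) = Some (t, f).
Proof.
elim: k => [//|k IH]; rewrite run_stateS.
case E : (F (hist v k)) => [[s f]|] /=; last first.
  by move=> /IH[j [f [jk Fj]]]; exists j, f; split => //; exact: ltnW.
rewrite pmwg_stepE; case: ifP => _ /=.
  by move=> /IH[j [f' [jk Fj]]]; exists j, f'; split => //; exact: ltnW.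
rewrite /step_state => h; have -> : t = s.
  by move: h; case: ifP => _; [case: ifP => _|] => -[->].
by exists k, f.
Qed.

(** Before any query the time counts as [n], when the initial quota [hb n] is available. *)
Definition last_time (st : pmwg_state R N) : nat := odflt n (prev_time st).

Lemma last_time_le v k t f : F (hist v k) = Some (t, f) ->
  (n <= last_time (state v k) <= t)%N.
Proof.
rewrite /last_time; case E : (prev_time (state v k)) => [s|] /= Fk; last first.
  by rewrite leqnn; move: Fk; rewrite -askedE => /(qs_linear qF)[].
have [j [f' [jk Fj]]] := run_prev_time E.
rewrite -!askedE in Fj Fk.
by rewrite (qs_ordered qF jk Fj Fk) andbT; have [] := qs_linear qF Fj.
Qed.

(* A running instance has 5/8 of its shift still to pay, when it ends; if no
   instance is running, the next one costs at most 9/8 of the sensitivity. *)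
Definition within_budget v k : Prop :=
  let st := state v k in
  let t := last_time st in
  if halted st then is_true (run_loss xi alpha n X F k v <= eps) else
  (hard st)%:R <= hb t /\
  run_loss xi alpha n X F k v +
    (if isSome (inst st) then 5 / 8 * run_shift xi alpha n X F v k
     else 9 / 8 * sens t) <= allowance t (hard st)%:R.

Lemma last_time_ge v k : (n <= last_time (state v k))%N.
Proof.
rewrite /last_time; case E : (prev_time (state v k)) => [s|] //=.
have [j [f' [jk Fj]]] := run_prev_time E.
by move: Fj; rewrite -askedE => /(qs_linear qF)[].
Qed.

(** A hard query raises the allowance at time [t] by [9 / 4 * sens t], the price of two instances.
    An instance that ends uses up its reserve of [5/8] of its shift, and [9 / 8 * sens t] is set
    aside for its successor, of which [1 / 2 * sens t] is paid when that one starts. An easy query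
    does not increase loss plus reserve. *)
Lemma run_within_budget (v : draw -> R) k : within_budget v k.
Proof.
elim: k => [|k IH].
  rewrite /within_budget /last_time /= /run_loss big_ord0 add0r; split => //.
  rewrite /allowance /spent big_geq // addr0 subr0.
  by have := sens_ge0 xi_gt0 (leqnn n); lra.
have lossS : run_loss xi alpha n X F k.+1 v =
    run_loss xi alpha n X F k v + step_loss xi alpha n X F k v.
  by rewrite /run_loss big_ord_recr.
have [[t act]|idle] := active_dec xi alpha n X F v k; last first.
  have sl0 : step_loss xi alpha n X F k v = 0.
    rewrite /step_loss; case E : query_code => [//|t].
    by rewrite /step_time_loss (negbTE (idle t)) /= !addr0.
  have stE : state v k.+1 = state v k.
    rewrite run_stateS; case E : (F (hist v k)) => [[t f]|] //=.
    rewrite pmwg_stepE; have := idle t.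
    by rewrite /active /query_code E eqxx /= negbK => ->.
  by move: IH; rewrite /within_budget lossS sl0 addr0 stE run_shiftS_idle.
have nt := active_ge qF act.
have Fk := activeP act.
have codeE : query_code xi alpha n X F v k = t.+1 by move: act => /andP[/eqP].
move: IH; rewrite /within_budget lossS (run_shiftS act) run_stateS Fk /= pmwg_stepE.
rewrite (active_halted act) => -[hH hD].
have /andP[n_le le_t] := last_time_le Fk.
have c0 := sens_ge0 xi_gt0 nt.
have cn : sens t <= sens n by apply: sens_le; rewrite leqnn.
have cl : sens t <= sens (last_time (state v k)) by apply: sens_le; rewrite n_le.
have hH' : (hard (state v k))%:R <= hb t.
  by apply: le_trans hH _; apply: hb_le; rewrite n_le.
have hA : allowance (last_time (state v k)) (hard (state v k))%:R <=
    allowance t (hard (state v k))%:R.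
  by apply: allowance_le => //; rewrite n_le.
have bt := budget nt; rewrite -/(spent t) in bt.
set H := (hard (state v k))%:R in hH hD hH' hA *.
have p0 : 0 <= (hb t - H) * sens t by apply: mulr_ge0; lra.
have HS : (hard (state v k)).+1%:R = H + 1 by rewrite natr1.
rewrite /= /step_loss codeE /step_time_loss act /= /step_state.
set a1 := above1 _ _ _ _ _ _ _ _; set a2 := above2 _ _ _ _ _ _ _ _.
rewrite /shift2 /shift1 /inst2 -/(run_above1 xi alpha n X F v k t).
rewrite -/(run_above2 xi alpha n X F v k t) /run_above1 /run_above2 -/a1 -/a2.
set L := run_loss _ _ _ _ _ _ _ in hD *.
set S := run_shift _ _ _ _ _ _ _ in hD *.
rewrite /allowance -/H in hD hA *; rewrite /allowance.
move: hD hA p0 bt; set LT := last_time _.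
set AL := _ * (_ + _) => hD hA p0 bt.
have obE : over_budget alpha n t (state v k) = (hb t < H + 1) by rewrite /over_budget HS.
rewrite obE.
case: (inst (state v k)) hD => [e|] /= hD.
  case: a1 => /=; case: a2 => /=; rewrite ?HS.
  (* Beyond the quota the loss only has to stay below [eps]. The hypothesis [budget] exceeds the
     allowance for a fully used quota by [9 / 8 * sens n], which with the reserve pays for the
     halting query. *)
  - case: ltP => hbH /=; first by lra.
    by rewrite /last_time /= HS; split => //; lra.
  - case: ltP => hbH /=; first by lra.
    by rewrite /last_time /= HS; split => //; lra.
  - case: ltP => hbH /=; first by lra.
    by rewrite /last_time /= HS; split => //; lra.
  - by rewrite /last_time /=; split => //; lra.
case: a1 => /=; case: a2 => /=; rewrite ?HS.
- case: ltP => hbH /=; first by lra.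
  by rewrite /last_time /= HS; split => //; lra.
- case: ltP => hbH /=; first by lra.
  by rewrite /last_time /= HS; split => //; lra.
- case: ltP => hbH /=; first by lra.
  by rewrite /last_time /= HS; split => //; lra.
- by rewrite /last_time /=; split => //; lra.
Qed.

Lemma run_loss_le (v : draw -> R) k : run_loss xi alpha n X F k v <= eps.
Proof.
have := run_within_budget v k; rewrite /within_budget; case: ifP => // _ [hH hD].
have nt := last_time_ge v k.
have c0 := sens_ge0 xi_gt0 nt.
have cn := sens_ge0 xi_gt0 (leqnn n).
have bt := budget nt; rewrite -/(spent _) in bt.
have := run_shift_ge0 alpha X qF xi_gt0 v k.
move: hD bt hH c0; rewrite /allowance; set t := last_time _.
set H := (hard _)%:R; set S := run_shift _ _ _ _ _ _ _ => hD bt hH c0 S0.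
have p0 : 0 <= (hb t - H) * sens t by apply: mulr_ge0; lra.
by move: hD; case: isSome; lra.
Qed.

End budget.

(** * Summability of the privacy loss *)

Section numerics.
Context {R : realType}.
Implicit Types (p q eps alpha : R) (N n t s : nat).

Lemma powR_nat_expR n p : (0 < n)%N -> n%:R `^ p = expR (p * ln n%:R) :> R.
Proof. by move=> n0; rewrite /powR pnatr_eq0 gtn_eqF. Qed.

Lemma ln_nat_ge0 n : (0 < n)%N -> 0 <= ln n%:R :> R.
Proof. by move=> n0; rewrite ln_ge0 // ler1n. Qed.

(** Inverts [7 / 8 <= expR (- (1 / 8))]. Powers of [8 / 7] then serve as rational bounds: the 20th
    for [ln 17], the 64th for [lam] below. *)
Lemma expR_eighth_le : expR (1 / 8) <= 8 / 7 :> R.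
Proof.
have h : 7 / 8 <= expR (- (1 / 8)) :> R.
  by apply: le_trans (expR_ge1Dx _); lra.
rewrite -[leLHS]invrK -expRN -[leRHS]invrK lef_pV2 ?posrE ?expR_gt0 ?invr_gt0 //.
by rewrite invf_div.
Qed.

Lemma ln17_ge : 5 / 2 <= ln 17%:R :> R.
Proof.
rewrite -ler_expR lnK; last by rewrite posrE.
rewrite (_ : 5 / 2 = (1 / 8) * 20%:R); last by lra.
rewrite expRM_natr; apply: (@le_trans _ _ ((8 / 7) ^+ 20)).
  by rewrite lerXn2r ?nnegrE ?expR_ge0 ?expR_eighth_le.
lra.
Qed.

Lemma ln_step_ge s : (1 < s)%N ->
  s%:R^-1 <= ln s%:R - ln (s%:R - 1) :> R.
Proof.
move=> s1.
have s0 : 0 < s%:R :> R by rewrite ltr0n ltnW.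
have s1' : 1 < s%:R :> R by rewrite ltr1n.
have sm : 0 < s%:R - 1 :> R by lra.
have si : s%:R^-1 < 1 :> R by rewrite invf_lt1.
have : ln (1 - s%:R^-1) <= - s%:R^-1 :> R by apply: le_ln1Dx; lra.
rewrite (_ : 1 - s%:R^-1 = (s%:R - 1) / s%:R); last by field; rewrite gt_eqF.
by rewrite ln_div ?posrE//; lra.
Qed.

Lemma b_seqE N t : (1 < t)%N -> b_seq R N t =
  (ln N%:R + ln (t%:R - 1)) / t%:R + (ln t%:R - ln (t%:R - 1)).
Proof.
move=> t1; rewrite /b_seq ln_div ?posrE ?ltr0n ?(ltnW t1) ?subr_gt0 ?ltr1n//.
by rewrite mulrDl.
Qed.

Lemma b_seq_ge0 N t : (0 < N)%N -> (1 < t)%N -> 0 <= b_seq R N t.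
Proof.
move=> N0 t1; rewrite b_seqE//; apply: addr_ge0.
  rewrite divr_ge0// addr_ge0 ?ln_nat_ge0//.
  by rewrite -(natrB _ (ltnW t1)) ln_nat_ge0 // subn_gt0.
by apply: le_trans (ln_step_ge t1); rewrite invr_ge0.
Qed.

(* A discrete primitive: the derivative of [x |-> tail_sum x] is
   [- x `^ (- q - 1) * (ln x + K)]. *)
Definition tail_sum q (K x : R) : R :=
  expR (- q * ln x) * ((ln x + K) / q + (q ^+ 2)^-1).

(** [b_seq R N s] is at most [(ln s - ln (s - 1)) * (ln (s - 1) + ln N + 1)], where the 1 absorbs
    the last term of [b_seq]. The difference of [tail_sum] is bounded from below by
    [1 + u <= expR u] at [u = q * (ln s - ln (s - 1))]. *)
Lemma b_seq_tail q N s : 0 < q -> (0 < N)%N -> (1 < s)%N ->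
  b_seq R N s * expR (- q * ln s%:R) <=
  tail_sum q (ln N%:R + 1) (s.-1)%:R - tail_sum q (ln N%:R + 1) s%:R.
Proof.
move=> q0 N0 s1.
have s0 : 0 < s%:R :> R by rewrite ltr0n ltnW.
have -> : (s.-1)%:R = s%:R - 1 :> R by rewrite -subn1 natrB // ltnW.
have u1 := ln_step_ge s1.
have y0 : 0 <= ln (s%:R - 1) :> R.
  by rewrite -(natrB _ (ltnW s1)) ln_nat_ge0 // subn_gt0.
have l0 := ln_nat_ge0 N0.
rewrite b_seqE // /tail_sum.
set x := ln s%:R in u1 *; set y := ln (s%:R - 1) in u1 y0 *; set l := ln N%:R in l0 *.
rewrite (_ : - q * y = - q * x + q * (x - y)); last by ring.
rewrite expRD -mulrA -mulrBr mulrC ler_pM2l ?expR_gt0//.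
have A0 : 0 <= (y + (l + 1)) / q + (q ^+ 2)^-1.
  by rewrite addr_ge0 ?divr_ge0 ?invr_ge0 ?exprn_ge0 ?addr_ge0 // ltW.
apply: (@le_trans _ _ ((1 + q * (x - y)) * ((y + (l + 1)) / q + (q ^+ 2)^-1) -
    ((x + (l + 1)) / q + (q ^+ 2)^-1))); last first.
  by rewrite lerD2r ler_wpM2r // expR_ge1Dx.
rewrite (_ : _ - (_ + (q ^+ 2)^-1) = (x - y) * (y + (l + 1))); last first.
  by field; rewrite gt_eqF.
have : (l + y) * s%:R^-1 <= (l + y) * (x - y) by rewrite ler_wpM2l // addr_ge0.
nra.
Qed.

Lemma sum_b_seq_tail q N n t : 0 < q -> (0 < N)%N -> (0 < n)%N -> (n <= t)%N ->
  \sum_(n.+1 <= s < t.+1) b_seq R N s * expR (- q * ln s%:R) <=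
  tail_sum q (ln N%:R + 1) n%:R.
Proof.
move=> q0 N0 n0 nt.
have T0 m : (0 < m)%N -> 0 <= tail_sum q (ln N%:R + 1) m%:R.
  move=> m0; rewrite mulr_ge0 ?expR_ge0 // addr_ge0 ?invr_ge0 ?exprn_ge0 ?divr_ge0 ?addr_ge0 ?ln_nat_ge0 // ltW//.
suff h : \sum_(n.+1 <= s < t.+1) b_seq R N s * expR (- q * ln s%:R) <=
    tail_sum q (ln N%:R + 1) n%:R - tail_sum q (ln N%:R + 1) t%:R.
  apply: le_trans h _; rewrite gerBl T0 //; exact: leq_trans nt.
elim: t nt => [|t IH]; first by rewrite leqn0 => /eqP n00; rewrite n00 in n0.
rewrite leq_eqVlt => /predU1P[<-|]; first by rewrite big_geq // subrr.
rewrite ltnS => nt; rewrite big_nat_recr //=.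
have t1 : (1 < t.+1)%N by rewrite ltnS (leq_trans n0 nt).
by have := b_seq_tail q0 N0 t1; have := IH nt; rewrite /=; lra.
Qed.

Section noise_level.
Variables (N n : nat) (p eps alpha : R).
Hypotheses (hp : 1 / 4 <= p < 1) (hN : (3 <= N)%N) (hn : (17 <= n)%N)
  (heps : 0 < eps) (halpha : 0 < alpha).
Local Notation xi := (xi_noise N eps 0 alpha n p).
Local Notation L := (ln (N * n)%:R).
Local Notation hb := (hard_bound N alpha n).
Let N0 : (0 < N)%N. Proof. exact: leq_trans hN. Qed.
Let n0 : (0 < n)%N. Proof. exact: leq_trans hn. Qed.
Let q := 1 - p.
Let q0 : 0 < q. Proof. by rewrite /q; case/andP: hp => ? ?; lra. Qed.

Lemma ln_size_ge : 5 / 2 <= ln n%:R :> R.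
Proof.
by apply: le_trans ln17_ge _; rewrite ler_ln ?posrE ?ltr0n // ler_nat.
Qed.

Lemma ln_prodE : L = ln N%:R + ln n%:R :> R.
Proof. by rewrite natrM lnM ?posrE ?ltr0n. Qed.

Lemma ln_prod_gt0 : 0 < L :> R.
Proof. by rewrite ln_prodE; have := ln_size_ge; have := ln_nat_ge0 N0; lra. Qed.

Let coef_ge0 : 0 <= alpha ^+ 2 * q ^+ 2 / (126 * L) * eps.
Proof.
apply: mulr_ge0; last exact: ltW.
apply: divr_ge0; first by rewrite mulr_ge0 ?sqr_ge0.
by rewrite mulr_ge0 // ltW // ln_prod_gt0.
Qed.

Lemma xi_noiseE t : (0 < t)%N ->
  xi t = alpha ^+ 2 * q ^+ 2 / (126 * L) * eps *
    expR (q * ln n%:R + p * ln t%:R).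
Proof.
move=> t0; rewrite /xi_noise eqxx !powR_nat_expR // expRD -/q.
by field; rewrite gt_eqF // ln_prod_gt0.
Qed.

Lemma xi_noise_gt0 t : (n <= t)%N -> 0 < xi t.
Proof.
move=> nt; rewrite xi_noiseE ?(leq_trans n0 nt)// !mulr_gt0 ?expR_gt0 ?exprn_gt0//.
by rewrite invr_gt0 mulr_gt0 // ln_prod_gt0.
Qed.

Lemma xi_noise_le s t : (n <= s <= t)%N -> xi s <= xi t.
Proof.
move=> /andP[ns st]; have s0 := leq_trans n0 ns; have t0 := leq_trans s0 st.
rewrite !xi_noiseE // ler_wpM2l //.
rewrite ler_expR lerD2l ler_wpM2l //; first by case/andP: hp => ? _; lra.
by rewrite ler_ln ?posrE ?ltr0n // ler_nat.
Qed.

Lemma sensE t : (0 < t)%N -> sens xi t =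
  alpha ^+ 2 * q ^+ 2 / (126 * L) * eps * expR (q * ln n%:R) * expR (- q * ln t%:R).
Proof.
move=> t0; rewrite /sens xi_noiseE // -mulrA -[in RHS]mulrA; congr (_ * _).
rewrite -[X in _ / X](@lnK R) ?posrE ?ltr0n //.
by rewrite -expRN -!expRD; congr expR; rewrite /q; ring.
Qed.

Lemma sens_noise_le s t : (n <= s <= t)%N -> sens xi t <= sens xi s.
Proof.
move=> /andP[ns st]; have s0 := leq_trans n0 ns; have t0 := leq_trans s0 st.
rewrite !sensE // ler_wpM2l //.
  exact: mulr_ge0 coef_ge0 (expR_ge0 _).
rewrite ler_expR !mulNr lerN2 ler_pM2l //.
by rewrite ler_ln ?posrE ?ltr0n // ler_nat.
Qed.

Lemma sens_size : sens xi n = alpha ^+ 2 * q ^+ 2 / (126 * L) * eps.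
Proof. by rewrite sensE // -mulrA -expRD mulNr subrr expR0 mulr1. Qed.

Lemma hard_bound_ge0 : 0 <= hb n.
Proof.
rewrite /hard_bound big_geq // addr0 mulr_ge0 ?ln_nat_ge0 //.
by rewrite divr_ge0 // exprn_ge0 // ltW.
Qed.

Lemma hard_boundS t : (n <= t)%N -> hb t.+1 = hb t + 36 / alpha ^+ 2 * b_seq R N t.+1.
Proof.
by move=> nt; rewrite /hard_bound big_nat_recr ?ltnS//= addrA mulrDr.
Qed.

Lemma hard_bound_le s t : (n <= s <= t)%N -> hb s <= hb t.
Proof.
move=> /andP[ns]; elim: t => [|t IH]; first by rewrite leqn0 => /eqP ->.
rewrite leq_eqVlt => /predU1P[-> //|]; rewrite ltnS => st.
rewrite hard_boundS ?(leq_trans ns st) // ler_wpDr ?IH // mulr_ge0 //.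
  by rewrite divr_ge0 // exprn_ge0 // ltW.
by rewrite b_seq_ge0 // ltnS (leq_trans n0) // (leq_trans ns).
Qed.

(** The factors [alpha ^+ 2] of the noise and of the quota cancel, and [9/4] of [1/126] is [1/56].
    What remains is [alpha ^+ 2 * q ^+ 2 + 36 * (q ^+ 2 * ln N + q * (L + 1) + 1) <= 56 * L]. By
    [q <= 3/4], [alpha <= 1] and [ln N <= L - 5/2] the left side is at most [47.25 * L + 13], and
    [L >= 5/2]. *)
Lemma loss_budget : alpha <= 1 -> forall t, (n <= t)%N ->
  9 / 4 * (sens xi n + (hb n * sens xi n +
    \sum_(n.+1 <= s < t.+1) (hb s - hb s.-1) * sens xi s)) <= eps.
Proof.
move=> alpha1 t nt.
have L0 := ln_prod_gt0; have ln0 := ln_size_ge; have l0 := ln_nat_ge0 N0.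
have a2 : 0 < alpha ^+ 2 by rewrite exprn_gt0.
have sE : \sum_(n.+1 <= s < t.+1) (hb s - hb s.-1) * sens xi s <=
    36 / alpha ^+ 2 * sens xi n * ((L + 1) / q + (q ^+ 2)^-1).
  rewrite (eq_big_nat _ _ (F2 := fun s => (36 / alpha ^+ 2 * (alpha ^+ 2 * q ^+ 2 / (126 * L) * eps * expR (q * ln n%:R))) * (b_seq R N s * expR (- q * ln s%:R)))); last first.
    move=> [//|s] /andP[ns _]; rewrite hard_boundS // sensE //=.
    by rewrite addrAC subrr add0r; ring.
  rewrite -mulr_sumr.
  have := sum_b_seq_tail q0 N0 n0 nt.
  have C0 : 0 <= 36 / alpha ^+ 2 * (alpha ^+ 2 * q ^+ 2 / (126 * L) * eps * expR (q * ln n%:R)).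
    apply: mulr_ge0; first by rewrite divr_ge0 // ltW.
    exact: mulr_ge0 coef_ge0 (expR_ge0 _).
  move=> /(ler_wpM2l C0) /le_trans; apply.
  rewrite sens_size /tail_sum ln_prodE -mulrA.
  rewrite mulNr expRN.
  have := expR_gt0 (q * ln n%:R); set E := expR _ => E0.
  rewrite le_eqVlt; apply/orP; left; apply/eqP.
  by field; rewrite ?gt_eqF //= -ln_prodE.
apply: (@le_trans _ _ (9 / 4 * (sens xi n + (hb n * sens xi n +
    36 / alpha ^+ 2 * sens xi n * ((L + 1) / q + (q ^+ 2)^-1))))).
  by rewrite ler_pM2l // !lerD2l.
rewrite sens_size /hard_bound big_geq // addr0.
rewrite [leLHS](_ : _ = eps / (56 * L) * (alpha ^+ 2 * q ^+ 2 +
   36 * (q ^+ 2 * ln N%:R + q * (L + 1) + 1))); last first.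
  by field; rewrite !gt_eqF.
rewrite mulrAC -mulrA ger_pMr // ler_pdivrMr ?mulr_gt0 // mul1r.
have q1 : q <= 3 / 4 by rewrite /q; case/andP: hp => ? ?; lra.
have qq : q ^+ 2 <= 9 / 16.
  by rewrite expr2 (_ : 9 / 16 = 3 / 4 * (3 / 4)); [rewrite ler_pM // ltW|field].
have aq : alpha ^+ 2 * q ^+ 2 <= 9 / 16.
  apply: le_trans qq; rewrite ger_pMl ?exprn_gt0 //.
  by rewrite expr_le1 // ltW.
have lE : ln N%:R = L - ln n%:R :> R by rewrite ln_prodE; ring.
have h1 : q ^+ 2 * ln N%:R <= 9 / 16 * ln N%:R by rewrite ler_wpM2r.
have h2 : q * (L + 1) <= 3 / 4 * (L + 1) by rewrite ler_wpM2r //; lra.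
lra.
Qed.

End noise_level.
End numerics.

(** * From finitely many outputs to all transcripts *)

Section transcript_approximation.
Context {R : realType}.

Definition finitary (S : set (transcript R)) : Prop :=
  exists k, forall a b : transcript R,
    (forall j, (j < k)%N -> a j = b j) -> S a -> S b.

Lemma finitaryC S : finitary S -> finitary (~` S).
Proof.
move=> [k h]; exists k => a b ab nS Sb; apply: nS; apply: h Sb => j jk.
by rewrite ab.
Qed.

Lemma finitary_bigcup (m : nat) (S : nat -> set (transcript R)) :
  (forall i, finitary (S i)) -> finitary (\bigcup_(i < m) S i).
Proof.
move=> /choice[K h]; exists (\max_(i < m) K i)%N => a b ab [i im Sa].
exists i => //; apply: (h i) Sa => j jk; apply: ab.
exact: leq_trans jk (leq_bigmax (Ordinal im)).
Qed.

Lemma transcript_event_sigma : sigma_algebra setT (@transcript_event R).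
Proof. exact: smallest_sigma_algebra. Qed.

Lemma transcript_event0 : transcript_event (set0 : set (transcript R)).
Proof. by have [] := transcript_event_sigma. Qed.

Lemma transcript_eventC S : @transcript_event R S -> transcript_event (~` S).
Proof. by have [_ + _] := transcript_event_sigma => /[apply]; rewrite setTD. Qed.

Lemma transcript_event_bigcup (S : nat -> set (transcript R)) :
  (forall i, transcript_event (S i)) -> transcript_event (\bigcup_i S i).
Proof. by have [_ _] := transcript_event_sigma; apply. Qed.

Lemma transcript_event_bigcup_ord m (S : nat -> set (transcript R)) :
  (forall i, transcript_event (S i)) -> transcript_event (\bigcup_(i < m) S i).
Proof.
move=> h.
rewrite (_ : \bigcup_(i < m) S i = \bigcup_i (if (i < m)%N then S i else set0)).
  by apply: transcript_event_bigcup => i; case: ifP => // _; exact: transcript_event0.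
apply/seteqP; split => a [i]; first by move=> im Sa; exists i => //; rewrite im.
by move=> _; case: ifP => // im Sa; exists i.
Qed.

Context (d : measure_display) (T : measurableType d) (mu : probability T R).

(** One finitary set has to approximate [S] under two laws at once, since it occurs on both sides of
    the privacy inequality; hence the family indexed by [bool]. *)
Definition near_finitary (g : bool -> T -> transcript R) (S : set (transcript R)) :=
  transcript_event S /\ forall e : R, 0 < e ->
  exists C, [/\ transcript_event C, finitary C & forall b,
    (mu [set x | (S `\` C `|` C `\` S) (g b x)] <= e%:E)%E].

Variables (g : bool -> T -> transcript R).
Hypothesis mg : forall b j, mobs (@obs_option R) (fun x => g b x j).

Let mpre b S : transcript_event S -> measurable [set x | S (g b x)].
Proof. exact: transcript_preimage. Qed.

Lemma near_finitary_event S : transcript_event S -> near_finitary g S.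
Proof.
apply: (smallest_sub (C := sigma_algebra setT)); last first.
  move=> _ [k [B [mB ->]]]; split.
    by apply: sub_sigma_algebra; exists k, B.
  move=> e e0; exists [set a : transcript R | exists2 r, B r & a k = Some r].
  split.
  - by apply: sub_sigma_algebra; exists k, B.
  - by exists k.+1 => a b ab /= [r Br ak]; exists r => //; rewrite -ab.
  - by move=> b; rewrite setDv setU0 (_ : [set x | _] = set0) // measure0 lee_fin ltW.
split.
- split; first exact: transcript_event0.
  move=> e e0; exists set0; split.
  + exact: transcript_event0.
  + by exists 0%N.
  + by move=> b; rewrite setDv setU0 (_ : [set x | _] = set0) // measure0 lee_fin ltW.
- move=> A [eA hA]; rewrite setTD; split; first exact: transcript_eventC.
  move=> e e0; have [C [eC fC h]] := hA e e0; exists (~` C); split.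
  + exact: transcript_eventC.
  + exact: finitaryC.
  + by move=> b; rewrite !setDE !setCK setUC setIC [X in _ `|` X]setIC -!setDE.
- move=> A hA; have eA i : transcript_event (A i) by have [] := hA i.
  split; first exact: transcript_event_bigcup.
  (* Half of the error pays for cutting the union after [m] terms, the other half for approximating
     these terms. *)
  move=> e e0; set W := \bigcup_i A i.
  pose rest b m := [set x | W (g b x)] `\` [set x | (\bigcup_(i < m) A i) (g b x)].
  have mS b : measurable [set x | W (g b x)].
    by apply: mpre; exact: transcript_event_bigcup.
  have mA b m : measurable [set x | (\bigcup_(i < m) A i) (g b x)].
    by apply: mpre; exact: transcript_event_bigcup_ord.
  have mrest b m : measurable (rest b m) by exact: measurableD.
  have rest0 b : \bigcap_m rest b m = set0.
    apply/seteqP; split => x // h.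
    have [[i _ Ai] _] := h 0%N I.
    by have [_] := h i.+1 I; apply; exists i => /=.
  have le_rest b m m' : (m <= m')%N -> rest b m' `<=` rest b m.
    move=> mm' x [Sx nx]; split => // -[i im Ai]; apply: nx; exists i => //=.
    exact: leq_trans im mm'.
  have small b : exists m, (mu (rest b m) <= (e / 2)%:E)%E.
    apply: contrapT => /forallNP hm.
    have cv : (mu \o rest b) x @[x --> \oo] --> mu (\bigcap_m rest b m).
      apply: nonincreasing_cvg_mu => //.
      - by apply: le_lt_trans (ltry 1); exact: probability_le1.
      - by rewrite rest0.
      - by move=> m m' mm'; apply/subsetPset; exact: le_rest.
    rewrite rest0 measure0 in cv.
    have : ((e / 2)%:E <= limn (mu \o rest b))%E.
      apply: lime_ge; first by apply/cvg_ex; exists 0%E.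
      near=> m; apply: ltW; rewrite ltNge; apply/negP; exact: hm.
    by rewrite (cvg_lim _ cv) // lee_fin; lra.
  have [m0 hm0] := small false; have [m1 hm1] := small true.
  pose m := maxn m0 m1.
  have hm b : (mu (rest b m) <= (e / 2)%:E)%E.
    case: b; [apply: le_trans hm1|apply: le_trans hm0];
    apply: le_measure; rewrite ?inE //; apply: le_rest; rewrite ?leq_maxl ?leq_maxr//.
  (* [m.+1] in place of [m] keeps the quotient positive when [m] is 0. *)
  have e'0 : 0 < e / (2 * m.+1%:R) by rewrite divr_gt0 // mulr_gt0.
  have /choice[C hC] i : exists C, [/\ transcript_event C, finitary C & forall b,
     (mu [set x | (A i `\` C `|` C `\` A i) (g b x)] <= (e / (2 * m.+1%:R))%:E)%E].
    by have [_] := hA i; apply.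
  have eC i : transcript_event (C i) by have [] := hC i.
  exists (\bigcup_(i < m) C i); split.
  + exact: transcript_event_bigcup_ord.
  + by apply: finitary_bigcup => i; have [] := hC i.
  move=> b.
  pose D i := [set x | (A i `\` C i `|` C i `\` A i) (g b x)].
  have mD i : measurable (D i).
    by apply: measurableU; apply: measurableD; exact: mpre.
  have mDm : measurable (\bigcup_(i < m) D i) by exact: bigcup_measurable.
  have mSC : measurable [set x | (\bigcup_(i < m) C i) (g b x)].
    by apply: mpre; exact: transcript_event_bigcup_ord.
  apply: (@le_trans _ _ (mu (rest b m `|` \bigcup_(i < m) D i))).
    apply: le_measure; rewrite ?inE.
    * by apply: measurableU; apply: measurableD; [exact: mS|exact: mSC|exact: mSC|exact: mS].
    * exact: measurableU.
    move=> x [[Sx nC]|[[i im Ci] nS]].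
      have [[i im Ai]|nA] := pselect ((\bigcup_(i < m) A i) (g b x)).
        right; exists i => //; left; split => // Ci; apply: nC; by exists i.
      by left.
    right; exists i => //; right; split => // Ai; apply: nS; by exists i.
  apply: le_trans (measureU2 _ _ _) _ => //.
  apply: (@le_trans _ _ ((e / 2)%:E + (e / 2)%:E)%E); last first.
    by rewrite -EFinD lee_fin; lra.
  apply: leeD; first exact: hm.
  rewrite bigcup_mkord.
  have /le_trans := @Boole_inequality _ _ _ mu D m (fun i _ => mD i); apply.
  apply: (@le_trans _ _ (\sum_(i < m) (e / (2 * m.+1%:R))%:E)%E).
    by apply: lee_sum => i _; have [_ _] := hC i; apply.
  rewrite sumEFin lee_fin sumr_const card_ord -[leLHS]mulr_natr.
  rewrite [leRHS](_ : _ = e / (2 * m.+1%:R) * m.+1%:R); last first.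
    by rewrite invfM -!mulrA mulVf ?mulr1 // pnatr_eq0.
  by rewrite ler_wpM2l ?ler_nat // ltW.
Unshelve. all: by end_near. Qed.

Lemma finitary_ratio (c : R) : 0 <= c ->
  (forall C, transcript_event C -> finitary C ->
    (mu [set x | C (g false x)] <= c%:E * mu [set x | C (g true x)])%E) ->
  forall S, transcript_event S ->
    (mu [set x | S (g false x)] <= c%:E * mu [set x | S (g true x)])%E.
Proof.
move=> c0 h S eS; have [_ hS] := near_finitary_event eS.
apply/lee_addgt0Pr => e e0.
(* The error enters once directly and once multiplied by [c]. *)
have e'0 : 0 < e / (1 + c) by rewrite divr_gt0 //; lra.
have [C [eC fC hC]] := hS _ e'0.
have mD b : measurable [set x | (S `\` C `|` C `\` S) (g b x)].
  by apply: measurableU; apply: measurableD; exact: mpre.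
apply: (@le_trans _ _ (mu [set x | C (g false x)] + (e / (1 + c))%:E)%E).
  apply: (@le_trans _ _ (mu ([set x | C (g false x)] `|`
      [set x | (S `\` C `|` C `\` S) (g false x)]))).
    apply: le_measure; rewrite ?inE; [exact: mpre|by apply: measurableU => //; exact: mpre|].
    move=> x Sx; have [Cx|nCx] := pselect (C (g false x)); first by left.
    by right; left.
  apply: le_trans (measureU2 _ _ _) _ => //; first exact: mpre.
  by apply: leeD2l; exact: hC.
apply: (@le_trans _ _ (c%:E * (mu [set x | S (g true x)] + (e / (1 + c))%:E)
    + (e / (1 + c))%:E)%E).
  rewrite leeD2r //; apply: le_trans (h _ eC fC) _.
  apply: lee_wpmul2l; first by rewrite lee_fin.
  apply: (@le_trans _ _ (mu ([set x | S (g true x)] `|`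
      [set x | (S `\` C `|` C `\` S) (g true x)]))).
    apply: le_measure; rewrite ?inE; [exact: mpre|by apply: measurableU => //; exact: mpre|].
    move=> x Cx; have [Sx|nSx] := pselect (S (g true x)); first by left.
    by right; right.
  apply: le_trans (measureU2 _ _ _) _ => //; first exact: mpre.
  by apply: leeD2l; exact: hC.
rewrite muleDr ?fin_num_adde_defl // -addeA leeD2l // -EFinM -EFinD lee_fin.
by rewrite -[X in _ + X]mul1r -mulrDl addrC mulrC mulfVK // gt_eqF //; lra.
Qed.

End transcript_approximation.

(** * Privacy of the mechanism *)

Section privacy.
Context {R : realType} {N : nat} (xi : nat -> R) (alpha : R) (n : nat).
Context (X X' : nat -> 'I_N -> R) (F : strategy R N).
Hypotheses (N0 : (0 < N)%N) (n0 : (0 < n)%N) (qF : query_stream n F).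
Hypotheses (xi_gt0 : forall t, (n <= t)%N -> 0 < xi t)
  (sens_le : forall s t, (n <= s <= t)%N -> sens xi t <= sens xi s)
  (close : forall t f, (n <= t)%N -> linear_query f ->
     `|lin f (X t) - lin f (X' t)| <= t%:R^-1).
Context (d : measure_display) (Omega : measurableType d)
  (P : probability Omega R) (V : draw -> {RV P >-> R}).
Hypothesis hV : noise_draws n xi V.
Variable eps : R.
Hypothesis loss_le : forall (v : draw -> R) k, run_loss xi alpha n X F k v <= eps.
Local Notation mu := (joint_law V).

(** The domination of [coupled k] is tested on the indicator of [C] for the run on [X']. Composed
    with the coupling it is the indicator for [X], as [C] reads only [k] outputs, and the weight is
    at least [expR (- eps)]. *)
Lemma finitary_privacy (C : set (transcript R)) : transcript_event C -> finitary C ->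
  (mu [set v | C (run_transcript xi alpha n X F v)] <=
   (expR eps)%:E * mu [set v | C (run_transcript xi alpha n X' F v)])%E.
Proof.
move=> eC [k hk].
have mX : measurable [set v : coord_space R draw | C (run_transcript xi alpha n X F v)].
  exact: measurable_transcript_event.
have mX' : measurable [set v : coord_space R draw | C (run_transcript xi alpha n X' F v)].
  exact: measurable_transcript_event.
have dom := dominated_coupled alpha N0 n0 qF xi_gt0 sens_le close hV k.
pose G (v : coord_space R draw) :=
  (\1_[set v : coord_space R draw | C (run_transcript xi alpha n X' F v)] v)%:E : \bar R.
have mG : measurable_fun setT G by apply/measurable_EFinP; exact: measurable_indic.
have G0 v : (0 <= G v)%E by rewrite lee_fin.
have := dominated_integral dom mG G0.
rewrite [leRHS]integral_indic // setIT => h.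
have {}h : ((expR (- eps))%:E * mu [set v | C (run_transcript xi alpha n X F v)] <=
    mu [set v | C (run_transcript xi alpha n X' F v)])%E.
  apply: le_trans h.
  rewrite -[X in (_ * mu X)%E]setIT -integral_indic // -ge0_integralZl //;
    try by [rewrite lee_fin expR_ge0|apply/measurable_EFinP; exact: measurable_indic].
  apply: ge0_le_integral => //.
  - by apply: measurable_funeM; apply/measurable_EFinP; exact: measurable_indic.
  - apply: dominated_integrand => //; first exact: dominated_map dom.
    exact: dominated_weight dom.
  move=> v _; rewrite /G !indicE.
  have -> : (v \in [set v | C (run_transcript xi alpha n X F v)]) =
      (coupled xi alpha n X X' F k v \in
       [set v : coord_space R draw | C (run_transcript xi alpha n X' F v)]).
    have tr j : (j < k)%N -> run_transcript xi alpha n X F v j =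
        run_transcript xi alpha n X' F (coupled xi alpha n X X' F k v) j.
      by move=> jk; rewrite (coupled_transcript alpha n0 qF xi_gt0 sens_le close).
    apply/idP/idP; rewrite !inE /=; apply: hk => j jk; rewrite tr //.
  rewrite -!EFinM lee_fin ler_wpM2r // ler_expR lerN2; exact: loss_le.
apply: le_trans (_ : ((expR eps)%:E * ((expR (- eps))%:E *
   mu [set v | C (run_transcript xi alpha n X F v)]) <= _)%E).
  by rewrite muleA -EFinM -expRD subrr expR0 mul1e.
by apply: lee_wpmul2l => //; rewrite lee_fin expR_ge0.
Qed.

Lemma transcript_privacy (S : set (transcript R)) : transcript_event S ->
  (mu [set v | S (run_transcript xi alpha n X F v)] <=
   (expR eps)%:E * mu [set v | S (run_transcript xi alpha n X' F v)])%E.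
Proof.
apply: (@finitary_ratio _ _ _ mu (fun b v =>
    if b then run_transcript xi alpha n X' F v else run_transcript xi alpha n X F v)).
- by case=> j; exact: mobs_run_transcript.
- exact: expR_ge0.
- exact: finitary_privacy.
Qed.

End privacy.

Lemma neighboring_close (R : realType) (N n : nat) (X X' : nat -> 'I_N -> R) :
  neighboring_streams n X X' -> forall t (f : 'I_N -> R), (n <= t)%N ->
  linear_query f -> `|lin f (X t) - lin f (X' t)| <= t%:R^-1.
Proof.
move=> [t0 [_ same nb]] t f nt lf.
have [tt0|t0t] := ltnP t t0.
  rewrite (_ : lin f (X t) = lin f (X' t)); first by rewrite subrr normr0 invr_ge0.
  by apply: eq_bigr => i _; rewrite same // nt.
have [i [i' [_ e]]] := nb t t0t.
have lE (j : 'I_N) : \sum_(l < N) f l * ((l == j)%:R / t%:R) = f j / t%:R.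
  rewrite (bigD1 j) //= eqxx big1 ?addr0 ?mul1r// => l /negbTE ->.
  by rewrite mul0r mulr0.
have -> : lin f (X t) - lin f (X' t) = (f i - f i') / t%:R.
  rewrite mulrBl -!lE /lin -!sumrB; apply: eq_bigr => l _; rewrite e; ring.
rewrite normrM normfV [`|t%:R|]ger0_norm // -[leRHS]mul1r ler_wpM2r ?invr_ge0//.
have /andP[a b] := lf i; have /andP[a' b'] := lf i'.
by rewrite ler_norml; apply/andP; split; lra.
Qed.

(** * The cross entropy potential *)

Section cross_entropy.
Context {R : realType} {N : nat}.
Hypothesis N0 : (0 < N)%N.
Implicit Types (x y f : 'I_N -> R).

(** Relative entropy plus the entropy of [x]. Unlike relative entropy it is linear in [x], so a new
    entry contributes one explicit term; it is still nonnegative, and it starts at [ln N]. *)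
Definition cross_entropy x y : R := - \sum_(i < N) x i * ln (y i).

Definition distr x : Prop := (forall i, 0 <= x i) /\ \sum_(i < N) x i = 1.

Definition pos_distr y : Prop := (forall i, 0 < y i) /\ \sum_(i < N) y i = 1.

Lemma pos_distr_le1 y i : pos_distr y -> y i <= 1.
Proof.
move=> [y0 <-]; rewrite (bigD1 i) //= lerDl sumr_ge0 // => j _.
exact: ltW.
Qed.

Lemma database_distr t x : (0 < t)%N -> database t x -> distr x.
Proof.
move=> t0 [c [ct xE]]; split => [i|]; first by rewrite xE divr_ge0.
under eq_bigr do rewrite xE.
by rewrite -mulr_suml -natr_sum ct divff // pnatr_eq0 -lt0n.
Qed.

Lemma cross_entropy_ge0 x y : distr x -> pos_distr y -> 0 <= cross_entropy x y.
Proof.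
move=> [x0 _] dy; rewrite /cross_entropy -sumrN sumr_ge0 // => i _.
by rewrite -mulrN mulr_ge0 // oppr_ge0 ln_le0 // pos_distr_le1.
Qed.

Definition uniform_hist : 'I_N -> R := fun=> 1 / N%:R.

Lemma uniform_pos_distr : pos_distr uniform_hist.
Proof.
split=> [i|]; first by rewrite divr_gt0 // ltr0n.
by rewrite sumr_const card_ord -[LHS]mulr_natr mul1r mulVf // pnatr_eq0 -lt0n.
Qed.

Lemma cross_entropy_uniform x : distr x -> cross_entropy x uniform_hist = ln N%:R.
Proof.
move=> [_ x1]; rewrite /cross_entropy /uniform_hist -mulr_suml x1 mul1r.
by rewrite mul1r lnV ?posrE ?ltr0n // opprK.
Qed.

Definition age (s t : nat) y : 'I_N -> R :=
  fun i => s%:R / t%:R * y i + (t - s)%:R / t%:R * (1 / N%:R).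

Lemma age_id s y : (0 < s)%N -> age s s y = y.
Proof.
move=> s0; apply/funext => i; rewrite /age subnn divff ?pnatr_eq0 -?lt0n //.
by rewrite !mul0r addr0 mul1r.
Qed.

(** Ageing over several units of time at once, as at a query after a pause, agrees with ageing unit
    by unit, so the entropy can be followed one entry at a time. *)
Lemma ageS s t y : (0 < s)%N -> (s <= t)%N -> age s t.+1 y = age t t.+1 (age s t y).
Proof.
move=> s0 st; have t0 := leq_trans s0 st.
apply/funext => i; rewrite /age !natrB // ?(leqW st) // -natr1.
have tR : 0 < t%:R :> R by rewrite ltr0n.
have NR : 0 < N%:R :> R by rewrite ltr0n.
by field; rewrite !gt_eqF //= ?ltr_wpDl // ltW.
Qed.

Lemma age_uniform s t : (0 < t)%N -> (s <= t)%N -> age s t uniform_hist = uniform_hist.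
Proof.
move=> t0 st; apply/funext => i; rewrite /age /uniform_hist natrB // -mulrDl.
rewrite -mulrDl (addrC s%:R) subrK divff ?mul1r // pnatr_eq0 -lt0n.
exact: t0.
Qed.

Lemma age_pos_distr s t y : (0 < s)%N -> (s <= t)%N -> pos_distr y ->
  pos_distr (age s t y).
Proof.
move=> s0 st [y0 y1]; have t0 := leq_trans s0 st.
have [_] := uniform_pos_distr; rewrite /uniform_hist => u1.
split=> [i|]; rewrite /age.
  apply: ltr_wpDr; first by rewrite mulr_ge0 // divr_ge0.
  by rewrite mulr_gt0 // divr_gt0 // ltr0n.
rewrite big_split /= -mulr_sumr -mulr_sumr y1 u1 !mulr1 -mulrDl natrB //.
rewrite (addrC s%:R) subrK.
by rewrite divff // pnatr_eq0 -lt0n.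
Qed.

(** Ageing keeps at least [s / s.+1] of each [y j] and leaves at least [1 / (N * s.+1)] at the new
    entry. So the old entries, of weight [s / s.+1], cost at most [ln s.+1 - ln s] more, and the new
    one at most [ln N + ln s.+1]. These costs combine to exactly [b_seq R N s.+1]; the factor
    [s / s.+1] on the old entropy is dropped as that entropy is nonnegative. *)
Lemma cross_entropy_age1 s x x' y : (0 < s)%N -> distr x -> pos_distr y ->
  add_entry s x x' ->
  cross_entropy x' (age s s.+1 y) <= cross_entropy x y + b_seq R N s.+1.
Proof.
move=> s0 dx dy [i xE].
have sR : 0 < s%:R :> R by rewrite ltr0n.
have s1R : 0 < s.+1%:R :> R by rewrite ltr0n.
have NR : 0 < N%:R :> R by rewrite ltr0n.
have [x0 x1] := dx; have [y0 y1] := dy.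
have CE0 := cross_entropy_ge0 dx dy.
set y' := age s s.+1 y.
have y'0 j : 0 < y' j by have [+ _] := age_pos_distr s0 (leqnSn s) dy; apply.
have l1 j : ln (y j) + (ln s%:R - ln s.+1%:R) <= ln (y' j).
  rewrite -ln_div ?posrE // -lnM ?posrE ?divr_gt0 // ler_ln ?posrE ?mulr_gt0 ?divr_gt0//.
  by rewrite /y' /age mulrC lerDl mulr_ge0 // divr_ge0.
have l2 : - (ln N%:R + ln s.+1%:R) <= ln (y' i).
  rewrite -lnM ?posrE // -lnV ?posrE ?mulr_gt0 // ler_ln ?posrE ?invr_gt0 ?mulr_gt0 //.
  rewrite /y' /age subSnn invfM mulrC mul1r mul1r lerDr.
  by rewrite mulr_ge0 ?divr_ge0 // ltW.
have E : \sum_(j < N) x' j * ln (y' j) =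
   (s%:R * \sum_(j < N) x j * ln (y' j) + ln (y' i)) / s.+1%:R.
  rewrite (eq_bigr (fun j => (s%:R / s.+1%:R) * (x j * ln (y' j)) +
     s.+1%:R^-1 * ((j == i)%:R * ln (y' j)))); last by move=> j _; rewrite xE; ring.
  have D : \sum_(j < N) (j == i)%:R * ln (y' j) = ln (y' i).
    rewrite (bigD1 i) //= eqxx mul1r big1 ?addr0 // => j /negbTE ->.
    by rewrite mul0r.
  by rewrite big_split /= -!mulr_sumr D; ring.
have l3 : \sum_(j < N) x j * ln (y j) + (ln s%:R - ln s.+1%:R) <=
    \sum_(j < N) x j * ln (y' j).
  set c := ln s%:R - ln s.+1%:R in l1 *.
  have -> : c = \sum_(j < N) x j * c by rewrite -mulr_suml x1 mul1r.
  rewrite -big_split /=; apply: ler_sum => j _; rewrite -mulrDr.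
  exact: (ler_wpM2l (x0 j) (l1 j)).
rewrite /cross_entropy in CE0 *; rewrite E b_seqE //.
rewrite (_ : s.+1%:R - 1 = s%:R); last by rewrite -natr1 addrK.
set A := \sum_(j < N) x j * ln (y j) in l3 CE0 *.
set B := \sum_(j < N) x j * ln (y' j) in l3 *.
have h1 : s%:R * (A + (ln s%:R - ln s.+1%:R)) <= s%:R * B by rewrite ler_pM2l.
move: l2 h1; set l' := ln (y' i); set l1' := ln s.+1%:R; set l0 := ln s%:R.
set lN := ln N%:R => l2 h1.
rewrite -mulNr ler_pdivrMr // (_ : _ * s.+1%:R = lN + l0 + (l1' - l0 - A) * (s%:R + 1)).
  by rewrite mulrDr mulr1; nra.
by rewrite -natr1; field; rewrite natr1 gt_eqF.
Qed.

Lemma cross_entropy_age n s t (X : nat -> 'I_N -> R) y : (0 < n)%N -> (n <= s <= t)%N ->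
  database_stream n X -> pos_distr y ->
  cross_entropy (X t) (age s t y) <=
  cross_entropy (X s) y + \sum_(s.+1 <= u < t.+1) b_seq R N u.
Proof.
move=> n0 /andP[ns]; have s0 := leq_trans n0 ns.
elim: t => [|t IH]; first by rewrite leqn0 => /eqP s00; rewrite s00 in s0.
rewrite leq_eqVlt => /predU1P[<- _ _|]; first by rewrite age_id // big_geq // addr0.
rewrite ltnS => st dX dy; rewrite ageS // big_nat_recr //= addrA.
have nt := leq_trans ns st; have t0 := leq_trans s0 st.
have [d1 d2] := dX.
apply: le_trans (cross_entropy_age1 t0 _ _ (d2 t nt)) _.
- exact: database_distr t0 (d1 t nt).
- exact: age_pos_distr.
by rewrite lerD2r IH.
Qed.

(** [(1 - u + u ^+ 2) * (1 + u) = 1 + u ^+ 3 >= 1], and [1 + u <= expR u]. *)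
Lemma expRN_le (u : R) : 0 <= u -> expR (- u) <= 1 - u + u ^+ 2.
Proof.
move=> u0; have h := expR_ge1Dx u.
have h0 : 0 <= 1 - u + u ^+ 2 by rewrite expr2; nra.
rewrite expRN -[leLHS]mul1r ler_pdivrMr ?expR_gt0 //.
apply: le_trans (ler_wpM2l h0 h).
have : 0 <= u ^+ 3 by rewrite exprn_ge0.
by rewrite (_ : _ * _ = 1 + u ^+ 3); [lra|ring].
Qed.

Lemma sum_update alpha r y : 0 < alpha -> linear_query r -> pos_distr y ->
  \sum_(i < N) y i * expR (- (alpha * r i / 6)) <=
  1 - alpha / 6 * lin r y + alpha ^+ 2 / 36.
Proof.
move=> a0 hr [y0 y1].
apply: (@le_trans _ _ (\sum_(i < N) (y i - alpha / 6 * (r i * y i) + alpha ^+ 2 / 36 * y i))).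
  apply: ler_sum => i _; have /andP[r0 r1] := hr i.
  have u0 : 0 <= alpha * r i / 6 by rewrite divr_ge0 // mulr_ge0 // ltW.
  have h := expRN_le u0; have yi := y0 i.
  apply: (@le_trans _ _ (y i * (1 - alpha * r i / 6 + (alpha * r i / 6) ^+ 2))).
    by rewrite ler_pM2l.
  have : alpha ^+ 2 * r i ^+ 2 * y i <= alpha ^+ 2 * y i.
    rewrite -mulrA ler_pM2l ?exprn_gt0 // ger_pMl //.
    by rewrite expr_le1.
  rewrite !expr2; nra.
by rewrite !big_split /= sumrN -!mulr_sumr y1 mulr1.
Qed.

Lemma update_pos_distr alpha r y : pos_distr y -> pos_distr (pub_update alpha r y).
Proof.
move=> [y0 y1].
have Z0 : 0 < \sum_(i < N) y i * expR (- (alpha * r i / 6)).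
  rewrite (bigD1 (Ordinal N0)) //= ltr_wpDr ?mulr_gt0 ?expR_gt0 // sumr_ge0 // => i _.
  by rewrite mulr_ge0 ?expR_ge0 // ltW.
split=> [i|]; first by rewrite /pub_update divr_gt0 // mulr_gt0 ?expR_gt0.
by rewrite /pub_update -mulr_suml divff // gt_eqF.
Qed.

(** The change is exactly [alpha / 6 * lin r x + ln Z] with [Z] the normalizing sum; [ln Z <= Z - 1]
    and [sum_update] bound the second term. *)
Lemma cross_entropy_update alpha r x y : 0 < alpha -> linear_query r ->
  distr x -> pos_distr y ->
  cross_entropy x (pub_update alpha r y) <=
  cross_entropy x y - alpha / 6 * (lin r y - lin r x) + alpha ^+ 2 / 36.
Proof.
move=> a0 hr [x0 x1] dy; have [y0 y1] := dy.
have Zle := sum_update a0 hr dy.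
have Z0 : 0 < \sum_(i < N) y i * expR (- (alpha * r i / 6)).
  rewrite (bigD1 (Ordinal N0)) //= ltr_wpDr ?mulr_gt0 ?expR_gt0 // sumr_ge0 // => i _.
  by rewrite mulr_ge0 ?expR_ge0 // ltW.
rewrite /cross_entropy /pub_update.
set Z := \sum_(i < N) y i * expR _ in Zle Z0 *.
have lnZ : ln Z <= Z - 1.
  by rewrite -{1}(subrK 1 Z) addrC le_ln1Dx //; lra.
rewrite (eq_bigr (fun i => x i * ln (y i) - alpha / 6 * (r i * x i) - x i * ln Z)).
  rewrite !big_split /= !sumrN -mulr_sumr -mulr_suml x1 mul1r -/(lin r x).
  lra.
move=> i _; rewrite ln_div ?posrE ?mulr_gt0 ?expR_gt0 // lnM ?posrE ?expR_gt0 // expRK.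
by field.
Qed.

End cross_entropy.

(** * Accuracy when the noise is small *)

Section accurate_run.
Context {R : realType} {N : nat} (xi : nat -> R) (alpha : R) (n : nat).
Context (X : nat -> 'I_N -> R) (F : strategy R N).
Hypotheses (N0 : (0 < N)%N) (n0 : (0 < n)%N) (qF : query_stream n F)
  (dX : database_stream n X) (alpha0 : 0 < alpha).
Hypotheses (xi_gt0 : forall t, (n <= t)%N -> 0 < xi t)
  (xi_le : forall s t, (n <= s <= t)%N -> xi s <= xi t).
Local Notation state := (run_state xi alpha n X F).
Local Notation hist := (run_hist xi alpha n X F).
Local Notation last_time := (last_time n).

(** Threshold noise divided by [xi t] and comparison noise add up to at most [alpha / 3], half of
    the threshold: success means a gap above [alpha / 3], failure a gap of at most [alpha]. Answer
    noise below [alpha / 3] then cannot reverse the sign of the gap. *)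
Definition small_noise (v : draw -> R) (k t : nat) : Prop := forall b,
  [/\ `|v (Eta k b)| < alpha / 9 * xi t, `|v (Nu k t b)| < 2 / 9 * alpha &
      `|v (Zed k t b)| < alpha / 3].

Variable v : draw -> R.
Hypothesis small : forall k t f, F (hist v k) = Some (t, f) -> small_noise v k t.

(** The last clause is the potential. The third reconciles two conventions: the algorithm does not
    age the histogram at its first query, while the potential is followed from time [n]; the uniform
    histogram is fixed by ageing. *)
Definition on_track k : Prop :=
  let st := state v k in
  let s := last_time st in
  [/\ halted st = false, pos_distr (pub st),
      prev_time st = None -> pub st = @uniform_hist R N,
      (forall e, inst st = Some e -> `|e| <= alpha / 9 * xi s) &
      (hard st)%:R * (alpha ^+ 2 / 36) + cross_entropy (X s) (pub st) <=
        ln N%:R + \sum_(n.+1 <= u < s.+1) b_seq R N u].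

(** The halting test, rescaled to the units of the potential. *)
Lemma le_hard_bound (h : R) t : (h <= hard_bound N alpha n t) =
  (h * (alpha ^+ 2 / 36) <= ln N%:R + \sum_(n.+1 <= u < t.+1) b_seq R N u).
Proof.
have a2 : 0 < alpha ^+ 2 / 36 by rewrite divr_gt0 // exprn_gt0.
rewrite /hard_bound -[in RHS](ler_pM2l (x := 36 / alpha ^+ 2)); last first.
  by rewrite divr_gt0 // exprn_gt0.
rewrite (_ : 36 / alpha ^+ 2 * (h * (alpha ^+ 2 / 36)) = h) //.
by field; rewrite gt_eqF.
Qed.

Lemma lin_compl (f x : 'I_N -> R) : \sum_(i < N) x i = 1 ->
  lin (fun i => 1 - f i) x = 1 - lin f x.
Proof.
move=> x1; rewrite /lin; under eq_bigr do rewrite mulrBl mul1r.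
by rewrite sumrB x1.
Qed.

Lemma on_track_step k t f : on_track k -> F (hist v k) = Some (t, f) ->
  (exists2 a, run_out xi alpha n X F v k = Some a & `|lin f (X t) - a| <= alpha) /\
  on_track k.+1.
Proof.
move=> [nh dy un ie ce] Fk.
have /andP[ns st] := last_time_le qF Fk.
have [nt lf] : (n <= t)%N /\ linear_query f.
  by move: Fk; rewrite -askedE; exact: qs_linear.
have t0 := leq_trans n0 nt.
have x0 := xi_gt0 nt.
have sm := small Fk.
have dx : distr (X t) by apply: database_distr t0 _; exact: dX.1.
set s := last_time (state v k) in ns st ie ce.
have s0 := leq_trans n0 ns.
have agedE : aged t (state v k) = age s t (pub (state v k)).
  rewrite /aged /pub_age /s /last_time.
  case E : (prev_time (state v k)) => [u|] /=; last first.
    by rewrite un // age_uniform.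
  have us : u = s by rewrite /s /last_time E.
  rewrite us; case: ltnP => // ts.
  have -> : t = s by apply/eqP; rewrite eqn_leq ts st.
  by rewrite age_id.
set y := aged t (state v k) in agedE *.
have dy' : pos_distr y by rewrite agedE; exact: age_pos_distr.
have cey : (hard (state v k))%:R * (alpha ^+ 2 / 36) + cross_entropy (X t) y <=
    ln N%:R + \sum_(n.+1 <= u < t.+1) b_seq R N u.
  have nst : (n <= s <= t)%N by rewrite ns.
  have := cross_entropy_age N0 n0 nst dX dy.
  rewrite -agedE (@big_cat_nat _ _ _ s.+1 n.+1 t.+1) ?ltnS //=.
  by lra.
have div_le e : `|e| <= alpha / 9 * xi t -> `|e / xi t| <= alpha / 9.
  by move=> h; rewrite normrM normfV [`|xi t|]gtr0_norm // ler_pdivrMr.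
have [sE1 sN1 sZ1] := sm false; have [sE2 sN2 sZ2] := sm true.
(* The noise of a running instance was bounded with the level of an earlier time; as [xi] increases,
   the bound holds at [t]. *)
have e1 : `|eta1 v k (state v k) / xi t| <= alpha / 9.
  apply: div_le; rewrite /eta1; case E : (inst (state v k)) => [e|] /=; last exact: ltW.
  apply: le_trans (ie _ E) _; rewrite ler_pM2l ?divr_gt0 //.
  by apply: xi_le; rewrite ns.
set a1 := above1 xi alpha v k t (X t) f (state v k).
have e2' : `|eta2 xi alpha v k t (X t) f (state v k)| <= alpha / 9 * xi t.
  rewrite /eta2 -/a1; case: ifP => _; first exact: ltW.
  by move: e1; rewrite normrM normfV [`|xi t|]gtr0_norm // ler_pdivrMr.
have e2 := div_le _ e2'.
set a2 := above2 xi alpha v k t (X t) f (state v k).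
move: e1 e2 sN1 sN2 sZ1 sZ2.
rewrite !ler_norml !ltr_norml => /andP[e1l e1u] /andP[e2l e2u] /andP[n1l n1u] /andP[n2l n2u]
  /andP[z1l z1u] /andP[z2l z2u].
pose gap := lin f (X t) - lin f y.
have a1T : a1 -> alpha / 3 < gap.
  by rewrite /a1 /above1 -/y /gap; lra.
have a1F : ~~ a1 -> gap <= alpha by rewrite /a1 /above1 -/y -ltNge /gap; lra.
have a2T : a2 -> alpha / 3 < - gap.
  by rewrite /a2 /above2 -/y /gap; lra.
have a2F : ~~ a2 -> - gap <= alpha by rewrite /a2 /above2 -/y -ltNge /gap; lra.
have i2 e : inst2 xi alpha v k t (X t) f (state v k) = Some e -> `|e| <= alpha / 9 * xi t.
  by rewrite /inst2; case: ifP => // _ [<-].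
have [hd|easy] := boolP (a1 || a2); last first.
  have [na1 na2] : ~~ a1 /\ ~~ a2 by apply/andP; rewrite -negb_or.
  split.
    exists (lin f y).
      by rewrite /run_out Fk /= pmwg_stepE nh /step_out -/a1 -/a2 (negbTE easy).
    by have := a1F na1; have := a2F na2; rewrite /gap ler_norml => ? ?; apply/andP; split; lra.
  rewrite /on_track run_stateS Fk /= pmwg_stepE nh /step_state -/a1 -/a2 (negbTE easy).
  by split.
set a := hard_answer xi alpha v k t (X t) f (state v k).
set r := penalty xi alpha v k t (X t) f (state v k).
have aE : `|lin f (X t) - a| <= alpha.
  rewrite /a /hard_answer -/a1 -/y; case: ifP => _; rewrite ler_norml; apply/andP; split; lra.
have [_ y1] := dy'; have [_ x1] := dx.
(* The answer lies on the same side of [lin f y] as the true value, so the public histogram gives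
   the penalty [r] at least [alpha / 3] more than the data do. *)
have rP : linear_query r /\ alpha / 3 <= lin r y - lin r (X t).
  rewrite /r /penalty -/a -/y /a /hard_answer -/a1 -/y.
  have [h1|h1] := boolP a1.
    have := a1T h1; rewrite /gap => g1.
    rewrite ifF; last by apply/negbTE; rewrite -leNgt; lra.
    split; first by move=> i; have /andP[f0 f1] := lf i; apply/andP; split; lra.
    by rewrite !lin_compl //; lra.
  have h2 : a2 by move: hd; rewrite (negbTE h1).
  have := a2T h2; rewrite /gap => g2.
  rewrite ifT; last by lra.
  by split => //; lra.
have [lr rgap] := rP.
have ce' := cross_entropy_update N0 alpha0 lr dx dy'.
have dec : alpha / 6 * (alpha / 3) <= alpha / 6 * (lin r y - lin r (X t)).
  by rewrite ler_pM2l // divr_gt0.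
have ceS : (hard (state v k)).+1%:R * (alpha ^+ 2 / 36) +
    cross_entropy (X t) (pub_update alpha r y) <=
    ln N%:R + \sum_(n.+1 <= u < t.+1) b_seq R N u.
  (* The gap yields a drop of [alpha ^+ 2 / 18], half of which is used up by the second-order term
     of the update. *)
  have sq : alpha / 6 * (alpha / 3) = alpha ^+ 2 / 36 + alpha ^+ 2 / 36 by field.
  by rewrite -natr1 mulrDl mul1r; lra.
have du := update_pos_distr N0 alpha r dy'.
(* The updated histogram is considered before it is known that the algorithm continues: its
   potential bounds the new hard-query count because cross entropy is nonnegative. *)
have nob : over_budget alpha n t (state v k) = false.
  apply/negbTE; rewrite /over_budget -leNgt le_hard_bound.
  by have := cross_entropy_ge0 dx du; lra.
split.
  by exists a => //; rewrite /run_out Fk /= pmwg_stepE nh /step_out -/a1 -/a2 hd nob.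
rewrite /on_track run_stateS Fk /= pmwg_stepE nh /step_state -/a1 -/a2 hd nob.
by split.
Qed.

Lemma run_on_track k : on_track k.
Proof.
elim: k => [|k IH].
  split => //; first exact: uniform_pos_distr.
  rewrite /= /last_time /= mul0r add0r big_geq // addr0.
  rewrite (cross_entropy_uniform N0) //.
  by apply: database_distr n0 _; exact: dX.1.
case E : (F (hist v k)) => [[t f]|]; first by have [] := on_track_step IH E.
by rewrite /on_track run_stateS E.
Qed.

Lemma accurate_answer k t f : F (hist v k) = Some (t, f) ->
  exists2 a, run_out xi alpha n X F v k = Some a & `|lin f (X t) - a| <= alpha.
Proof. by move=> Fk; have [] := on_track_step (run_on_track k) Fk. Qed.

End accurate_run.

(** * Probability of large noise *)

(** Query counts are bounded only through their partial sums, while the weights decrease. The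
    induction carries the surplus of the partial sums times the last weight. *)
Lemma abel_summation_le (R : realDomainType) (m E w : nat -> R) (n T : nat) :
  (n <= T)%N -> (forall s, (n <= s)%N -> 0 <= w s) ->
  (forall s, (n <= s)%N -> w s.+1 <= w s) ->
  (forall t, (n <= t)%N -> \sum_(n <= s < t.+1) m s <= \sum_(n <= s < t.+1) E s) ->
  \sum_(n <= s < T.+1) m s * w s <= \sum_(n <= s < T.+1) E s * w s.
Proof.
move=> nT w0 wS mE.
suff : (\sum_(n <= s < T.+1) E s - \sum_(n <= s < T.+1) m s) * w T <=
    \sum_(n <= s < T.+1) E s * w s - \sum_(n <= s < T.+1) m s * w s.
  have : 0 <= (\sum_(n <= s < T.+1) E s - \sum_(n <= s < T.+1) m s) * w T.
    by rewrite mulr_ge0 ?w0 // subr_ge0 mE.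
  by lra.
elim: T nT => [|T IH] nT.
  by move: nT; rewrite leqn0 => /eqP ->; rewrite !big_nat1; lra.
move: nT; rewrite leq_eqVlt => /predU1P[<-|]; first by rewrite !big_nat1; lra.
rewrite ltnS => nT; rewrite !(big_nat_recr T.+1) ?(leqW nT) //=.
have h := IH nT.
have d0 : 0 <= \sum_(n <= s < T.+1) E s - \sum_(n <= s < T.+1) m s.
  by rewrite subr_ge0 mE.
have := ler_wpM2l d0 (wS T nT).
move: h; set A := \sum_(n <= s < T.+1) E s; set B := \sum_(n <= s < T.+1) m s.
nra.
Qed.

(** Telescopes by [1 / T.+1 ^+ 2 <= 1 / T - 1 / T.+1]; the first term is 1. *)
Lemma sum_inv_sq_le (R : realType) (n T : nat) : (0 < n)%N -> (n <= T)%N ->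
  \sum_(n <= s < T.+1) (n%:R / s%:R) ^+ 2 <= 1 + n%:R :> R.
Proof.
move=> n0 nT.
have nR : 0 < n%:R :> R by rewrite ltr0n.
suff : \sum_(n <= s < T.+1) (n%:R / s%:R) ^+ 2 <= 1 + n%:R - n%:R ^+ 2 / T%:R :> R.
  have : 0 <= n%:R ^+ 2 / T%:R :> R by rewrite divr_ge0 // exprn_ge0.
  by lra.
elim: T nT => [|T IH]; first by rewrite leqn0 => /eqP n00; rewrite n00 in n0.
rewrite leq_eqVlt => /predU1P[<-|].
  rewrite big_nat1 divff ?gt_eqF // expr1n expr2 mulfK ?gt_eqF //; lra.
rewrite ltnS => nT; rewrite big_nat_recr ?(leqW nT) //=.
have TR : 0 < T%:R :> R by rewrite ltr0n (leq_trans n0 nT).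
have h : (n%:R / T.+1%:R) ^+ 2 <= n%:R ^+ 2 / T%:R - n%:R ^+ 2 / T.+1%:R :> R.
  rewrite exprMn -mulrBr ler_pM2l ?exprn_gt0 //.
  rewrite (_ : T%:R^-1 - T.+1%:R^-1 = (T%:R * T.+1%:R)^-1 :> R); last first.
    by rewrite -natr1; field; rewrite natr1 !gt_eqF.
  rewrite exprVn lef_pV2 ?posrE ?mulr_gt0 ?exprn_gt0 // expr2 ler_pM2r //.
  by rewrite ler_nat.
by apply: le_trans (lerD (IH nT) h) _; rewrite addrA subrK.
Qed.

Lemma counting_ge (R : realType) (A : set nat) (M : nat) :
  ((\sum_(0 <= k < M) (k \in A)%:R)%:E <= (counting A : \bar R))%E.
Proof.
rewrite /counting; case: asboolP => [fA|_]; last by rewrite leey.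
rewrite lee_fin -natr_sum ler_nat.
rewrite /index_iota subn0.
rewrite big_mkcond /= (eq_bigr (fun k => if k \in A then 1%N else 0%N)); last first.
  by move=> k _; case: (k \in A).
rewrite -big_mkcond sum1_count -size_filter.
apply: uniq_leq_size; first by rewrite filter_uniq // iota_uniq.
by move=> k; rewrite mem_filter in_fset_set // => /andP[].
Qed.

Section resampled_tail.
Context {R : realType} {D : eqType}.
Context (d : measure_display) (Omega : measurableType d)
  (P : probability Omega R) (V : D -> {RV P >-> R}).
Hypothesis indepV : mutually_independent V.
Local Notation space := (coord_space R D).

(** Resampling coordinate [i] does not affect [A], so the integral over that coordinate factors
    out. *)
Lemma joint_law_indep (i : D) (A : set space) (B : set R) :
  measurable A -> measurable B ->
  (forall v z, A (upd v i z) <-> A v) ->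
  joint_law V (A `&` [set v | B (v i)]) =
    (joint_law V A * distribution P (V i) B)%E.
Proof.
move=> mA mB Ai.
have mAB : measurable (A `&` [set v : space | B (v i)]).
  apply: measurableI => //; rewrite -[X in measurable X]setTI.
  exact: measurable_coord.
rewrite -[in LHS](setIT (A `&` _)) -integral_indic //.
rewrite (integral_resample indepV i) //; last first.
  by apply/measurable_EFinP; exact: measurable_indic.
transitivity (\int[joint_law V]_v ((\1_A v)%:E * distribution P (V i) B))%E.
  apply: eq_integral => v _.
  have E z : ((\1_(A `&` [set v : space | B (v i)]) (upd v i z))%:E =
      (\1_A v)%:E * (\1_B z)%:E :> \bar R)%E.
    rewrite -EFinM; congr (_%:E); rewrite !indicE -natrM mulnb; congr (_%:R).
    congr nat_of_bool; apply/idP/andP; rewrite !inE /= upd_same.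
      by move=> [/Ai ? ?].
    by move=> [? ?]; split => //; apply/Ai.
  under eq_integral do rewrite E.
  rewrite ge0_integralZl //; last by apply/measurable_EFinP; exact: measurable_indic.
  by rewrite integral_indic // setIT.
rewrite ge0_integralZr //; last by apply/measurable_EFinP; exact: measurable_indic.
by rewrite integral_indic // setIT.
Qed.

End resampled_tail.

Section noise_union_bound.
Context {R : realType} {N : nat} (xi : nat -> R) (alpha : R) (n : nat).
Context (X : nat -> 'I_N -> R) (F : strategy R N).
Hypotheses (N0 : (0 < N)%N) (n0 : (0 < n)%N) (qF : query_stream n F)
  (alpha0 : 0 < alpha).
Hypotheses (xi_gt0 : forall t, (n <= t)%N -> 0 < xi t)
  (xi_le : forall s t, (n <= s <= t)%N -> xi s <= xi t).
Context (d : measure_display) (Omega : measurableType d)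
  (P : probability Omega R) (V : draw -> {RV P >-> R}).
Hypothesis hV : noise_draws n xi V.
Local Notation noise := (coord_space R draw).
Local Notation mu := (joint_law V).
Local Notation code := (query_code xi alpha n X F).
Local Notation tr := (run_transcript xi alpha n X F).

Definition asked_at k t : set noise := [set v | code v k = t.+1].

Lemma measurable_asked_at k t : measurable (asked_at k t).
Proof. exact: measurable_code. Qed.

Lemma asked_at_local k t i (v : noise) z : draw_step i = k ->
  asked_at k t (upd v i z) <-> asked_at k t v.
Proof.
move=> ik; have same : same_before k (upd v i z) v.
  move=> j jk; rewrite upd_other //; apply: contraTneq jk => ->.
  by rewrite ik ltnn.
by rewrite /asked_at /=; have [_ _ -> _] := same_before_run xi alpha n X F same.
Qed.

Lemma asked_at_ge k t v : asked_at k t v -> (n <= t)%N.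
Proof.
rewrite /asked_at /= /query_code; case E : (F _) => [[t' f]|] //= [<-].
by move: E; rewrite -askedE => /(qs_linear qF)[].
Qed.

(* [alpha * xi t / 24] is the smallest of the three exponents, that of [Zed]. *)
Definition tail_level t : R := 2 * expR (- (alpha * xi t / 24)).

(** Whether query [k] arrives at time [t] is decided before the draws of step [k], hence
    independently of draw [i]. *)
Lemma asked_at_tail k t i (b u : R) : draw_step i = k -> 0 < b -> 0 <= u ->
  laplace_distributed (V i) b -> alpha * xi t / 24 <= u / b ->
  (mu (asked_at k t `&` [set v | (u <= `|v i|)%R]) <=
   mu (asked_at k t) * (tail_level t)%:E)%E.
Proof.
move=> ik b0 u0 lapi lev.
have mB : measurable [set z : R | (u <= `|z|)%R].
  apply/measurable_bool_set; apply: measurable_fun_ler => //.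
rewrite (joint_law_indep (noise_indep hV) (measurable_asked_at k t) mB); last first.
  by move=> v z; exact: asked_at_local.
apply: lee_wpmul2l => //; apply: le_trans (laplace_tail b0 lapi u0) _.
by rewrite lee_fin /tail_level ler_pM2l // ler_expR lerN2.
Qed.

Definition bad k t : set noise := \big[setU/set0]_(b : bool)
  ((asked_at k t `&` [set v | (alpha / 9 * xi t <= `|v (Eta k b)|)%R]) `|`
   (asked_at k t `&` [set v | (2 / 9 * alpha <= `|v (Nu k t b)|)%R]) `|`
   (asked_at k t `&` [set v | (alpha / 3 <= `|v (Zed k t b)|)%R])).

Let measurable_tail k t i (u : R) :
  measurable (asked_at k t `&` [set v : noise | (u <= `|v i|)%R]).
Proof.
apply: measurableI; first exact: measurable_asked_at.
apply/measurable_bool_set; apply: measurable_fun_ler => //.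
by apply: measurableT_comp => //; exact: measurable_coord.
Qed.

Lemma measurable_bad k t : measurable (bad k t).
Proof.
apply: bigsetU_measurable => b _.
by apply: measurableU; first apply: measurableU.
Qed.

Lemma not_bad_small k t v : asked_at k t v -> ~ bad k t v -> small_noise xi alpha v k t.
Proof.
move=> av nb b; rewrite !ltNge.
have inB : (asked_at k t `&` [set v | (alpha / 9 * xi t <= `|v (Eta k b)|)%R]) v \/
   (asked_at k t `&` [set v | (2 / 9 * alpha <= `|v (Nu k t b)|)%R]) v \/
   (asked_at k t `&` [set v | (alpha / 3 <= `|v (Zed k t b)|)%R]) v -> bad k t v.
  move=> hh; rewrite /bad (bigD1 b) //=; left.
  by case: hh => [?|[?|?]]; [left; left|left; right|right].
split; apply/negP => hh; apply: nb; apply: inB.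
- by left.
- by right; left.
- by right; right.
Qed.

(** Six tails: three kinds of draws for each of the two submitted queries, with exponents
    [alpha * xi t / 18] for [Eta] and [Nu] and [alpha * xi t / 24] for [Zed]. *)
Lemma bad_le k t : (mu (bad k t) <= mu (asked_at k t) * (6 * tail_level t)%:E)%E.
Proof.
have [nt|tn] := leqP n t; last first.
  rewrite (_ : bad k t = set0) ?measure0; last first.
    rewrite /bad big1 // => b _; rewrite (_ : asked_at k t = set0) ?set0I ?setU0 //.
    apply/seteqP; split => v // /asked_at_ge; rewrite leqNgt tn //.
  by rewrite mule_ge0 // lee_fin /tail_level mulr_ge0 // mulr_ge0 // expR_ge0.
have x0 := xi_gt0 nt.
have ax0 : 0 <= alpha * xi t by rewrite mulr_ge0 // ltW.
set a := mu (asked_at k t).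
have aE : a = (fine a)%:E.
  by rewrite fineK // fin_num_measure //; exact: measurable_asked_at.
have tl b : (mu ((asked_at k t `&` [set v | (alpha / 9 * xi t <= `|v (Eta k b)|)%R]) `|`
   (asked_at k t `&` [set v | (2 / 9 * alpha <= `|v (Nu k t b)|)%R]) `|`
   (asked_at k t `&` [set v | (alpha / 3 <= `|v (Zed k t b)|)%R])) <=
   a * (3 * tail_level t)%:E)%E.
  apply: (@le_trans _ _ (a * (tail_level t)%:E + a * (tail_level t)%:E +
     a * (tail_level t)%:E)%E); last first.
    by rewrite aE -!EFinM -!EFinD lee_fin; lra.
  apply: le_trans (measureU2 _ _ _) _ => //; first exact: measurableU.
  apply: leeD; last first.
    apply: (asked_at_tail (i := Zed k t b) _ _ _ (noise_zed hV k b nt)) => //.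
    - by rewrite divr_gt0.
    - by rewrite divr_ge0 // ltW.
    - by rewrite (_ : alpha / 3 / _ = alpha * xi t / 24) //; field; rewrite gt_eqF.
  apply: le_trans (measureU2 _ _ _) _ => //.
  apply: leeD.
    apply: (asked_at_tail (i := Eta k b) _ _ _ (noise_eta hV k b)) => //.
    - by rewrite mulr_ge0 ?divr_ge0 // ltW.
    - by lra.
  apply: (asked_at_tail (i := Nu k t b) _ _ _ (noise_nu hV k b nt)) => //.
  - by rewrite divr_gt0.
  - by rewrite mulr_ge0 // ltW.
  - rewrite (_ : 2 / 9 * alpha / _ = alpha * xi t / 18); first by lra.
    by field; rewrite gt_eqF.
rewrite /bad big_bool /=.
apply: le_trans (measureU2 _ _ _) _.
- by apply: measurableU => //; exact: measurableU.
- by apply: measurableU => //; exact: measurableU.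
apply: le_trans (leeD (tl true) (tl false)) _.
by rewrite aE -!EFinM -!EFinD lee_fin; lra.
Qed.

Variables (E : nat -> R) (beta : R).
Hypotheses (count_le : forall (a : transcript R) t, (n <= t)%N ->
    (\sum_(n <= s < t.+1) ell F a s <= (\sum_(n <= s < t.+1) E s)%:E)%E)
  (total_le : forall t, (n <= t)%N ->
     \sum_(n <= s < t.+1) E s * (6 * tail_level s) <= beta).

Lemma queries_atE v t : queries_at F (tr v) t = [set k | code v k = t.+1].
Proof.
apply/seteqP; split => k; rewrite /queries_at /= askedE /query_code.
  by move=> [f ->].
by case: (F _) => [[t' f]|] //= [->]; exists f.
Qed.

(** The bound on the number of queries holds along each transcript; integrating it bounds the sum of
    the arrival probabilities. *)
Lemma expected_queries_le M t : (n <= t)%N ->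
  (\sum_(n <= s < t.+1) \sum_(0 <= k < M) mu (asked_at k s) <=
   (\sum_(n <= s < t.+1) E s)%:E)%E.
Proof.
move=> nt.
have mI k s : measurable_fun setT (fun v : noise => ((\1_(asked_at k s) v : R)%:E)).
  by apply/measurable_EFinP; apply: measurable_indic; exact: measurable_asked_at.
have -> : (\sum_(n <= s < t.+1) \sum_(0 <= k < M) mu (asked_at k s) =
  \int[mu]_v (\sum_(n <= s < t.+1) \sum_(0 <= k < M) (\1_(asked_at k s) v)%:E))%E.
  rewrite ge0_integral_sum //; last 2 first.
  - by move=> s; apply: emeasurable_sum => k; exact: mI.
  - by move=> s v _; apply: sume_ge0 => k _; rewrite lee_fin.
  apply: eq_bigr => s _; rewrite ge0_integral_sum //.
  apply: eq_bigr => k _; rewrite integral_indic ?setIT //.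
  exact: measurable_asked_at.
apply: (@le_trans _ _ (\int[mu]_v (cst (\sum_(n <= s < t.+1) E s)%:E) v)%E); last first.
  rewrite integral_cst // [X in (_ * X)%E](_ : _ = 1%E) ?mule1 //.
  exact: probability_setT.
apply: ge0_le_integral => //.
- by move=> v _; apply: sume_ge0 => s _; apply: sume_ge0 => k _; rewrite lee_fin.
- by apply: emeasurable_sum => s; apply: emeasurable_sum => k; exact: mI.
move=> v _; apply: le_trans (count_le (tr v) nt).
apply: lee_sum => s _; rewrite sumEFin.
apply: le_trans (counting_ge _ _ M); rewrite queries_atE lee_fin.
by rewrite le_eqVlt; apply/orP; left; apply/eqP; apply: eq_bigr.
Qed.

Definition bad_upto M : set noise :=
  \bigcup_(k in `I_M) \bigcup_(t in `I_M) bad k t.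

Lemma measurable_bad_upto M : measurable (bad_upto M).
Proof.
apply: bigcup_measurable => k _; apply: bigcup_measurable => t _.
exact: measurable_bad.
Qed.

(** The maximum with 0 covers [M <= n], where no query counts and [total_le] gives nothing. *)
Lemma bad_upto_le M : (mu (bad_upto M) <= (Num.max beta 0)%:E)%E.
Proof.
have tl0 s : 0 <= 6 * tail_level s by rewrite !mulr_ge0 // expR_ge0.
apply: (@le_trans _ _ (\sum_(k < M) \sum_(t < M) mu (bad k t))%E).
  have -> : bad_upto M = \big[setU/set0]_(k < M) \big[setU/set0]_(t < M) bad k t.
    by rewrite /bad_upto bigcup_mkord; apply: eq_bigr => k _; rewrite bigcup_mkord.
  have mb k : measurable (\big[setU/set0]_(t < M) bad k t).
    by apply: bigsetU_measurable => t _; exact: measurable_bad.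
  have /le_trans := @Boole_inequality _ _ _ mu
    (fun k => \big[setU/set0]_(t < M) bad k t) M (fun k _ => mb k); apply.
  apply: lee_sum => k _.
  exact: (@Boole_inequality _ _ _ mu (bad k) M (fun t _ => measurable_bad k t)).
apply: (@le_trans _ _ (\sum_(k < M) \sum_(t < M)
    mu (asked_at k t) * (6 * tail_level t)%:E)%E).
  by apply: lee_sum => k _; apply: lee_sum => t _; exact: bad_le.
pose m (k t : nat) := fine (mu (asked_at k t)).
have mE k t : mu (asked_at k t) = (m k t)%:E.
  by rewrite /m fineK // fin_num_measure //; exact: measurable_asked_at.
have m0 k t : (t < n)%N -> m k t = 0.
  move=> tn; rewrite /m (_ : asked_at k t = set0) ?measure0 //.
  by apply/seteqP; split => v // /asked_at_ge; rewrite leqNgt tn.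
have -> : (\sum_(k < M) \sum_(t < M) mu (asked_at k t) * (6 * tail_level t)%:E =
    (\sum_(0 <= t < M) (\sum_(0 <= k < M) m k t) * (6 * tail_level t))%:E)%E.
  rewrite exchange_big /= big_mkord -sumEFin; apply: eq_bigr => t _.
  rewrite big_mkord mulr_suml -sumEFin; apply: eq_bigr => k _.
  by rewrite mE EFinM.
rewrite lee_fin.
have [Mn|nM] := leqP M n.
  rewrite big_nat big1; first by rewrite le_max lexx orbT.
  move=> t /andP[_ tM]; rewrite big1 ?mul0r // => k _.
  exact: m0 (leq_trans tM Mn).
rewrite (@big_cat_nat _ _ _ n) //=; last exact: ltnW.
rewrite [X in X + _]big_nat [X in X + _]big1 ?add0r; last first.
  by move=> t /andP[_ tn]; rewrite big1 ?mul0r // => k _; exact: m0.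
case: M nM m0 mE => // M nM m0 mE; rewrite ltnS in nM.
rewrite le_max; apply/orP; left; apply: le_trans (total_le nM).
apply: abel_summation_le => //.
- move=> s ns; rewrite ler_pM2l // ler_pM2l // ler_expR lerN2.
  rewrite ler_pM2r // ler_pM2l //; apply: xi_le; rewrite ns leqnSn //.
- move=> t nt; have := expected_queries_le M.+1 nt.
  rewrite -lee_fin => /(le_trans _); apply.
  rewrite -sumEFin; apply: lee_sum => s _; rewrite -sumEFin.
  by apply: lee_sum => k _; rewrite mE.
Qed.

Lemma bad_union_le :
  (mu (\bigcup_M bad_upto M) <= (Num.max beta 0)%:E)%E.
Proof.
have nd M M' : (M <= M')%N -> bad_upto M `<=` bad_upto M'.
  move=> MM' v [k kM [t tM bkt]]; exists k; first exact: leq_trans MM'.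
  by exists t => //; exact: leq_trans MM'.
have cv : (mu \o bad_upto) M @[M --> \oo] --> mu (\bigcup_M bad_upto M).
  apply: nondecreasing_cvg_mu.
  - exact: measurable_bad_upto.
  - by apply: bigcupT_measurable; exact: measurable_bad_upto.
  - by move=> M M' MM'; apply/subsetPset; exact: nd.
rewrite -(cvg_lim _ cv) //; apply: lime_le; first by apply/cvg_ex; eexists; exact: cv.
by near=> M; exact: bad_upto_le.
Unshelve. all: by end_near. Qed.

End noise_union_bound.

(** * Accuracy *)

Section accuracy.
Context {R : realType} {N : nat} (xi : nat -> R) (alpha : R) (n : nat).
Context (X : nat -> 'I_N -> R) (F : strategy R N).
Hypotheses (N0 : (0 < N)%N) (n0 : (0 < n)%N) (qF : query_stream n F)
  (dX : database_stream n X) (alpha0 : 0 < alpha).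
Hypotheses (xi_gt0 : forall t, (n <= t)%N -> 0 < xi t)
  (xi_le : forall s t, (n <= s <= t)%N -> xi s <= xi t).
Context (d : measure_display) (Omega : measurableType d)
  (P : probability Omega R) (V : draw -> {RV P >-> R}).
Hypothesis hV : noise_draws n xi V.
Local Notation noise := (coord_space R draw).
Local Notation mu := (joint_law V).
Local Notation code := (query_code xi alpha n X F).
Local Notation query := (query_fun xi alpha n X F).
Local Notation tr := (run_transcript xi alpha n X F).
Local Notation asked_at := (asked_at xi alpha n X F).

Definition accurate_event : set noise :=
  [set v | forall k t f, asked F (tr v) k = Some (t, f) ->
     exists2 a, tr v k = Some a & `|lin f (X t) - a| <= alpha].

Lemma measurable_accurate_event : measurable accurate_event.
Proof.
pose ok k t : set noise := [set v | isSome (tr v k) &&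
  (`|lin (query v k) (X t) - odflt 0 (tr v k)| <= alpha)].
have mok k t : measurable (ok k t).
  have /mobs_optionP[m1 m2] := mobs_run_transcript xi alpha X N0 qF k.
  apply/measurable_bool_set; apply: measurable_and => //.
  apply: measurable_fun_ler => //; apply: measurableT_comp => //.
  apply: measurable_funB => //.
  by apply: (@measurable_lin _ _ _ _ _ (fun=> X t)) => // i; exact: measurable_query.
rewrite (_ : accurate_event = ~` \bigcup_k \bigcup_t (asked_at k t `\` ok k t)).
  apply: measurableC; apply: bigcupT_measurable => k; apply: bigcupT_measurable => t.
  by apply: measurableD => //; exact: measurable_asked_at.
apply/seteqP; split => v /=.
  move=> acc [k _ [t _ [at_kt]]]; apply.
  have Fk : asked F (tr v) k = Some (t, query v k).
    move: at_kt; rewrite askedE /asked_at /query_code /query_fun /=.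
    by case: (F _) => [[t' f]|] //= [->].
  by have [a /= ae le] := acc _ _ _ Fk; rewrite /ok /= ae.
move=> nb k t f Fk.
have [cE fE] : code v k = t.+1 /\ query v k = f.
  by move: Fk; rewrite askedE /query_code /query_fun => ->.
have : ok k t v.
  by apply: contrapT => nok; apply: nb; exists k => //; exists t.
rewrite /ok /= fE; case: (tr v k) => [a|] //= le.
by exists a.
Qed.

Lemma inaccurate_bad : ~` accurate_event `<=` \bigcup_M bad_upto xi alpha n X F M.
Proof.
move=> v nacc; apply: contrapT => nbad; apply: nacc => k t f.
rewrite askedE run_transcriptE.
apply: (accurate_answer N0 n0 qF dX alpha0 xi_gt0 xi_le) => {}k {}t {}f Fk.
apply: (@not_bad_small _ _ xi alpha n X F).
  by rewrite /asked_at /= /query_code Fk.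
move=> bkt; apply: nbad; exists (maxn k t).+1 => //.
by exists k; [rewrite /= ltnS leq_maxl|exists t; rewrite //= ltnS leq_maxr].
Qed.

Variables (E : nat -> R) (beta : R).
Hypotheses (beta0 : 0 <= beta)
  (count_le : forall (a : transcript R) t, (n <= t)%N ->
    (\sum_(n <= s < t.+1) ell F a s <= (\sum_(n <= s < t.+1) E s)%:E)%E)
  (total_le : forall t, (n <= t)%N ->
     \sum_(n <= s < t.+1) E s * (6 * tail_level xi alpha s) <= beta).

Lemma accurate_event_ge : ((1 - beta)%:E <= mu accurate_event)%E.
Proof.
have macc := measurable_accurate_event.
have mbad : measurable (\bigcup_M bad_upto xi alpha n X F M).
  by apply: bigcupT_measurable => M; exact: measurable_bad_upto.
have bad_le : (mu (~` accurate_event) <= beta%:E)%E.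
  apply: (@le_trans _ _ (mu (\bigcup_M bad_upto xi alpha n X F M))).
    by apply: le_measure; rewrite ?inE //; [exact: measurableC|exact: inaccurate_bad].
  have := bad_union_le X N0 qF alpha0 xi_gt0 xi_le hV count_le total_le.
  by rewrite max_l.
move: bad_le; rewrite probability_setC //.
have -> : mu accurate_event = (fine (mu accurate_event))%:E.
  by rewrite fineK // fin_num_measure.
by rewrite -EFinB !lee_fin; lra.
Qed.

End accuracy.

(** * Constants of the accuracy bound *)

Section accuracy_numerics.
Context {R : realType} (N n : nat) (p eps alpha kappa beta : R).
Hypotheses (hp : 1 / 4 <= p < 1) (hN : (3 <= N)%N) (hn : (17 <= n)%N)
  (heps : 0 < eps) (halpha : 0 < alpha) (hkappa : 1 <= kappa)
  (hbeta : 0 < beta < 2 `^ (- (15 / 2))).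
Hypothesis alpha_ge : (6426 * ln (N * n)%:R * ln (144 * kappa * n%:R / beta)
      / ((1 - p) ^+ 2 * n%:R * eps)) `^ (1 / 3) <= alpha.
Local Notation xi := (xi_noise N eps 0 alpha n p).
Local Notation L := (ln (N * n)%:R).
Let lam := ln (144 * kappa * n%:R / beta).
Let n0 : (0 < n)%N. Proof. exact: leq_trans hn. Qed.
Let nR : 0 < n%:R :> R. Proof. by rewrite ltr0n. Qed.
Let L0 : 0 < L :> R. Proof. exact: ln_prod_gt0. Qed.
Let q0 : 0 < 1 - p. Proof. by case/andP: hp => ? ?; lra. Qed.

Let beta_gt0 : 0 < beta. Proof. by case/andP: hbeta. Qed.

Lemma beta_lt : beta < 1 / 4.
Proof.
case/andP: hbeta => _ /lt_le_trans; apply.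
rewrite (_ : 1 / 4 = 2 `^ (- 2%:R)); first by rewrite ler_powR //; lra.
by rewrite powRN powR_mulrn // div1r; congr (_^-1); rewrite expr2; lra.
Qed.

Let kappa_gt0 : 0 < kappa. Proof. exact: lt_le_trans ltr01 hkappa. Qed.

Let ratio_gt0 : 0 < 144 * kappa * n%:R / beta.
Proof. by rewrite divr_gt0 // mulr_gt0 // mulr_gt0. Qed.

Lemma lam_ge : 8 <= lam.
Proof.
rewrite /lam -ler_expR lnK ?posrE //.
rewrite (_ : 8 = (1 / 8) * 64%:R); last by lra.
rewrite expRM_natr; apply: (@le_trans _ _ ((8 / 7) ^+ 64)).
  by rewrite lerXn2r ?nnegrE ?expR_ge0 ?expR_eighth_le.
(* [(8 / 7) ^+ 64] is below 5200; the new bound is the value at [kappa = 1], [n = 17],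
   [beta = 1 / 4]. *)
apply: (@le_trans _ _ (144 * 17 * 4)); first by lra.
rewrite ler_pdivlMr //.
have n17 : 17 <= n%:R :> R by rewrite (ler_nat R 17).
have kn : 17 <= kappa * n%:R by apply: le_trans n17 _; rewrite ler_peMl // ltW.
by have := beta_lt; rewrite -mulrA; lra.
Qed.

Lemma cube_root_le (Y a : R) : 0 <= Y -> 0 <= a -> Y `^ (1 / 3) <= a -> Y <= a ^+ 3.
Proof.
move=> Y0 a0 Ya.
have -> : Y = (Y `^ (1 / 3)) ^+ 3.
  by rewrite -powR_mulrn ?powR_ge0 // -powRrM mul1r mulVf // powRr1.
by rewrite lerXn2r ?nnegrE ?powR_ge0.
Qed.

(** The cube of the lower bound on [alpha], with [6426 = 51 * 126] and 126 the constant of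
    [xi_noise]. *)
Lemma scaled_noise_ge : 51 * lam <= alpha * (alpha ^+ 2 * (1 - p) ^+ 2 / (126 * L) * eps) * n%:R.
Proof.
have lam0 : 0 <= lam by apply: le_trans lam_ge.
have D0 : 0 < (1 - p) ^+ 2 * n%:R * eps by rewrite !mulr_gt0 ?exprn_gt0.
have c0 : (0 : R) <= 6426 by exact: ler0n.
have Y0 : 0 <= 6426 * L * lam / ((1 - p) ^+ 2 * n%:R * eps).
  by apply: divr_ge0 (ltW D0); apply: mulr_ge0 lam0; apply: mulr_ge0 c0 (ltW L0).
have := cube_root_le Y0 (ltW halpha) alpha_ge.
rewrite (ler_pdivrMr _ _ D0) => h.
rewrite (_ : alpha * _ * _ = alpha ^+ 3 * ((1 - p) ^+ 2 * n%:R * eps) / (126 * L)).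
  rewrite ler_pdivlMr ?mulr_gt0 //; apply: le_trans h.
  by rewrite (_ : 6426 = 51 * 126 :> R); [lra|rewrite -natrM].
by field; rewrite gt_eqF.
Qed.

(** With [dd = ln s - ln n], [alpha * xi s] is at least [51 * lam * expR (p * dd)], hence at least
    [51 * lam * (1 + p * dd)]. By [p >= 1/4] and [lam >= 8], the part with [dd], divided by 48, is
    at least [51 * 8 / (4 * 48) * dd], which is at least [2 * dd]. *)
Lemma noise_level_ge s : (n <= s)%N ->
  lam + 2 * (ln s%:R - ln n%:R) <= alpha * xi s / 48.
Proof.
move=> ns; have s0 := leq_trans n0 ns.
have lam0 := lam_ge; have sc := scaled_noise_ge.
have [p1 p2] := andP hp.
have d0 : 0 <= ln s%:R - ln n%:R :> R.
  by rewrite subr_ge0 ler_ln ?posrE ?ltr0n // ler_nat.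
rewrite xi_noiseE //.
rewrite (_ : (1 - p) * ln n%:R + p * ln s%:R =
  ln n%:R + p * (ln s%:R - ln n%:R)); last by ring.
rewrite expRD lnK ?posrE //.
set dd := ln s%:R - ln n%:R in d0 *.
have e := expR_ge1Dx (p * dd).
have C0 : 0 <= alpha * (alpha ^+ 2 * (1 - p) ^+ 2 / (126 * L) * eps) * n%:R by lra.
have := ler_pM (_ : 0 <= 51 * lam) (_ : 0 <= 1 + p * dd) sc e.
have pd : 1 / 4 * dd <= p * dd by rewrite ler_wpM2r.
have pd0 : 0 <= p * dd by lra.
have ld : 8 * (p * dd) <= lam * (p * dd) by rewrite ler_wpM2r.
move=> /(_ _ _) h; rewrite ler_pdivlMr //.
have {}h : 51 * lam * (1 + p * dd) <= alpha * (alpha ^+ 2 * (1 - p) ^+ 2 / (126 * L) * eps *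
    (n%:R * expR (p * dd))).
  rewrite (_ : alpha * (_ * (n%:R * _)) = alpha * (alpha ^+ 2 * (1 - p) ^+ 2 / (126 * L) * eps) *
     n%:R * expR (p * dd)); last by ring.
  by apply: h; lra.
by apply: le_trans h; lra.
Qed.

(** As [6048 = 48 * 126], the exponent is [alpha * xi s / 48], half of that in [tail_level]. *)
Definition query_rate (s : nat) : R :=
  kappa * expR (alpha ^+ 3 * (1 - p) ^+ 2 * eps * n%:R `^ (1 - p)
                    * s%:R `^ p / (6048 * L)).

(** Half of the tail exponent pays for the number of queries. The other half leaves at most
    [12 * kappa * expR (- lam) * (n / s) ^+ 2] at time [s], which is summable; by the choice of
    [lam] the total is at most [beta * (1 + n) / (12 * n)]. *)
Lemma query_rate_tail t : (n <= t)%N ->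
  \sum_(n <= s < t.+1) query_rate s * (6 * tail_level xi alpha s) <= beta.
Proof.
move=> nt.
apply: (@le_trans _ _ (\sum_(n <= s < t.+1) (12 * kappa * expR (- lam)) * (n%:R / s%:R) ^+ 2)).
  apply: ler_sum_nat => s /andP[ns _].
  have s0 := leq_trans n0 ns.
  rewrite /query_rate /tail_level.
  rewrite (_ : alpha ^+ 3 * _ * _ * _ * _ / _ = alpha * xi s / 48); last first.
    by rewrite /xi_noise eqxx; field; rewrite gt_eqF.
  rewrite (_ : kappa * _ * _ = 12 * kappa * expR (- (alpha * xi s / 48))); last first.
    rewrite (_ : - (alpha * xi s / 48) = alpha * xi s / 48 - alpha * xi s / 24).
      by rewrite expRD; ring.
    by field.
  rewrite -[leRHS]mulrA ler_pM2l; last by rewrite mulr_gt0.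
  rewrite (_ : (n%:R / s%:R) ^+ 2 = expR (- (2 * (ln s%:R - ln n%:R)))).
    by rewrite -expRD ler_expR -opprD lerN2; exact: noise_level_ge.
  by rewrite -mulrN opprB expRM_natl expRD expRN !lnK ?posrE ?ltr0n.
rewrite -mulr_sumr.
have c0 : 0 <= 12 * kappa * expR (- lam) by rewrite mulr_ge0 ?expR_ge0 // mulr_ge0 // ltW.
apply: le_trans (ler_wpM2l c0 (sum_inv_sq_le R n0 nt)) _.
rewrite expRN /lam lnK ?posrE // invf_div.
have n17 : 17 <= n%:R :> R by rewrite (ler_nat R 17).
rewrite [leLHS](_ : _ = beta * ((1 + n%:R) / (12 * n%:R))); last first.
  by field; rewrite !gt_eqF.
rewrite ger_pMr // ler_pdivrMr ?mulr_gt0 //; lra.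
Qed.

End accuracy_numerics.

Theorem theorem27 (R : realType) (d : measure_display)
    (Omega : measurableType d) (P : probability Omega R)
    (N n : nat) (p eps alpha : R) (V : draw -> {RV P >-> R})
    (hp : 1 / 4 <= p < 1) (hN : (3 <= N)%N) (hn : (17 <= n)%N)
    (heps : 0 < eps) (halpha : 0 < alpha)
    (hV : noise_draws n (xi_noise N eps 0 alpha n p) V) :
  (alpha <= 1 ->
   forall F : strategy R N, query_stream n F ->
     differentially_private P n
       (fun X => pmwg V X F eps 0 alpha n p) eps 0) /\
  (forall kappa beta : R, 1 <= kappa -> 0 < beta < 2 `^ (- (15 / 2)) ->
   (6426 * ln (N * n)%:R * ln (144 * kappa * n%:R / beta)
      / ((1 - p) ^+ 2 * n%:R * eps)) `^ (1 / 3) <= alpha ->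
   forall F : strategy R N, query_stream n F ->
     (forall (a : transcript R) (t : nat), (n <= t)%N ->
        (\sum_(n <= s < t.+1) ell F a s <=
         (kappa * \sum_(n <= s < t.+1)
            expR (alpha ^+ 3 * (1 - p) ^+ 2 * eps * n%:R `^ (1 - p)
                    * s%:R `^ p / (6048 * ln (N * n)%:R)))%:E)%E) ->
     accurate P n (fun X => pmwg V X F eps 0 alpha n p) F alpha beta).
Proof.
have N0 : (0 < N)%N := leq_trans (isT : (0 < 3)%N) hN.
have n0 : (0 < n)%N := leq_trans (isT : (0 < 17)%N) hn.
have xi0 := xi_noise_gt0 hp hN hn heps halpha.
split.
  move=> alpha1 F qF X X' _ _ nb S eS.
  rewrite adde0.
  apply: (transcript_privacy N0 n0 qF xi0 (sens_noise_le alpha hp hN hn heps)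
    (neighboring_close nb) hV _ eS).
  exact: (run_loss_le X qF xi0 (sens_noise_le alpha hp hN hn heps)
    (hard_bound_ge0 n hN halpha) (hard_bound_le hN hn halpha)
    (loss_budget hp hN hn heps halpha alpha1)).
move=> kappa beta hk hb ha F qF hF X dX.
apply: (accurate_event_ge N0 n0 qF dX halpha xi0 (xi_noise_le alpha hp hN hn heps) hV
  (E := query_rate N n p eps alpha kappa)).
- by case/andP: hb => /ltW.
- by move=> a t nt; have := hF a t nt; rewrite mulr_sumr.
- exact: query_rate_tail.
Qed.
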